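(* Let $k$ be a commutative ring or a field, and let $\mathcal C$ be a cooperad with comultiplication in $k$-modules, with homology $H_\bullet(\mathcal C)=H(\mathcal C_\bullet,d)$, where $\mathcal C(n)$ is in degree $n$ and $d$ is the differential induced by the comultiplication. Then $H_\bullet(\mathcal C)$, with the coproduct induced by the cup coproduct $\cup^c$ of $\mathcal C$ and the cobracket induced by the canonical cobracket $\{-\}$ of $\mathcal C$, is a Gerstenhaber coalgebra.
   Context: Throughout, $k$ is a commutative ring or a field (of characteristic zero if need be). Tensor products are over $k$, and $k\otimes M\cong M\cong M\otimes k$ is used implicitly. A planar counital cooperad is a sequence $\mathcal C=\{\mathcal C(n)\}_{n\ge0}$ of $k$-modules with $k$-linear maps $\epsilon\colon\mathcal C(1)\to k$ and $\Delta_{p,q,i}\colon\mathcal C(p+q-1)\to\mathcal C(p)\otimes\mathcal C(q)$ for $p\ge1$, $q\ge0$, $1\le i\le p$ (and $\Delta_{0,q,i}:=0$), such that $(\epsilon\otimes\mathrm{id})\circ\Delta_{1,n,1}=\mathrm{id}_{\mathcal C(n)}$, $(\mathrm{id}\otimes\epsilon)\circ\Delta_{n,1,i}=\mathrm{id}_{\mathcal C(n)}$ for $1\le i\le n$, and for all $p\ge 1$, $q,r\ge0$, $1\le i\le p$, $1\le j\le p+q-1$: $$(\Delta_{p,q,i}\otimes\mathrm{id})\circ\Delta_{p+q-1,r,j}=\begin{cases}(\mathrm{id}\otimes\sigma)\circ(\Delta_{p,r,j-q+1}\otimes\mathrm{id})\circ\Delta_{p+r-1,q,i}& i\le j-q,\\(\mathrm{id}\otimes\Delta_{q,r,j-i+1})\circ\Delta_{p,q+r-1,i}&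 j-q<i\le j,\\(\mathrm{id}\otimes\sigma)\circ(\Delta_{p,r,j}\otimes\mathrm{id})\circ\Delta_{p+r-1,q,i+r-1}& j<i\le p,\end{cases}$$ where $\sigma(a\otimes b)=b\otimes a$. A cooperad with comultiplication is a planar counital cooperad $\mathcal C$ with a morphism of counital cooperads to the linear dual of the unital associative operad; equivalently, with $k$-linear maps $\mu^c\colon\mathcal C(2)\to k$ and $e^c\colon\mathcal C(0)\to k$ such that $(\mu^c\otimes\mu^c)\circ\Delta_{2,2,1}=(\mu^c\otimes\mu^c)\circ\Delta_{2,2,2}$ and $(\mu^c\otimes e^c)\circ\Delta_{2,0,1}=(\mu^c\otimes e^c)\circ\Delta_{2,0,2}=\epsilon$. Differential: on $\mathcal C(n)$, $n\geq 1$, $d=(\mu^c\otimes\mathrm{id})\circ\big(\Delta_{2,n-1,2}+(-1)^n\Delta_{2,n-1,1}\big)+\sum_{i=1}^{n-1}(-1)^i(\mathrm{id}\otimes\mu^c)\circ\Delta_{n-1,2,i}\colon\mathcal C(n)\to\mathcal C(n-1)$ and $d=0$ on $\mathcal C(0)$. Cup coproduct: for $x\in\mathcal C(n)$, $\cup^cx=\sum_{j=1}^{n+1}(\mu^c\otimes\mathrm{id}^{\otimes2})\circ(\Delta_{2,j-1,1}\otimes\mathrm{id})\circ\Delta_{j,n+1-j,j}(x)$. Cobracket: $\{-\}=(\mathrm{id}-\rho)\circ[-]$ with $[x]=\sum_{p=1}^{n+1}\sum_{i=1}^{p}(-1)^{(n-p)(p-i)}\Delta_{p,n+1-p,i}(x)$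 for $x\in\mathcal C(n)$. Flips, on homogeneous elements: $\tau(a\otimes b)=(-1)^{|a||b|}b\otimes a$, $\rho(a\otimes b)=(-1)^{(|a|-1)(|b|-1)}b\otimes a$, $\varrho(a\otimes b)=(-1)^{|a|(|b|-1)}b\otimes a$. The differential $d$ is a coderivation of $\cup^c$ (with $\mathcal C(n)$ in degree $n$) and of $\{-\}$ (with $\mathcal C(n)$ in degree $n-1$). A Gerstenhaber coalgebra is a graded $k$-module $V=\bigoplus_{n\ge0}V_n$ with a coassociative coproduct $\cup^c\colon V_n\to\bigoplus_{p+q=n}V_p\otimes V_q$ that is graded cocommutative ($\tau\circ\cup^c=\cup^c$), and a graded Lie cobracket $\{-\}\colon V_n\to\bigoplus_{p+q=n+1}V_p\otimes V_q$ of degree $+1$, meaning a Lie cobracket for the shifted grading: $\mathrm{Im}(\{-\})\subseteq\mathrm{Im}(\mathrm{id}-\rho)$ and $\big(\mathrm{id}+(\mathrm{id}\otimes\rho)\circ(\rho\otimes\mathrm{id})+(\rho\otimes\mathrm{id})\circ(\mathrm{id}\otimes\rho)\big)\circ(\{-\}\otimes\mathrm{id})\circ\{-\}=0$; these must satisfy the coLeibniz identity $$(\mathrm{id}\otimes\cup^c)\circ\{-\}=\big(\{-\}\otimes\mathrm{id}+(\varrho\otimes\mathrm{id})\circ(\mathrm{id}\otimes\{-\})\big)\circ\cup^c.$$ Here $\mathrm{id}\otimes\{-\}$ etc. are applied without extra Koszul signs, e.g. $(\mathrm{id}\otimes\{-\})(a\otimes b)=a\otimes\{b\}$.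
   Formalization: When k is not a field, the Künneth property is assumed (double tensors bijective, triple tensors and ρ-coinvariants injective), since otherwise the coproduct and cobracket need not descend to H⊗H; without it the identities are proved only up to boundaries. *)

(* Defs.v *)
From HB Require Import structures.
From mathcomp Require Import all_boot all_order all_algebra.
From mathcomp Require Import sesquilinear.
From mathcomp Require Import boolp.
From mathcomp Require Import freeg.

Set Implicit Arguments.
Unset Strict Implicit.
Unset Printing Implicit Defensive.

Import GRing.Theory.
Local Open Scope ring_scope.
Local Open Scope quotient_scope.

Section QuotientModule.
Variables (k : comNzRingType) (M : lmodType k) (S : submodClosed M).

Definition submod_mem : {pred M} := [pred x | x \in S].
Fact quotmod_zmod_closed : zmod_closed submod_mem.
Proof.
split=> [|x y]; rewrite !inE ?rpred0 // => Sx Sy.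
by rewrite -scaleN1r rpredD ?rpredZ.
Qed.
HB.instance Definition _ := GRing.isZmodClosed.Build M submod_mem quotmod_zmod_closed.

Definition quotmod := Quotient.quot submod_mem.

HB.instance Definition _ := GRing.Zmodule.on quotmod.

Definition quotmod_pi (x : M) : quotmod := \pi_quotmod x.
Definition quotmod_scale (a : k) (x : quotmod) : quotmod :=
  quotmod_pi (a *: repr x).

Lemma quotmod_piB : {morph quotmod_pi : x y / x - y}.
Proof. by move=> x y; rewrite /quotmod_pi !piE. Qed.

Lemma quotmod_pi_eq x y : quotmod_pi x = quotmod_pi y <-> x - y \in S.
Proof.
have -> : (x - y \in S) = (x - y \in submod_mem) by rewrite inE.
rewrite Quotient.idealrBE; split=> [h|/eqP //]; exact/eqP.
Qed.

Lemma quotmod_piK (x : quotmod) : quotmod_pi (repr x) = x.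
Proof. exact: reprK. Qed.

Lemma quotmod_scale_pi a x : quotmod_scale a (quotmod_pi x) = quotmod_pi (a *: x).
Proof.
apply/quotmod_pi_eq; rewrite -scalerBr rpredZ //.
by apply/quotmod_pi_eq; rewrite quotmod_piK.
Qed.

Lemma quotmod_piD : {morph quotmod_pi : x y / x + y}.
Proof. by move=> x y; rewrite /quotmod_pi !piE. Qed.

Lemma quotmod_scaleA a b x :
  quotmod_scale a (quotmod_scale b x) = quotmod_scale (a * b) x.
Proof. by rewrite -(quotmod_piK x) !quotmod_scale_pi scalerA. Qed.
Lemma quotmod_scale1 : left_id 1 quotmod_scale.
Proof. by move=> x; rewrite -(quotmod_piK x) quotmod_scale_pi scale1r. Qed.
Lemma quotmod_scaleDr : right_distributive quotmod_scale +%R.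
Proof.
move=> a x y; rewrite -(quotmod_piK x) -(quotmod_piK y) -quotmod_piD.
by rewrite !quotmod_scale_pi -quotmod_piD scalerDr.
Qed.
Lemma quotmod_scaleDl x :
  {morph quotmod_scale^~ x : a b / a + b}.
Proof.
move=> a b; rewrite -(quotmod_piK x) !quotmod_scale_pi -quotmod_piD.
by rewrite scalerDl.
Qed.

HB.instance Definition _ := GRing.Zmodule_isLmodule.Build k quotmod
  quotmod_scaleA quotmod_scale1 quotmod_scaleDr quotmod_scaleDl.

Lemma quotmod_pi_is_linear : linear quotmod_pi.
Proof.
by move=> a x y; rewrite quotmod_piD -quotmod_scale_pi.
Qed.
HB.instance Definition _ :=
  GRing.isLinear.Build k M quotmod _ quotmod_pi quotmod_pi_is_linear.

End QuotientModule.

Section Span.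
Variables (k : comNzRingType) (M : lmodType k) (G : M -> Prop).

Definition span : {pred M} :=
  fun x => `[< forall N : {pred M},
    submod_closed N -> (forall y, G y -> y \in N) -> x \in N >].

Lemma span_submod_closed : submod_closed span.
Proof.
split=> [|a x y /asboolP hx /asboolP hy]; apply/asboolP=> N cN hN.
  by case: cN.
by case: (cN) => _; apply; [apply: hx | apply: hy].
Qed.
HB.instance Definition _ :=
  GRing.isSubmodClosed.Build k M span span_submod_closed.
End Span.

(* M ⊗ N is the free module on M × N modulo the bilinearity relations; its
   universal property is [tlift], [tlift_pure] (existence) and [tensor_ext]
   (uniqueness). *)
Section Tensor.
Variables (k : comNzRingType) (M N : lmodType k).

Local Notation F := {freeg (M * N) / k}.

Variant tensor_rel : F -> Prop :=
| TensorDl m m' n : tensor_rel (<< (m + m', n) >> - << (m, n) >> - << (m', n) >>)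
| TensorDr m n n' : tensor_rel (<< (m, n + n') >> - << (m, n) >> - << (m, n') >>)
| TensorZl a m n : tensor_rel (<< (a *: m, n) >> - a *: << (m, n) >>)
| TensorZr a m n : tensor_rel (<< (m, a *: n) >> - a *: << (m, n) >>).

Definition tensor := quotmod (span tensor_rel).

HB.instance Definition _ := GRing.Lmodule.on tensor.

Definition tpure (m : M) (n : N) : tensor := quotmod_pi (span tensor_rel) << (m, n) >>.

Lemma tensor_rel0 r : tensor_rel r -> quotmod_pi (span tensor_rel) r = 0.
Proof.
move=> h; rewrite -(raddf0 (quotmod_pi (span tensor_rel))).
apply/quotmod_pi_eq; rewrite subr0; apply/asboolP=> S _; exact.
Qed.

Lemma tpure_is_bilinear : bilinear_for *:%R *:%R tpure.
Proof.
split=> [n|m] a x y; rewrite /tpure.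
  have := tensor_rel0 (TensorDl (a *: x) y n).
  rewrite !raddfB /= => /eqP; rewrite subr_eq add0r subr_eq addrC => /eqP ->.
  have /eqP := tensor_rel0 (TensorZl a x n).
  by rewrite linearB linearZ_LR /= subr_eq0 => /eqP ->; rewrite addrC.
have := tensor_rel0 (TensorDr m (a *: x) y).
rewrite !raddfB /= => /eqP; rewrite subr_eq add0r subr_eq addrC => /eqP ->.
have /eqP := tensor_rel0 (TensorZr a m x).
by rewrite linearB linearZ_LR /= subr_eq0 => /eqP ->; rewrite addrC.
Qed.
HB.instance Definition _ :=
  @bilinear_isBilinear.Build k M N tensor _ _ tpure tpure_is_bilinear.

Lemma tpurePl a x y n : tpure (a *: x + y) n = a *: tpure x n + tpure y n.
Proof. exact: (tpure_is_bilinear.1 n a x y). Qed.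
Lemma tpurePr a m x y : tpure m (a *: x + y) = a *: tpure m x + tpure m y.
Proof. exact: (tpure_is_bilinear.2 m a x y). Qed.
HB.instance Definition _ m :=
  GRing.isLinear.Build k N tensor _ (tpure m) (tpurePr^~ m).

Section Lift.
Variables (P : lmodType k) (f : {bilinear M -> N -> P}).

Let flift : F -> P := fglift (fun x => f x.1 x.2).

Let fliftB : {morph flift : x y / x - y}.
Proof. exact: lift_is_additive. Qed.
Let flift0 : flift 0 = 0.
Proof. by have := fliftB 0 0; rewrite !subr0 subrr. Qed.
Let fliftN : {morph flift : x / - x}.
Proof. by move=> x; have := fliftB 0 x; rewrite !sub0r flift0 sub0r. Qed.
Let fliftD : {morph flift : x y / x + y}.
Proof. by move=> x y; rewrite -{1}[y]opprK fliftB fliftN opprK. Qed.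
Let fliftU c x : flift << c *g x >> = c *: f x.1 x.2.
Proof. exact: liftU. Qed.
Let flift_sum I (r : seq I) (G : I -> F) :
  flift (\sum_(i <- r) G i) = \sum_(i <- r) flift (G i).
Proof. exact: (big_morph flift fliftD flift0). Qed.
Let fliftZ a : {morph flift : x / a *: x}.
Proof.
move=> x; have -> : a *: x = \sum_(y <- dom x) << a * coeff y x *g y >> by [].
rewrite -[in RHS](freeg_sumE x) !flift_sum scaler_sumr; apply: eq_bigr => i _.
by rewrite !fliftU scalerA.
Qed.

Let flift_span x : x \in span tensor_rel -> flift x = 0.
Proof.
move/asboolP=> /(_ [pred x | flift x == 0]); rewrite inE => h; apply/eqP/h.
  split; first by rewrite inE flift0.
  by move=> a u v; rewrite !inE fliftD fliftZ => /eqP-> /eqP->; rewrite scaler0 addr0.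
move=> _ [m m' n|m n n'|a m n|a m n];
  rewrite inE ?fliftB ?fliftZ !fliftU /= !scale1r.
- by rewrite linearDl /= -addrA -opprD subrr.
- by rewrite linearDr /= -addrA -opprD subrr.
- by rewrite linearZl_LR /= subrr.
- by rewrite linearZr_LR /= subrr.
Qed.

Definition tlift (t : tensor) : P := flift (repr t).

Let tlift_pi x : tlift (quotmod_pi (span tensor_rel) x) = flift x.
Proof.
apply/eqP; rewrite -subr_eq0 -fliftB; apply/eqP/flift_span.
by apply/quotmod_pi_eq; rewrite quotmod_piK.
Qed.

Lemma tlift_is_linear : linear tlift.
Proof.
move=> a x y; rewrite -[x]quotmod_piK -[y]quotmod_piK -linearP !tlift_pi.
by rewrite fliftD fliftZ.
Qed.
HB.instance Definition _ :=
  GRing.isLinear.Build k tensor P _ tlift tlift_is_linear.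

Lemma tlift_pure m n : tlift (tpure m n) = f m n.
Proof. by rewrite tlift_pi fliftU scale1r. Qed.
End Lift.

Lemma tensor_ext (P : lmodType k) (g h : {linear tensor -> P}) :
  (forall m n, g (tpure m n) = h (tpure m n)) -> g =1 h.
Proof.
move=> gh t; rewrite -[t]quotmod_piK; move: (repr _ : F) => x.
rewrite -[x]freeg_sumE !raddf_sum /=; apply: eq_bigr => -[m n] _.
have -> : << coeff (m, n) x *g (m, n) >> = coeff (m, n) x *: (<< (m, n) >> : F).
  by apply/eqP/freeg_eqP => z; rewrite coeffZ !coeffU mul1r.
by rewrite !linearZ /= gh.
Qed.

End Tensor.

Notation "M ⊗ N" := (tensor M N) (at level 40, left associativity) : type_scope.

(* Iterated tensor products associate to the left; the identification
   (A ⊗ B) ⊗ C ≅ A ⊗ (B ⊗ C) is made explicit by [tassoc] and [tassocV]. *)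
Section TensorMaps.
Variable k : comNzRingType.
Implicit Types A B C D : lmodType k.

Definition tmap_fun A B C D (f : {linear A -> C}) (g : {linear B -> D})
  (a : A) (b : B) : C ⊗ D := tpure (f a) (g b).
Fact tmap_bilinear A B C D (f : {linear A -> C}) (g : {linear B -> D}) :
  bilinear_for *:%R *:%R (tmap_fun f g).
Proof.
by split=> [b|a] s x y; rewrite /tmap_fun linearP (tpurePl, tpurePr).
Qed.
HB.instance Definition _ A B C D (f : {linear A -> C}) (g : {linear B -> D}) :=
  @bilinear_isBilinear.Build k A B (C ⊗ D) _ _ (tmap_fun f g) (tmap_bilinear f g).
Definition tmap A B C D (f : {linear A -> C}) (g : {linear B -> D}) :
  {linear A ⊗ B -> C ⊗ D} := tlift (tmap_fun f g).

Definition tswap_fun A B (a : A) (b : B) : B ⊗ A := tpure b a.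
Fact tswap_bilinear A B : bilinear_for *:%R *:%R (@tswap_fun A B).
Proof. by split=> [b|a] s x y; rewrite /tswap_fun (tpurePl, tpurePr). Qed.
HB.instance Definition _ A B :=
  @bilinear_isBilinear.Build k A B (B ⊗ A) _ _ (@tswap_fun A B) (@tswap_bilinear A B).
Definition tswap A B : {linear A ⊗ B -> B ⊗ A} := tlift (@tswap_fun A B).

(* a ⊗ b ↦ (-1)^e b ⊗ a *)
Definition flip (e : nat) A B : {linear A ⊗ B -> B ⊗ A} :=
  (-1) ^+ e \*: tswap A B.

Definition tassoc_fun A B C (t : A ⊗ B) (c : C) : A ⊗ (B ⊗ C) :=
  tmap idfun (applyr (@tpure k B C) c) t.
Fact tassoc_bilinear A B C : bilinear_for *:%R *:%R (@tassoc_fun A B C).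
Proof.
split=> [c|t] s x y; rewrite /tassoc_fun ?linearP //.
pose f c : {linear A ⊗ B -> A ⊗ (B ⊗ C)} := tmap idfun (applyr (@tpure k B C) c).
suff: f (s *: x + y) =1 (s \*: f x) \+ f y by exact.
apply: tensor_ext => a b /=; rewrite !tlift_pure /= /tmap_fun /= /applyr.
by rewrite tpurePr /= tpurePr.
Qed.
HB.instance Definition _ A B C :=
  @bilinear_isBilinear.Build k (A ⊗ B) C (A ⊗ (B ⊗ C)) _ _
    (@tassoc_fun A B C) (@tassoc_bilinear A B C).
Definition tassoc A B C : {linear A ⊗ B ⊗ C -> A ⊗ (B ⊗ C)} :=
  tlift (@tassoc_fun A B C).

Definition tassocV_fun A B C (a : A) (t : B ⊗ C) : A ⊗ B ⊗ C :=
  tmap (@tpure k A B a) idfun t.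
Fact tassocV_bilinear A B C : bilinear_for *:%R *:%R (@tassocV_fun A B C).
Proof.
split=> [t|a] s x y; rewrite /tassocV_fun ?linearP //.
pose f a : {linear B ⊗ C -> A ⊗ B ⊗ C} := tmap (@tpure k A B a) idfun.
suff: f (s *: x + y) =1 (s \*: f x) \+ f y by exact.
apply: tensor_ext => b c /=; rewrite !tlift_pure /= /tmap_fun /=.
by rewrite tpurePl /= tpurePl.
Qed.
HB.instance Definition _ A B C :=
  @bilinear_isBilinear.Build k A (B ⊗ C) (A ⊗ B ⊗ C) _ _
    (@tassocV_fun A B C) (@tassocV_bilinear A B C).
Definition tassocV A B C : {linear A ⊗ (B ⊗ C) -> A ⊗ B ⊗ C} :=
  tlift (@tassocV_fun A B C).

(* f ⊗ id followed by k ⊗ B ≅ B, and id ⊗ f followed by A ⊗ k ≅ A. *)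
Definition contractl_fun A B (f : {scalar A}) (a : A) (b : B) : B := f a *: b.
Fact contractl_bilinear A B (f : {scalar A}) :
  bilinear_for *:%R *:%R (@contractl_fun A B f).
Proof.
split=> [b|a] s x y; rewrite /contractl_fun.
  by rewrite linearP /= scalerDl scalerA.
by rewrite scalerDr scalerA /= scalerA mulrC.
Qed.
HB.instance Definition _ A B (f : {scalar A}) :=
  @bilinear_isBilinear.Build k A B B _ _ (@contractl_fun A B f)
    (@contractl_bilinear A B f).
Definition contractl A B (f : {scalar A}) : {linear A ⊗ B -> B} :=
  tlift (@contractl_fun A B f).
Definition contractr A B (f : {scalar B}) : {linear A ⊗ B -> A} :=
  contractl A f \o tswap A B.

(* f ⊗ g followed by k ⊗ k ≅ k *)
Definition tscalar A B (f : {scalar A}) (g : {scalar B}) (t : A ⊗ B) : k :=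
  g (contractl B f t).

End TensorMaps.

Arguments tswap {k A B}.
Arguments flip {k} e {A B}.
Arguments tassoc {k A B C}.
Arguments tassocV {k A B C}.
Arguments contractl {k A B}.
Arguments contractr {k A B}.

Section TensorMapsE.
Variable k : comNzRingType.
Implicit Types A B C D : lmodType k.

Lemma tmapE A B C D (f : {linear A -> C}) (g : {linear B -> D}) a b :
  tmap f g (tpure a b) = tpure (f a) (g b).
Proof. exact: tlift_pure. Qed.
Lemma tswapE A B (a : A) (b : B) : tswap (tpure a b) = tpure b a.
Proof. exact: tlift_pure. Qed.
Lemma flipE e A B (a : A) (b : B) :
  flip e (tpure a b) = (-1) ^+ e *: tpure b a.
Proof. by rewrite /flip -(tswapE a b). Qed.
Lemma tassocE A B C (a : A) (b : B) (c : C) :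
  tassoc (tpure (tpure a b) c) = tpure a (tpure b c).
Proof. by apply: (etrans (tlift_pure (@tassoc_fun k A B C) _ _)); apply: tmapE. Qed.
Lemma tassocVE A B C (a : A) (b : B) (c : C) :
  tassocV (tpure a (tpure b c)) = tpure (tpure a b) c.
Proof. by apply: (etrans (tlift_pure (@tassocV_fun k A B C) _ _)); apply: tmapE. Qed.
Lemma contractlE A B (f : {scalar A}) (a : A) (b : B) :
  contractl f (tpure a b) = f a *: b.
Proof. exact: tlift_pure. Qed.
Lemma contractrE A B (f : {scalar B}) (a : A) (b : B) :
  contractr f (tpure a b) = f b *: a.
Proof. by rewrite /contractr /= tswapE contractlE. Qed.
Lemma tscalarE A B (f : {scalar A}) (g : {scalar B}) (a : A) (b : B) :
  tscalar f g (tpure a b) = f a * g b.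
Proof. by rewrite /tscalar contractlE linearZ. Qed.
End TensorMapsE.

Section Homology.
Variable k : comNzRingType.

Section Kernel.
Variables (A B : lmodType k) (f : {linear A -> B}).

Definition ker_pred : {pred A} := fun x => f x == 0.
Fact ker_submod_closed : submod_closed ker_pred.
Proof.
split=> [|a x y]; rewrite ?unfold_in /ker_pred ?linear0 //.
by rewrite linearP => /eqP-> /eqP->; rewrite scaler0 addr0.
Qed.
HB.instance Definition _ :=
  GRing.isSubmodClosed.Build k A ker_pred ker_submod_closed.

Record ker := Ker { ker_val : A; _ : ker_val \in ker_pred }.
HB.instance Definition _ := [isSub for ker_val].
HB.instance Definition _ := [Choice of ker by <:].
HB.instance Definition _ := [SubChoice_isSubLmodule of ker by <:].

Fact ker_val_is_linear : linear ker_val.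
Proof. exact: (linearP (val : ker -> A)). Qed.
HB.instance Definition _ :=
  GRing.isLinear.Build k ker A _ ker_val ker_val_is_linear.
End Kernel.

(* Since n.+1.-1 is n, [d n.+1] maps V n.+1 to V n. Elements of degree 0 are
   cycles when [d 0] is zero. *)
Variables (V : nat -> lmodType k) (d : forall n, {linear V n -> V n.-1}).

Definition cycles n := ker (d n).

Definition boundaries n : {pred cycles n} :=
  fun z => `[< exists y : V n.+1, ker_val z = d n.+1 y >].
Fact boundaries_submod_closed n : submod_closed (@boundaries n).
Proof.
split=> [|a x y /asboolP[u xu] /asboolP[v yv]]; apply/asboolP.
  by exists 0; rewrite !linear0.
by exists (a *: u + v); rewrite !linearP /= xu yv.
Qed.
HB.instance Definition _ n :=
  GRing.isSubmodClosed.Build k (cycles n) (@boundaries n)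
    (boundaries_submod_closed n).

Definition homology (n : nat) : lmodType k := quotmod (@boundaries n).
Definition hclass n : {linear cycles n -> homology n} :=
  quotmod_pi (@boundaries n).

End Homology.

(* A map from V_n to a finite direct sum of V_p ⊗ V_q is given by its components
   in all bidegrees, those outside the sum being zero. An element of [tensor2 V]
   is a family of components in all bidegrees, hence in all total degrees at
   once; the direct sum over p + q = n is the part of total degree n. All
   operations below preserve or shift the total degree, so that statements about
   such families are the conjunction over n of the statements about degree n. *)
Section Graded.
Variable k : comNzRingType.

Definition tensor2 (V : nat -> lmodType k) := forall p q, V p ⊗ V q.
Definition tensor3 (V : nat -> lmodType k) := forall p q r, V p ⊗ V q ⊗ V r.
Definition coop (V : nat -> lmodType k) :=
  forall n p q, {linear V n -> V p ⊗ V q}.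

Section Flips.
Variable V : nat -> lmodType k.

(* In the signs, the shifted degree p - 1 is replaced by p + 1, which has the
   same parity. The component (p, q) of a flip comes from the component (q, p). *)
Definition tau2 (z : tensor2 V) : tensor2 V :=
  fun p q => flip (q * p) (z q p).
Definition rho2 (z : tensor2 V) : tensor2 V :=
  fun p q => flip (q.+1 * p.+1) (z q p).
Definition rho12 (z : tensor3 V) : tensor3 V :=
  fun p q r => tmap (flip (q.+1 * p.+1)) idfun (z q p r).
Definition rho23 (z : tensor3 V) : tensor3 V :=
  fun p q r =>
    tassocV (tmap idfun (flip (r.+1 * q.+1)) (tassoc (z p r q))).
Definition varrho12 (z : tensor3 V) : tensor3 V :=
  fun p q r => tmap (flip (q * p.+1)) idfun (z q p r).

(* (f ⊗ id) ∘ g and (id ⊗ f) ∘ g, where f maps V_m to the sum of the V_p ⊗ V_q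
   with p + q = m + s. When the subtraction truncates, f has no component in the
   bidegree concerned. *)
Definition compl (s : nat) (f g : coop V) n (x : V n) : tensor3 V :=
  fun p q r => tmap (f (p + q - s)%N p q) idfun (g n (p + q - s)%N r x).
Definition compr (s : nat) (f g : coop V) n (x : V n) : tensor3 V :=
  fun p q r =>
    tassocV (tmap idfun (f (q + r - s)%N q r) (g n p (q + r - s)%N x)).

(* Each defect is the difference of the two sides of an identity. *)
Variables cup cobr : coop V.

Definition coassoc_defect n (x : V n) : tensor3 V :=
  fun p q r => compl 0 cup cup x p q r - compr 0 cup cup x p q r.
Definition cocomm_defect n (x : V n) : tensor2 V :=
  fun p q => tau2 (fun p q => cup n p q x) p q - cup n p q x.
Definition cojacobi_defect n (x : V n) : tensor3 V :=
  let z := compl 1 cobr cobr x in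
  fun p q r => z p q r + rho23 (rho12 z) p q r + rho12 (rho23 z) p q r.
Definition coleibniz_defect n (x : V n) : tensor3 V :=
  fun p q r => compr 0 cup cobr x p q r
    - (compl 1 cobr cup x p q r + varrho12 (compr 1 cobr cup x) p q r).

Record gerstenhaber_coalgebra : Prop := {
  cup_degree : forall n p q, (p + q)%N != n -> forall x, cup n p q x = 0;
  cobr_degree : forall n p q, (p + q)%N != n.+1 -> forall x, cobr n p q x = 0;
  cup_coassoc : forall n x p q r, @coassoc_defect n x p q r = 0;
  cup_cocomm : forall n x p q, @cocomm_defect n x p q = 0;
  cobr_antisym : forall n (x : V n), exists y : tensor2 V,
    forall p q, cobr n p q x = y p q - rho2 y p q;
  cobr_cojacobi : forall n x p q r, @cojacobi_defect n x p q r = 0;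
  cobr_coleibniz : forall n x p q r, @coleibniz_defect n x p q r = 0
}.
End Flips.

Section Kunneth.
Variables (V : nat -> lmodType k) (d : forall n, {linear V n -> V n.-1}).
Let H := homology d.
Local Notation incl p := (@ker_val _ _ _ (d p)).

(* The differential of V ⊗ V, with V_p in degree p + s for the first factor; in
   [diff3], s is the shift of the first factor and t the sum of the shifts of the
   first two. Only the parity of a shift matters, so s = 1 is the grading in
   which V_p has degree p - 1. *)
Definition diff2 (s : nat) (w : tensor2 V) : tensor2 V :=
  fun p q => tmap (d p.+1) idfun (w p.+1 q)
    + (-1) ^+ (p + s) *: tmap idfun (d q.+1) (w p q.+1).
Definition diff3 (s t : nat) (w : tensor3 V) : tensor3 V :=
  fun p q r => tmap (tmap (d p.+1) idfun) idfun (w p.+1 q r)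
    + (-1) ^+ (p + s) *: tmap (tmap idfun (d q.+1)) idfun (w p q.+1 r)
    + (-1) ^+ (p + q + t) *: tmap idfun (d r.+1) (w p q r.+1).

Definition boundary2 s (z : tensor2 V) :=
  exists w, forall p q, z p q = diff2 s w p q.
Definition boundary3 s t (z : tensor3 V) :=
  exists w, forall p q r, z p q r = diff3 s t w p q r.

(* [kunneth_rel2 s t z]: the Künneth map H(V) ⊗ H(V) -> H(V ⊗ V), which sends
   [a] ⊗ [b] to [a ⊗ b], sends t to the class of z. Similarly [kunneth_rel3] for
   H(V) ⊗ H(V) ⊗ H(V) -> H(V ⊗ V ⊗ V). *)
Definition kunneth_rel2 (s : nat) (t : tensor2 H) (z : tensor2 V) : Prop :=
  exists u : forall p q, cycles d p ⊗ cycles d q,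
    (forall p q, t p q = tmap (hclass d p) (hclass d q) (u p q)) /\
    boundary2 s (fun p q => z p q - tmap (incl p) (incl q) (u p q)).
Definition kunneth_rel3 (t : tensor3 H) (z : tensor3 V) : Prop :=
  exists u : forall p q r, cycles d p ⊗ cycles d q ⊗ cycles d r,
    (forall p q r, t p q r =
       tmap (tmap (hclass d p) (hclass d q)) (hclass d r) (u p q r)) /\
    boundary3 0 0 (fun p q r => z p q r -
       tmap (tmap (incl p) (incl q)) (incl r) (u p q r)).

(* The Künneth property for the complex V: the first map above is bijective, the
   second is injective, and so is the map (H ⊗ H)_ρ -> H((V ⊗ V)_ρ) induced on
   the coinvariants of ρ (the cokernels of id - ρ). A change of the shifts only
   changes the signs of the components of the Künneth maps. *)
Record kunneth : Prop := {
  kunneth2_inj : forall t, kunneth_rel2 0 t (fun _ _ => 0) -> forall p q, t p q = 0;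
  kunneth2_surj : forall z, (forall p q, diff2 0 z p q = 0) ->
    exists t, kunneth_rel2 0 t z;
  kunneth3_inj : forall t, kunneth_rel3 t (fun _ _ _ => 0) ->
    forall p q r, t p q r = 0;
  kunneth_coinv_inj : forall t y,
    kunneth_rel2 1 t (fun p q => y p q - rho2 y p q) ->
    exists t', forall p q, t p q = t' p q - rho2 t' p q
}.

(* The Künneth map sends fH [x] to the class of f x, for every cycle x; s = 0 for
   a coproduct, s = 1 for a cobracket. *)
Definition induced_coop (s : nat) (f : coop V) (fH : coop H) : Prop :=
  forall n (x : cycles d n),
    kunneth_rel2 s (fun p q => fH n p q (hclass d n x))
      (fun p q => f n p q (ker_val x)).

(* The Gerstenhaber identities for the maps H(V) -> H(V ⊗ V) induced by cup and
   cobr, as identities in H(V ⊗ V) and H(V ⊗ V ⊗ V); this makes sense without the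
   Künneth property. *)
Record gerstenhaber_mod_boundaries (cup cobr : coop V) : Prop := {
  diff_diff : forall n x, d n.-1 (d n x) = 0;
  cup_coderivation : forall n x p q,
    cup n.-1 p q (d n x) = diff2 0 (fun p q => cup n p q x) p q;
  cobr_coderivation : forall n x p q,
    cobr n.-1 p q (d n x) = diff2 1 (fun p q => cobr n p q x) p q;
  mod_coassoc : forall n (x : V n), d n x = 0 ->
    boundary3 0 0 (coassoc_defect cup x);
  mod_cocomm : forall n (x : V n), d n x = 0 -> boundary2 0 (cocomm_defect cup x);
  mod_antisym : forall n (x : V n), d n x = 0 ->
    exists y, boundary2 1 (fun p q => cobr n p q x - (y p q - rho2 y p q));
  mod_cojacobi : forall n (x : V n), d n x = 0 ->
    boundary3 1 0 (cojacobi_defect cobr x);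
  mod_coleibniz : forall n (x : V n), d n x = 0 ->
    boundary3 1 1 (coleibniz_defect cup cobr x)
}.
End Kunneth.

End Graded.

Section Cooperad.
Variable k : comNzRingType.

(* [decomp n p q i] is Δ_{p,q,i} when p + q - 1 = n and 1 <= i <= p, and zero
   otherwise. *)
Record cooperad := Cooperad {
  cooperad_sort :> nat -> lmodType k;
  counit : {scalar cooperad_sort 1};
  decomp : forall n p q (i : nat),
    {linear cooperad_sort n -> cooperad_sort p ⊗ cooperad_sort q};
  decomp_out : forall n p q i,
    ~~ [&& n.+1 == (p + q)%N, (1 <= i)%N & (i <= p)%N] ->
    forall x, decomp n p q i x = 0;
  counitl : forall n (x : cooperad_sort n),
    contractl counit (decomp n 1 n 1 x) = x;
  counitr : forall n i, (1 <= i <= n)%N -> forall x : cooperad_sort n,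
    contractr counit (decomp n n 1 i x) = x;
  decomp_coassoc : forall p q r i j,
    (1 <= p)%N -> (1 <= i <= p)%N -> (1 <= j <= (p + q).-1)%N ->
    forall x : cooperad_sort ((p + q).-1 + r).-1,
    tmap (decomp (p + q).-1 p q i) idfun (decomp _ (p + q).-1 r j x) =
    if (i + q <= j)%N then
      tassocV (tmap idfun tswap (tassoc
        (tmap (decomp (p + r).-1 p r (j - q + 1)%N) idfun
           (decomp _ (p + r).-1 q i x))))
    else if (i <= j)%N then
      tassocV (tmap idfun (decomp (q + r).-1 q r (j - i + 1)%N)
        (decomp _ p (q + r).-1 i x))
    else
      tassocV (tmap idfun tswap (tassoc
        (tmap (decomp (p + r).-1 p r j) idfun
           (decomp _ (p + r).-1 q (i + r - 1)%N x))))
}.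

Record comult_cooperad := ComultCooperad {
  comult_base :> cooperad;
  comu : {scalar comult_base 2};
  coun : {scalar comult_base 0};
  comu_coassoc : forall x : comult_base 3,
    tscalar comu comu (decomp comult_base 3 2 2 1 x) =
    tscalar comu comu (decomp comult_base 3 2 2 2 x);
  comu_counitl : forall x : comult_base 1,
    tscalar comu coun (decomp comult_base 1 2 0 1 x) = counit comult_base x;
  comu_counitr : forall x : comult_base 1,
    tscalar comu coun (decomp comult_base 1 2 0 2 x) = counit comult_base x
}.

Variable C : comult_cooperad.
Local Notation Δ := (decomp C).
Local Notation μ := (comu C).

Fact scale_interchange (M : lmodType k) (a b : k) (u u' v v' : M) :
  a *: u + u' + b *: (a *: v + v') = a *: (u + b *: v) + (u' + b *: v').
Proof. by rewrite !scalerDr !scalerA (mulrC b) addrACA. Qed.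

(* For n = 0 all terms vanish, so that d = 0 on C(0). *)
Definition coop_diff_fun n (x : C n) : C n.-1 :=
  contractl μ (Δ n 2 n.-1 2 x + (-1) ^+ n *: Δ n 2 n.-1 1 x)
  + \sum_(1 <= i < n) (-1) ^+ i *: contractr μ (Δ n n.-1 2 i x).
Fact coop_diff_is_linear n : linear (@coop_diff_fun n).
Proof.
move=> a x y; rewrite /coop_diff_fun.
have E i : (-1) ^+ i *: contractr μ (Δ n n.-1 2 i (a *: x + y)) =
    a *: ((-1) ^+ i *: contractr μ (Δ n n.-1 2 i x))
      + (-1) ^+ i *: contractr μ (Δ n n.-1 2 i y).
  by rewrite linearP (linearP (contractr μ)) scalerDr !scalerA mulrC.
have E2 : Δ n 2 n.-1 2 (a *: x + y) + (-1) ^+ n *: Δ n 2 n.-1 1 (a *: x + y) =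
    a *: (Δ n 2 n.-1 2 x + (-1) ^+ n *: Δ n 2 n.-1 1 x)
      + (Δ n 2 n.-1 2 y + (-1) ^+ n *: Δ n 2 n.-1 1 y).
  by rewrite (linearP (Δ n 2 n.-1 2)) (linearP (Δ n 2 n.-1 1)) scale_interchange.
rewrite (eq_bigr _ (fun i _ => E i)) big_split /= -scaler_sumr.
by rewrite E2 linearP addrACA scalerDr.
Qed.
HB.instance Definition _ n :=
  GRing.isLinear.Build k (C n) (C n.-1) _ (@coop_diff_fun n)
    (@coop_diff_is_linear n).
Definition coop_diff n : {linear C n -> C n.-1} := @coop_diff_fun n.

(* The component in C(p) ⊗ C(q) is the term of index j = p + 1. *)
Definition cup_coproduct : coop C := fun n p q =>
  tmap (contractl μ \o Δ p.+1 2 p 1) idfun \o Δ n p.+1 q p.+1.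

(* The component of [x] in C(p) ⊗ C(q); n - p is q - 1 when p + q = n + 1, and
   has the parity of q + 1. *)
Definition prebracket_fun n p q (x : C n) : C p ⊗ C q :=
  \sum_(1 <= i < p.+1) (-1) ^+ (q.+1 * (p - i)) *: Δ n p q i x.
Fact prebracket_is_linear n p q : linear (@prebracket_fun n p q).
Proof.
move=> a x y; rewrite /prebracket_fun scaler_sumr -big_split /=.
by apply: eq_bigr => i _; rewrite linearP scalerDr !scalerA mulrC.
Qed.
HB.instance Definition _ n p q :=
  GRing.isLinear.Build k (C n) (C p ⊗ C q) _ (@prebracket_fun n p q)
    (@prebracket_is_linear n p q).

Definition cobracket_fun n p q (x : C n) : C p ⊗ C q :=
  prebracket_fun p q x - rho2 (fun p q => prebracket_fun p q x) p q.
Fact cobracket_is_linear n p q : linear (@cobracket_fun n p q).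
Proof.
move=> a x y; rewrite /cobracket_fun /rho2.
rewrite !prebracket_is_linear (linearP (flip _)).
by rewrite scalerBr opprD addrACA.
Qed.
HB.instance Definition _ n p q :=
  GRing.isLinear.Build k (C n) (C p ⊗ C q) _ (@cobracket_fun n p q)
    (@cobracket_is_linear n p q).
Definition cobracket : coop C := fun n p q => @cobracket_fun n p q.

End Cooperad.

Definition is_field (k : comNzRingType) : Prop :=
  forall x : k, x != 0 -> exists y, y * x = 1.

(* Main.v *)
(* For a commutative algebra A, the families of linear maps C n -> A form an
   operad under convolution with the decompositions of C, and the comultiplication
   of C makes it an operad with multiplication mu.  The tensor product of three
   square-zero extensions of k is an algebra A in which C p ⊗ C q ⊗ C r embeds by
   products of such maps, so an identity between iterated decompositions of C
   holds as soon as its dual holds in all these operads.  There the differential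
   is [mu, -], the cup product is mu{-,-} up to sign, and the Gerstenhaber
   identities follow from the relations that express x{y}{z}, x{y,z}{w} and
   x{y}{z,w} by braces; the homotopies are x{y} for the commutativity of the cup
   product and x{y,z} for the Leibniz rule.

   The Künneth property transports the identities to homology.  Over a field it
   holds because each d has, by Zorn's lemma, a linear g with d g d = d: then
   h = g (1 - g d) is a contraction of the complex onto its homology. *)
From HB Require Import structures.
Require Import Defs.
From mathcomp Require Import all_boot all_order all_algebra.
From mathcomp Require Import ring zify.
From mathcomp Require Import sesquilinear boolp classical_sets functions freeg.

Set Implicit Arguments.
Unset Strict Implicit.
Unset Printing Implicit Defensive.

Import GRing.Theory.
Local Open Scope ring_scope.

(** * Linear combinations in a module *)

(** Over a ring, functionals with values in [k] need not separate the points of a tensor product,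
    hence the tests by maps into varying algebras. On the dual side only one rule produces signs,
    the exchange of two parallel insertions, so sign checks become finite case distinctions on
    parities. The calculus closes at three insertions: such terms vanish for [mu], which has two
    inputs, and those with [mu] inserted into x beside y and z cancel. Two obstacles shape the
    details. Arities may be 0, where truncated degrees such as [(p + q).-1] have the wrong parity or
    name the wrong component; the operation concerned vanishes there, which has to be split off by
    hand. In homology, the inverse of the Künneth map is not given by a formula, so the passage uses
    relations between tensors of classes and representing tensors. These relations are compatible
    with linear combinations, flips and composition, and the Künneth property makes them
    functions. *)

Section ModuleExpressions.
Variables (k : comNzRingType) (M : lmodType k).

Inductive mexpr :=
| MVar of nat
| MZero
| MAdd of mexpr & mexpr
| MOpp of mexpr
| MScale of k & mexpr.

Fixpoint mval (env : seq M) e : M :=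
  match e with
  | MVar n => nth 0 env n
  | MZero => 0
  | MAdd e1 e2 => mval env e1 + mval env e2
  | MOpp e1 => - mval env e1
  | MScale a e1 => a *: mval env e1
  end.

Fixpoint mcoef e (i : nat) : k :=
  match e with
  | MVar n => if n == i then 1 else 0
  | MZero => 0
  | MAdd e1 e2 => mcoef e1 i + mcoef e2 i
  | MOpp e1 => - mcoef e1 i
  | MScale a e1 => a * mcoef e1 i
  end.

Lemma mval_coef env e :
  mval env e = \sum_(i < size env) mcoef e i *: nth 0 env i.
Proof.
elim: e => /= [n||e1 -> e2 ->|e1 ->|a e1 ->].
- have [lt_n|le_n] := ltnP n (size env).
    rewrite (bigD1 (Ordinal lt_n)) //= eqxx scale1r big1 ?addr0 // => i.
    by rewrite -val_eqE /= eq_sym => /negPf->; rewrite scale0r.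
  rewrite nth_default // big1 // => i _.
  by rewrite (negPf (_ : n != i)) ?scale0r // neq_ltn (leq_trans (ltn_ord i)) ?orbT.
- by rewrite big1 // => i _; rewrite scale0r.
- by rewrite -big_split; apply: eq_bigr => i _; rewrite scalerDl.
- by rewrite -sumrN; apply: eq_bigr => i _; rewrite scaleNr.
- by rewrite scaler_sumr; apply: eq_bigr => i _; rewrite scalerA.
Qed.

(** After reification the [foldr] over [iota] computes to a finite conjunction of scalar equations,
    one for each atom, which [ring] closes. *)
Lemma mexpr_eq env e1 e2 :
  foldr (fun i P => mcoef e1 i = mcoef e2 i /\ P) True (iota 0 (size env)) ->
  mval env e1 = mval env e2.
Proof.
move=> h; rewrite !mval_coef; apply: eq_bigr => i _; congr (_ *: _).
have: (i : nat) \in iota 0 (size env) by rewrite mem_iota /= ltn_ord.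
elim: (iota _ _) h => //= j r ih [e_j h]; rewrite inE => /predU1P[->//|]; exact: ih.
Qed.
End ModuleExpressions.

Ltac mod_index_syntactic x env :=
  lazymatch env with
  | x :: _ => constr:(0%N)
  | _ :: ?r => let n := mod_index_syntactic x r in constr:(n.+1)
  end.
(* Atoms are compared up to conversion, since different inheritance paths may
   lead to the same algebraic structure. *)
Ltac mod_index_conversion x env :=
  lazymatch env with
  | ?y :: ?r =>
    match constr:(Set) with
    | _ => let _ := constr:(erefl x : x = y) in constr:(0%N)
    | _ => let n := mod_index_conversion x r in constr:(n.+1)
    end
  end.
Ltac mod_index x env :=
  match constr:(Set) with
  | _ => mod_index_syntactic x env
  | _ => mod_index_conversion x env
  end.
Ltac mod_add x env :=
  match constr:(Set) with
  | _ => let _ := mod_index x env in env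
  | _ => constr:(x :: env)
  end.
Ltac mod_env t env :=
  lazymatch t with
  | GRing.add ?a ?b => let env := mod_env a env in mod_env b env
  | GRing.opp ?a => mod_env a env
  | GRing.scale _ ?a => mod_env a env
  | GRing.zero => env
  | ?a => mod_add a env
  end.
Ltac mod_reify k t env :=
  lazymatch t with
  | GRing.add ?a ?b =>
    let x := mod_reify k a env in let y := mod_reify k b env in
    constr:(MAdd x y)
  | GRing.opp ?a => let x := mod_reify k a env in constr:(MOpp x)
  | GRing.scale ?c ?a => let x := mod_reify k a env in constr:(MScale (c : k) x)
  | GRing.zero => constr:(MZero k)
  | ?a => let n := mod_index a env in constr:(MVar k n)
  end.
(* Proves equations between linear combinations, comparing coefficients by [ring]. *)
Ltac module k M :=
  lazymatch goal with
  | |- ?a = ?b =>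
    let env := mod_env a (@nil M) in
    let env := mod_env b env in
    let x := mod_reify k a env in
    let y := mod_reify k b env in
    change (mval env x = mval env y); apply: mexpr_eq;
    rewrite /=; repeat split; ring
  end.

(** Signs are compared through the parities of the atoms in their exponents. Subtractions and
    predecessors are opaque to [parity], so exponents containing them are first brought to common
    atoms. *)
Lemma signE (k : comNzRingType) n : (-1) ^+ n = (if odd n then -1 else 1) :> k.
Proof. by rewrite -signr_odd; case: odd. Qed.

Ltac parity :=
  rewrite !signE /= ?(oddD, oddM) /= ?(oddD, oddM) /= ?(oddD, oddM) /=;
  repeat match goal with |- context [odd ?n] => case: (odd n) => /= end.

(** * Braces in an operad with multiplication *)

Section NatSums.
Variables (k : comNzRingType) (M : lmodType k).

(* Splits the inputs of x o_i y (x of arity p, y of arity q) into those of x to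
   the left of i, those of y, and those of x to the right of i. *)
Lemma big_insertion a p q i (F : nat -> M) : (a <= i < p)%N ->
  \sum_(a <= m < (p + q).-1) F m =
  \sum_(a <= m < i) F m + \sum_(0 <= m < q) F (i + m)%N
  + \sum_(i.+1 <= j < p) F (j + q).-1.
Proof.
case/andP=> le_ai lt_ip; rewrite (@big_cat_nat _ _ _ i) /=; [|lia|lia].
rewrite [X in _ + X](@big_cat_nat _ _ _ (i + q)) /=; [|lia|lia].
rewrite addrA; congr (_ + _ + _).
  by rewrite -{1}[i]add0n big_addn addKn; apply: eq_bigr => m _; rewrite addnC.
rewrite -[(i + q)%N]add0n -[i.+1]add0n !big_addn.
have -> : ((p + q).-1 - (i + q) = p - i.+1)%N by lia.
by apply: eq_bigr => m _; congr F; lia.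
Qed.

Lemma big_triangle p (F : nat -> nat -> M) :
  \sum_(0 <= i < p) \sum_(i.+1 <= j < p) F i j =
  \sum_(0 <= j < p) \sum_(0 <= i < j) F i j.
Proof.
elim: p => [|p IH]; first by rewrite !big_geq.
rewrite big_nat_recr //= [in RHS]big_nat_recr //= -IH.
rewrite [X in _ + X]big_geq // addr0 -big_split /=.
by apply: eq_big_nat => i /andP[_ lt_ip]; rewrite big_nat_recr.
Qed.

End NatSums.

Section Braces.
Variables (k : comNzRingType) (T : lmodType k).
(* [c p q i x y] inserts y, of arity q, into the input i (counted from 0) of x, of
   arity p, with the sign (-1)^((q - 1)(p - 1 - i)) of the operadic suspension: then
   only the exchange of two parallel insertions produces a sign, the Koszul sign
   [sgn2] for elements of arity p in degree p - 1. *)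
Variable c : nat -> nat -> nat -> {bilinear T -> T -> T}.

Definition sgn2 (p q : nat) : k := (-1) ^+ (p.+1 * q.+1).

Hypothesis c_seq : forall p q r i l x y z, (i < p)%N -> (l < q)%N ->
  c (p + q).-1 r (i + l) (c p q i x y) z = c p (q + r).-1 i x (c q r l y z).
Hypothesis c_par : forall p q r i j x y z, (i < j)%N -> (j < p)%N ->
  c (p + q).-1 r (j + q).-1 (c p q i x y) z =
  sgn2 q r *: c (p + r).-1 q i (c p r j x z) y.

(** The one-argument brace x{y}, Gerstenhaber's pre-Lie product. *)
Definition pre p q x y := \sum_(0 <= i < p) c p q i x y.
(* Up to Koszul signs, the braces x{y,z} and x{y,z,w}. The rightmost argument is
   inserted first, which leaves the positions of the others unchanged. *)
Definition brace2 p q r x y z :=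
  \sum_(0 <= j < p) \sum_(0 <= i < j) c (p + r).-1 q i (c p r j x z) y.
Definition brace3 p q r s x y z w :=
  \sum_(0 <= m < p) \sum_(0 <= j < m) \sum_(0 <= i < j)
    c ((p + s).-1 + r).-1 q i (c (p + s).-1 r j (c p s m x w) z) y.

Lemma prePl p q a x x' y :
  pre p q (a *: x + x') y = a *: pre p q x y + pre p q x' y.
Proof.
rewrite /pre /= scaler_sumr -big_split /=.
by apply: eq_bigr => i _; exact: linearPl.
Qed.
Lemma prePr p q a x y y' :
  pre p q x (a *: y + y') = a *: pre p q x y + pre p q x y'.
Proof.
rewrite /pre /= scaler_sumr -big_split /=.
by apply: eq_bigr => i _; exact: linearPr.
Qed.
Lemma pre0l p q y : pre p q 0 y = 0.
Proof. by have := prePl p q (-1) 0 0 y; rewrite !scaleN1r oppr0 addr0 addNr. Qed.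
Lemma pre0r p q x : pre p q x 0 = 0.
Proof. by have := prePr p q (-1) x 0 0; rewrite !scaleN1r oppr0 addr0 addNr. Qed.
Lemma pre_suml p q I (t : seq I) (F : I -> T) y :
  pre p q (\sum_(i <- t) F i) y = \sum_(i <- t) pre p q (F i) y.
Proof.
apply: (big_morph (fun x => pre p q x y)) => [x x'|]; last exact: pre0l.
by have := prePl p q 1 x x' y; rewrite !scale1r.
Qed.

Lemma brace2P1 p q r a x x' y z :
  brace2 p q r (a *: x + x') y z = a *: brace2 p q r x y z + brace2 p q r x' y z.
Proof.
rewrite /brace2 scaler_sumr -big_split /=; apply: eq_bigr => j _.
rewrite scaler_sumr -big_split /=; apply: eq_bigr => i _.
by rewrite linearPl linearPl.
Qed.
Lemma brace2_suml p q r I (t : seq I) (F : I -> T) y z :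
  brace2 p q r (\sum_(i <- t) F i) y z = \sum_(i <- t) brace2 p q r (F i) y z.
Proof.
apply: (big_morph (fun x => brace2 p q r x y z)) => [x x'|].
  by have := brace2P1 p q r 1 x x' y z; rewrite !scale1r.
by have := brace2P1 p q r (-1) 0 0 y z; rewrite !scaleN1r oppr0 addr0 addNr.
Qed.
Lemma brace2_0l p q r y z : brace2 p q r 0 y z = 0.
Proof.
by have := brace2_suml p q r (Nil unit) (fun=> 0) y z; rewrite !big_nil.
Qed.
Lemma brace2P2 p q r a x y y' z :
  brace2 p q r x (a *: y + y') z = a *: brace2 p q r x y z + brace2 p q r x y' z.
Proof.
rewrite /brace2 scaler_sumr -big_split /=; apply: eq_bigr => j _.
rewrite scaler_sumr -big_split /=; apply: eq_bigr => i _.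
by rewrite linearPr.
Qed.
Lemma brace2P3 p q r a x y z z' :
  brace2 p q r x y (a *: z + z') = a *: brace2 p q r x y z + brace2 p q r x y z'.
Proof.
rewrite /brace2 scaler_sumr -big_split /=; apply: eq_bigr => j _.
rewrite scaler_sumr -big_split /=; apply: eq_bigr => i _.
by rewrite linearPr linearPl.
Qed.

(** z stands left of y, inside y, or right of y. The terms with z on the left already have the form
    of a brace with z before y; those on the right must be reordered by [c_par], which is the source
    of [sgn2 q r]. *)
Lemma insertion_pre p q r i x y z : (i < p)%N ->
  pre (p + q).-1 r (c p q i x y) z =
  \sum_(0 <= m < i) c (p + q).-1 r m (c p q i x y) z
  + c p (q + r).-1 i x (pre q r y z)
  + sgn2 q r *: \sum_(i.+1 <= j < p) c (p + r).-1 q i (c p r j x z) y.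
Proof.
move=> lt_ip; rewrite /pre (@big_insertion k T 0 p q i) // linear_sumr scaler_sumr.
congr (_ + _ + _); apply: eq_big_nat => j /andP[? ?].
  by rewrite c_seq.
by rewrite c_par.
Qed.

(** The pre-Lie relation: the associator is a sum of two braces and therefore graded symmetric in y
    and z. *)
Lemma pre_pre p q r x y z :
  pre (p + q).-1 r (pre p q x y) z =
  pre p (q + r).-1 x (pre q r y z) + brace2 p r q x z y
  + sgn2 q r *: brace2 p q r x y z.
Proof.
rewrite {2}/pre pre_suml (eq_big_nat _ _ (F2 := fun i =>
  \sum_(0 <= m < i) c (p + q).-1 r m (c p q i x y) z
  + c p (q + r).-1 i x (pre q r y z)
  + sgn2 q r *: \sum_(i.+1 <= j < p) c (p + r).-1 q i (c p r j x z) y)).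
  by rewrite !big_split /= -scaler_sumr big_triangle [_ + pre _ _ _ _]addrC.
by move=> i /andP[_ lt_ip]; rewrite insertion_pre.
Qed.

(** w has five places: inside y, inside z, or in x to the left of both, between them, or to the
    right. Each argument that w follows contributes its Koszul sign. *)
Lemma brace2_pre p q r s x y z w :
  pre ((p + r).-1 + q).-1 s (brace2 p q r x y z) w =
  brace2 p (q + s).-1 r x (pre q s y w) z
  + sgn2 q s *: brace2 p q (r + s).-1 x y (pre r s z w)
  + brace3 p s q r x w y z + sgn2 q s *: brace3 p q s r x y w z
  + (sgn2 q s * sgn2 r s) *: brace3 p q r s x y z w.
Proof.
have step i j : (i < j)%N -> (j < p)%N ->
  pre ((p + r).-1 + q).-1 s (c (p + r).-1 q i (c p r j x z) y) w =
  c (p + r).-1 (q + s).-1 i (c p r j x z) (pre q s y w)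
  + sgn2 q s *: c (p + (r + s).-1).-1 q i (c p (r + s).-1 j x (pre r s z w)) y
  + \sum_(0 <= m < i)
      c ((p + r).-1 + q).-1 s m (c (p + r).-1 q i (c p r j x z) y) w
  + sgn2 q s *: \sum_(i.+1 <= m < j)
      c ((p + r).-1 + s).-1 q i (c (p + r).-1 s m (c p r j x z) w) y
  + (sgn2 q s * sgn2 r s) *: \sum_(j.+1 <= m < p)
      c ((p + s).-1 + r).-1 q i (c (p + s).-1 r j (c p s m x w) z) y.
  move=> lt_ij lt_jp; rewrite insertion_pre; last by lia.
  rewrite (@big_insertion k T i.+1 p r j) ?lt_ij // !scalerDr.
  have -> : \sum_(0 <= m < r)
      c ((p + r).-1 + s).-1 q i (c (p + r).-1 s (j + m) (c p r j x z) w) y =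
    c (p + (r + s).-1).-1 q i (c p (r + s).-1 j x (pre r s z w)) y.
    rewrite linear_sumr linear_sumlz; apply: eq_big_nat => m /andP[_ lt_mr].
    rewrite c_seq //; congr (c _ _ _ _ _); lia.
  have -> : \sum_(j.+1 <= m < p)
      c ((p + r).-1 + s).-1 q i (c (p + r).-1 s (m + r).-1 (c p r j x z) w) y =
    sgn2 r s *: \sum_(j.+1 <= m < p)
      c ((p + s).-1 + r).-1 q i (c (p + s).-1 r j (c p s m x w) z) y.
    rewrite scaler_sumr; apply: eq_big_nat => m /andP[lt_jm lt_mp].
    rewrite c_par // linearZl_LR /=; congr (_ *: c _ _ _ _ _); lia.
  by module k T.
rewrite {1}/brace2 pre_suml (eq_big_nat _ _ (F2 := fun j => \sum_(0 <= i < j)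
  (c (p + r).-1 (q + s).-1 i (c p r j x z) (pre q s y w)
  + sgn2 q s *: c (p + (r + s).-1).-1 q i (c p (r + s).-1 j x (pre r s z w)) y
  + \sum_(0 <= m < i)
      c ((p + r).-1 + q).-1 s m (c (p + r).-1 q i (c p r j x z) y) w
  + sgn2 q s *: \sum_(i.+1 <= m < j)
      c ((p + r).-1 + s).-1 q i (c (p + r).-1 s m (c p r j x z) w) y
  + (sgn2 q s * sgn2 r s) *: \sum_(j.+1 <= m < p)
      c ((p + s).-1 + r).-1 q i (c (p + s).-1 r j (c p s m x w) z) y))); last first.
  move=> j /andP[_ lt_jp]; rewrite pre_suml.
  by apply: eq_big_nat => i /andP[_ lt_ij]; exact: step.
under eq_bigr do rewrite !big_split /= -!scaler_sumr big_triangle exchange_big /=.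
by rewrite !big_split /= -!scaler_sumr big_triangle.
Qed.

(** z precedes w, and each of them is left of y, inside y or right of y; this leaves six
    configurations. *)
Lemma brace2_of_pre p q r s x y z w :
  brace2 (p + q).-1 r s (pre p q x y) z w =
  pre p ((q + s).-1 + r).-1 x (brace2 q r s y z w)
  + brace2 p r (q + s).-1 x z (pre q s y w)
  + sgn2 q s *: brace2 p (q + r).-1 s x (pre q r y z) w
  + brace3 p r s q x z w y + sgn2 q s *: brace3 p r q s x z y w
  + (sgn2 q s * sgn2 q r) *: brace3 p q r s x y z w.
Proof.
pose D := (p + q).-1.
have step i : (i < p)%N -> brace2 D r s (c p q i x y) z w =
  c p ((q + s).-1 + r).-1 i x (brace2 q r s y z w)
  + \sum_(0 <= l < i)
      c (p + (q + s).-1).-1 r l (c p (q + s).-1 i x (pre q s y w)) z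
  + sgn2 q s *: \sum_(i.+1 <= j < p)
      c (p + s).-1 (q + r).-1 i (c p s j x w) (pre q r y z)
  + \sum_(0 <= m < i) \sum_(0 <= l < m)
      c (D + s).-1 r l (c D s m (c p q i x y) w) z
  + sgn2 q s *: \sum_(i.+1 <= j < p) \sum_(0 <= l < i)
      c ((p + s).-1 + q).-1 r l (c (p + s).-1 q i (c p s j x w) y) z
  + (sgn2 q s * sgn2 q r) *: \sum_(i.+1 <= j < p) \sum_(i.+1 <= m < j)
      c ((p + s).-1 + r).-1 q i (c (p + s).-1 r m (c p s j x w) z) y.
  move=> lt_ip; rewrite {1}/brace2 (@big_insertion k T 0 p q i) //=.
  have -> : \sum_(0 <= m < q) \sum_(0 <= l < i + m)
      c (D + s).-1 r l (c D s (i + m) (c p q i x y) w) z =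
    \sum_(0 <= l < i)
      c (p + (q + s).-1).-1 r l (c p (q + s).-1 i x (pre q s y w)) z
    + c p ((q + s).-1 + r).-1 i x (brace2 q r s y z w).
    transitivity (\sum_(0 <= m < q) (\sum_(0 <= l < i)
        c (p + (q + s).-1).-1 r l (c p (q + s).-1 i x (c q s m y w)) z
      + c p ((q + s).-1 + r).-1 i x
          (\sum_(0 <= l < m) c (q + s).-1 r l (c q s m y w) z))).
      apply: eq_big_nat => m /andP[_ lt_mq]; rewrite c_seq //.
      rewrite (@big_cat_nat _ _ _ i) ?leq_addr //=; congr (_ + _).
        by apply: eq_big_nat => l _; congr (c _ _ _ _ _); rewrite /D; lia.
      rewrite -{1}[i]add0n big_addn addKn linear_sumr.
      apply: eq_big_nat => l /andP[_ lt_lm]; rewrite [(l + i)%N]addnC.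
      have -> : (D + s).-1 = (p + (q + s).-1).-1 by rewrite /D; lia.
      by rewrite c_seq //; lia.
    rewrite big_split /= exchange_big /= -linear_sumr; congr (_ + _).
    by apply: eq_bigr => l _; rewrite linear_sumr linear_sumlz.
  (* Here w is right of y, and z may be left of y, inside y, or between y and w. *)
  have -> : \sum_(i.+1 <= j < p) \sum_(0 <= l < (j + q).-1)
      c (D + s).-1 r l (c D s (j + q).-1 (c p q i x y) w) z =
    sgn2 q s *: \sum_(i.+1 <= j < p) (\sum_(0 <= l < i)
        c ((p + s).-1 + q).-1 r l (c (p + s).-1 q i (c p s j x w) y) z
      + c (p + s).-1 (q + r).-1 i (c p s j x w) (pre q r y z)
      + sgn2 q r *: \sum_(i.+1 <= m < j)
        c ((p + s).-1 + r).-1 q i (c (p + s).-1 r m (c p s j x w) z) y).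
    rewrite scaler_sumr; apply: eq_big_nat => j /andP[lt_ij lt_jp].
    rewrite c_par // (@big_insertion k T 0 j q i) //= linear_sumr !scalerDr.
    rewrite !scaler_sumr.
    have ED : (D + s).-1 = ((p + s).-1 + q).-1 by rewrite /D; lia.
    congr (_ + _ + _); apply: eq_big_nat => l /andP[lt_l lt_l'].
    - by rewrite linearZl_LR /= ED.
    - rewrite linearZl_LR /= ED c_seq //; lia.
    - rewrite linearZl_LR /= ED c_par ?scalerA //; lia.
  rewrite !big_split /= -scaler_sumr; module k T.
rewrite {1}/pre brace2_suml (eq_big_nat _ _ (fun i h => step i (andP h).2)).
rewrite !big_split /= -!scaler_sumr !big_triangle; congr (_ + _ *: _).
by apply: eq_bigr => j _; rewrite big_triangle.
Qed.

Lemma pre0 q x y : pre 0 q x y = 0.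
Proof. by rewrite /pre big_geq. Qed.
Lemma brace2_small p q r x y z : (p < 2)%N -> brace2 p q r x y z = 0.
Proof.
case: p => [|[|//]] _; rewrite /brace2; first by rewrite big_geq.
by rewrite big_nat1 big_geq.
Qed.
Lemma brace3_small p q r s x y z w : (p < 3)%N -> brace3 p q r s x y z w = 0.
Proof.
move=> lt_p3; rewrite /brace3 big_nat_cond big1 // => m; rewrite andbT.
case/andP=> _ lt_mp; rewrite big_nat_cond big1 // => j; rewrite andbT.
by case/andP=> _ lt_jm; rewrite big_geq //; lia.
Qed.

(** * Differential, cup product and bracket defined by a multiplication *)

Variable mu : T.
(** Associativity of the multiplication: in the suspended signs the two insertions of [mu] into
    itself carry opposite signs. *)
Hypothesis pre_mu : pre 2 2 mu mu = 0.

(* The bracket [mu, x]. *)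
Definition hoch p x := (-1) ^+ p *: pre p 2 x mu + pre 2 p mu x.
(** The sign cancels those of the suspension, so that this product is dual to [cup_coproduct], which
    carries no signs; see [ev2_cup]. *)
Definition cup p q x y := (-1) ^+ (p.+1 * q) *: brace2 2 p q mu x y.
Definition bracket p q x y := pre p q x y - sgn2 p q *: pre q p y x.

Lemma hochP p a x y : hoch p (a *: x + y) = a *: hoch p x + hoch p y.
Proof.
rewrite /hoch prePl prePr; module k T.
Qed.

(** Since [mu] has odd degree, the brace x{mu,mu} occurs twice with opposite signs; the remaining
    terms cancel by the pre-Lie relation for mu{mu}{x}, where mu{mu} = 0. *)
Lemma hoch_hoch p x : hoch p.+1 (hoch p x) = 0.
Proof.
rewrite /hoch !(prePl, prePr).
have E1 := pre_pre p 2 2 x mu mu; have E2 := pre_pre 2 p 2 mu x mu.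
have E3 := pre_pre 2 2 p mu mu x.
rewrite pre_mu pre0l in E3; rewrite pre_mu pre0r add0r addn2 in E1.
rewrite /= in E1 E2 E3; rewrite addn2 /= in E2.
have {}E3 : pre 2 p.+1 mu (pre 2 p mu x) =
    - (brace2 2 p 2 mu x mu + sgn2 2 p *: brace2 2 2 p mu mu x).
  by apply/eqP; rewrite -addr_eq0 addrA -E3.
rewrite E1 E2 E3 /sgn2; parity; module k T.
Qed.

(** The differential fails to be a derivation of x{y} exactly by the graded commutator of the cup
    product; this comes from the pre-Lie relations for x{y}{mu}, x{mu}{y} and mu{x}{y}. *)
Lemma hoch_pre p q x y :
  hoch (p + q).-1 (pre p q x y) =
  pre p.+1 q (hoch p x) y + (-1) ^+ p.+1 *: pre p q.+1 x (hoch q y)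
  - (brace2 2 q p mu y x + sgn2 p q *: brace2 2 p q mu x y).
Proof.
have E1 := pre_pre p q 2 x y mu; have E2 := pre_pre p 2 q x mu y.
have E3 := pre_pre 2 p q mu x y.
rewrite /= in E1 E2 E3; rewrite !addn2 /= in E1 E2.
rewrite /hoch !(prePl, prePr) E1 E2 E3 /sgn2; case: p {E1 E2 E3} => [|p].
  by rewrite !(pre0, brace2_small (p := 0)) // pre0r; parity; module k T.
by rewrite addSn; parity; module k T.
Qed.

(** Expanding x{y,z}{mu}, mu{x}{y,z} and x{mu}{y,z}, the terms with three insertions into x cancel.
    Besides the differentials of x, y and z there remain x{mu{y,z}}, mu{y,x{z}} and mu{x{y},z}, the
    three terms of a Leibniz rule. *)
Lemma hoch_brace2 p q r x y z :
  hoch ((p + r).-1 + q).-1 (brace2 p q r x y z) =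
  brace2 p.+1 q r (hoch p x) y z
  + (-1) ^+ p.+1 *: brace2 p q r.+1 x y (hoch r z)
  + (-1) ^+ (p + r) *: brace2 p q.+1 r x (hoch q y) z
  + (-1) ^+ p.+1 *: pre p (q + r) x (brace2 2 q r mu y z)
  - brace2 2 q (p + r).-1 mu y (pre p r x z)
  - sgn2 p r *: brace2 2 (p + q).-1 r mu (pre p q x y) z.
Proof.
have E1 := brace2_pre p q r 2 x y z mu; have E2 := brace2_of_pre 2 p q r mu x y z.
have E3 := brace2_of_pre p 2 q r x mu y z.
rewrite !(@brace3_small 2) // in E2.
rewrite /= in E1 E2 E3; rewrite !addn2 /= ?[(r + q)%N]addnC in E1 E2 E3.
rewrite /hoch !(brace2P1, brace2P2, brace2P3) E1 E2 E3 /sgn2.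
have [lt_p2|] := ltnP p 2.
  rewrite !(brace2_small _ _ _ _ _ lt_p2) pre0r.
  rewrite !brace3_small; try by rewrite ltnW.
  by case: p lt_p2 {E1 E2 E3} => [|[|//]] _; parity; module k T.
case: p {E1 E2 E3} => [|[|p]] // _; rewrite !addSn /=.
parity; module k T.
Qed.

Lemma hochZ p a x : hoch p (a *: x) = a *: hoch p x.
Proof.
by rewrite -[a *: _]addr0 hochP {2}/hoch pre0l pre0r scaler0 !addr0.
Qed.

(** This is [hoch_brace2] for the closed element [mu]; its leftover terms are those of mu{mu}{x,y},
    which vanishes. *)
Lemma hoch_cup p q x y :
  hoch (p + q) (cup p q x y) =
  cup p.+1 q (hoch p x) y + (-1) ^+ p *: cup p q.+1 x (hoch q y).
Proof.
have mu_closed : hoch 2 mu = 0 by rewrite /hoch pre_mu scaler0 addr0.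
have E := brace2_of_pre 2 2 p q mu mu x y.
rewrite pre_mu brace2_0l !(@brace3_small 2) // !scaler0 !addr0 /= addnC in E.
have {}E : pre 2 (p + q) mu (brace2 2 p q mu x y) =
    - brace2 2 p q.+1 mu x (pre 2 q mu y)
    - sgn2 2 q *: brace2 2 p.+1 q mu (pre 2 p mu x) y.
  by apply/eqP; rewrite -subr_eq0 !opprD !opprK addrA -E.
have := hoch_brace2 2 p q mu x y.
rewrite mu_closed brace2_0l /= [(q + p)%N]addnC /cup hochZ => ->.
by rewrite E /sgn2; parity; module k T.
Qed.

(** The defect in [hoch_pre] is graded symmetric and disappears on antisymmetrization. *)
Lemma hoch_bracket p q x y :
  hoch (p + q).-1 (bracket p q x y) =
  bracket p.+1 q (hoch p x) y + (-1) ^+ p.+1 *: bracket p q.+1 x (hoch q y).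
Proof.
rewrite /bracket addrC -scaleNr hochP [in hoch _ (pre q p _ _)]addnC !hoch_pre.
by rewrite /sgn2; parity; module k T.
Qed.

Lemma cup_comm p q x y :
  (-1) ^+ (q * p) *: cup q p y x - cup p q x y =
  (-1) ^+ p *: (pre p.+1 q (hoch p x) y + (-1) ^+ p.+1 *: pre p q.+1 x (hoch q y)
                - hoch (p + q).-1 (pre p q x y)).
Proof. by rewrite hoch_pre /cup /sgn2; parity; module k T. Qed.

(* The parity of a total degree (p + q).-1 is wrong only for p = q = 0, when the
   bracket vanishes. *)
Lemma bracket_sign p q (e f : nat) (g : T -> T) x y : g 0 = 0 ->
  ((0 < p + q)%N -> odd e = odd f) ->
  (-1) ^+ e *: g (bracket p q x y) = (-1) ^+ f *: g (bracket p q x y).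
Proof.
have [/eqP|pq_gt0] := posnP (p + q); last first.
  by move=> _ /(_ isT) Eef; rewrite -signr_odd Eef signr_odd.
rewrite addn_eq0 => /andP[/eqP-> /eqP->] g0 _.
by rewrite /bracket !pre0 scaler0 subr0 g0 !scaler0.
Qed.

(** As in every pre-Lie algebra, the symmetry of the associator gives the Jacobi identity. The signs
    are those of the two cyclic permutations composed from [rho12] and [rho23]. *)
Lemma bracket_jacobi p q r x y z :
  bracket (p + q).-1 r (bracket p q x y) z
  + (-1) ^+ (r.+1 * q.+1) *: ((-1) ^+ (r.+1 * p.+1) *:
      bracket (r + p).-1 q (bracket r p z x) y)
  + (-1) ^+ (q.+1 * p.+1) *: ((-1) ^+ (r.+1 * p.+1) *:
      bracket (q + r).-1 p (bracket q r y z) x) = 0.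
Proof.
have E p1 q1 r1 x1 y1 z1 : bracket (p1 + q1).-1 r1 (bracket p1 q1 x1 y1) z1 =
    pre (p1 + q1).-1 r1 (bracket p1 q1 x1 y1) z1
    - (-1) ^+ ((p1 + q1) * r1.+1) *: pre r1 (p1 + q1).-1 z1 (bracket p1 q1 x1 y1).
  rewrite {1}/bracket; congr (_ - _).
  apply: (@bracket_sign _ _ _ _ (pre r1 _ z1)); first exact: pre0r.
  by move/prednK->; rewrite !oddM.
rewrite !E /bracket.
have F p1 q1 r1 x1 y1 z1 a :
    pre (p1 + q1).-1 r1 (pre p1 q1 x1 y1 - a *: pre q1 p1 y1 x1) z1 =
    pre (p1 + q1).-1 r1 (pre p1 q1 x1 y1) z1
    - a *: pre (q1 + p1).-1 r1 (pre q1 p1 y1 x1) z1.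
  by rewrite addrC -scaleNr prePl [(q1 + p1)%N]addnC; module k T.
have G p1 q1 r1 x1 y1 z1 a :
    pre r1 (p1 + q1).-1 z1 (pre p1 q1 x1 y1 - a *: pre q1 p1 y1 x1) =
    pre r1 (p1 + q1).-1 z1 (pre p1 q1 x1 y1)
    - a *: pre r1 (q1 + p1).-1 z1 (pre q1 p1 y1 x1).
  by rewrite addrC -scaleNr prePr [(q1 + p1)%N]addnC; module k T.
rewrite !F !G !pre_pre /sgn2 ![(r + p)%N]addnC ![(q + p)%N]addnC ![(r + q)%N]addnC.
parity; module k T.
Qed.

(** A degree such as [(r + p).-1] has the wrong parity only for r = 0 and p = 0, and then the
    one-argument brace with first arity 0 vanishes. *)
Lemma pre_sign p q (e f : nat) (g : T -> T) x y : g 0 = 0 ->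
  ((0 < p)%N -> odd e = odd f) ->
  (-1) ^+ e *: g (pre p q x y) = (-1) ^+ f *: g (pre p q x y).
Proof.
case: p => [|p] g0 h; first by rewrite pre0 g0 !scaler0.
by rewrite -signr_odd h // signr_odd.
Qed.

Lemma brace2_0m p q r x z : brace2 p q r x 0 z = 0.
Proof.
have := brace2P2 p q r (-1) x 0 0 z.
by rewrite !scaleN1r oppr0 addr0 addNr.
Qed.
Lemma brace2_0r p q r x y : brace2 p q r x y 0 = 0.
Proof.
have := brace2P3 p q r (-1) x y 0 0.
by rewrite !scaleN1r oppr0 addr0 addNr.
Qed.

(** This half of the Leibniz rule is strict: [mu] has no third input for x, so x enters y or z. *)
Lemma pre_cup p q r x y z :
  pre (q + r) p (cup q r y z) x =
  cup q (r + p).-1 y (pre r p z x)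
  + (-1) ^+ (p.+1 * r) *: cup (q + p).-1 r (pre q p y x) z.
Proof.
have := brace2_pre 2 q r p mu y z x.
rewrite !(@brace3_small 2) // !scaler0 !addr0 /= /cup [(r + q)%N]addnC => E.
rewrite -[_ *: brace2 2 q r mu y z]addr0 prePl pre0l addr0 E.
rewrite (@pre_sign r p (q.+1 * (r + p).-1) (q.+1 * (r + p).+1)
  (brace2 2 q _ mu y)) ?brace2_0r //; last first.
  by case: r {E} => // r _; rewrite addSn !oddM /= negbK.
rewrite (@pre_sign q p ((q + p).-1.+1 * r) ((q + p) * r)
  (fun t => brace2 2 _ r mu t z)) ?brace2_0m //; last first.
  by case: q {E}.
by rewrite /sgn2; parity; module k T.
Qed.

(** By [pre_cup] the terms with x inserted into y or z cancel; the other half of the bracket is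
    governed by [hoch_brace2], and x{y,z} is the homotopy. *)
Lemma bracket_cup p q r x y z :
  bracket p (q + r) x (cup q r y z)
  - (cup (p + q).-1 r (bracket p q x y) z
     + (-1) ^+ (q * p.+1) *: cup q (p + r).-1 y (bracket p r x z)) =
  (-1) ^+ (p + q.+1 * r) *:
    (brace2 p.+1 q r (hoch p x) y z
     + (-1) ^+ p.+1 *: brace2 p q r.+1 x y (hoch r z)
     + (-1) ^+ (p + r) *: brace2 p q.+1 r x (hoch q y) z
     - hoch ((p + r).-1 + q).-1 (brace2 p q r x y z)).
Proof.
rewrite hoch_brace2 {1}/bracket pre_cup.
have E1 : cup (p + q).-1 r (bracket p q x y) z =
    (-1) ^+ ((p + q) * r) *: (brace2 2 (p + q).-1 r mu (pre p q x y) z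
    - sgn2 p q *: brace2 2 (q + p).-1 r mu (pre q p y x) z).
  rewrite /cup (@bracket_sign _ _ _ ((p + q) * r)
    (fun t => brace2 2 _ r mu t z)) ?brace2_0m //; last first.
    by move/prednK->.
  by rewrite /bracket addrC -scaleNr brace2P2 [(q + p)%N]addnC; module k T.
have E2 : cup q (p + r).-1 y (bracket p r x z) =
    (-1) ^+ (q.+1 * (p + r).+1) *: (brace2 2 q (p + r).-1 mu y (pre p r x z)
    - sgn2 p r *: brace2 2 q (r + p).-1 mu y (pre r p z x)).
  rewrite /cup (@bracket_sign _ _ _ (q.+1 * (p + r).+1)
    (brace2 2 q _ mu y)) ?brace2_0r //; last first.
    by move/prednK=> <-; rewrite !oddM /= negbK.
  by rewrite /bracket addrC -scaleNr brace2P3 [(r + p)%N]addnC; module k T.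
rewrite E1 E2 /cup /sgn2 -[(-1) ^+ (q.+1 * r) *: _]addr0 prePr pre0r addr0.
rewrite ![(r + p)%N]addnC ![(q + p)%N]addnC.
have E3 : (-1) ^+ (q.+1 * (p + r).-1) *: brace2 2 q (p + r).-1 mu y (pre r p z x) =
    (-1) ^+ (q.+1 * (p + r).+1) *: brace2 2 q (p + r).-1 mu y (pre r p z x).
  apply: (@pre_sign _ _ _ _ (brace2 2 q _ mu y)); rewrite ?brace2_0r //.
  by case: r {E1 E2} => // r _; rewrite addnS !oddM /= negbK.
have E4 : (-1) ^+ ((p + q).-1.+1 * r) *: brace2 2 (p + q).-1 r mu (pre q p y x) z =
    (-1) ^+ ((p + q) * r) *: brace2 2 (p + q).-1 r mu (pre q p y x) z.
  apply: (@pre_sign _ _ _ _ (fun t => brace2 2 _ r mu t z)); rewrite ?brace2_0m //.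
  by case: q {E1 E2 E3} => // q _; rewrite addnS.
by rewrite E3 E4; parity; module k T.
Qed.

(** The brace inserts y first, [cup_coproduct] corresponds to inserting x first; one use of [c_par]
    exchanges them. *)
Lemma cupE p q x y :
  cup p q x y = (-1) ^+ p.+1 *: c p.+1 q p (c 2 p 0 mu x) y.
Proof.
have := @c_par 2 p q 0 1 mu x y isT isT; rewrite add1n /= /cup => ->.
have -> : brace2 2 p q mu x y = c q.+1 p 0 (c 2 q 1 mu y) x.
  by rewrite /brace2 big_nat_recr //= !big_nat1 big_geq // add0r.
by rewrite /sgn2; parity; module k T.
Qed.

(** Both sides are reduced to x, y and z inserted into the same composite of [mu] with itself;
    [pre_mu] supplies the one comparison of composites. *)
Lemma cup_assoc p q r x y z :
  cup (p + q) r (cup p q x y) z = cup p (q + r) x (cup q r y z).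
Proof.
have mu2 : c 2 2 1 mu mu = - c 2 2 0 mu mu.
  have := pre_mu; rewrite /pre big_nat_recr //= big_nat1 => /eqP.
  by rewrite addrC addr_eq0 => /eqP.
have L : c 2 (p + q) 0 mu (c p.+1 q p (c 2 p 0 mu x) y) =
    c p.+2 q p (c 3 p 0 (c 2 2 0 mu mu) x) y.
  have := @c_seq 2 p.+1 q 0 p mu (c 2 p 0 mu x) y isT (leqnn _).
  by have := @c_seq 2 2 p 0 0 mu mu x isT isT => /= -> ->.
have R : c p.+1 (q + r) p (c 2 p 0 mu x) (c q.+1 r q (c 2 q 0 mu y) z) =
    - sgn2 p 2 *: c (p + q).+1 r (p + q)
      (c p.+2 q p (c 3 p 0 (c 2 2 0 mu mu) x) y) z.
  have := @c_seq p.+1 q.+1 r p q (c 2 p 0 mu x) (c 2 q 0 mu y) z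
    (leqnn _) (leqnn _); rewrite addSn addnS /= => <-.
  have := @c_seq p.+1 2 q p 0 (c 2 p 0 mu x) mu y (leqnn _) isT.
  rewrite /= addn0 addn2 /= => <-.
  have := @c_par 2 p 2 0 1 mu x mu isT isT; rewrite add1n /= => ->.
  by rewrite mu2 linearNl scalerN -scaleNr !linearZl_LR.
rewrite !cupE linearZr_LR [in RHS]linearZr_LR linearZl_LR /= L R /sgn2.
by parity; module k T.
Qed.

End Braces.

(** * Commutative algebras containing tensor products *)

Section TensorInduction.
Variable k : comNzRingType.
Implicit Types M N Q P : lmodType k.

Lemma tpure0r M N (m : M) : tpure m (0 : N) = 0.
Proof. exact: linear0. Qed.
Lemma tpureZl M N a (m : M) (n : N) : tpure (a *: m) n = a *: tpure m n.
Proof.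
have := tpurePl a m 0 n; rewrite addr0 => ->.
by have := tpurePl (-1) (0 : M) 0 n; rewrite !scaleN1r oppr0 addr0 addNr => ->; rewrite addr0.
Qed.

Lemma tpureDl M N (m m' : M) (n : N) : tpure (m + m') n = tpure m n + tpure m' n.
Proof. by have := tpurePl 1 m m' n; rewrite !scale1r. Qed.
Lemma tpureDr M N (m : M) (n n' : N) : tpure m (n + n') = tpure m n + tpure m n'.
Proof. exact: linearD. Qed.

(** Scalars are absorbed into the left factor of a pure tensor, and 0 is itself pure. *)
Lemma tensor_ind M N (P : M ⊗ N -> Prop) :
  (forall m n, P (tpure m n)) -> (forall x y, P x -> P y -> P (x + y)) ->
  forall t, P t.
Proof.
move=> Ppure PD t; rewrite -[t]quotmod_piK.
move: (repr _ : {freeg (M * N) / k}) => x.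
rewrite -[x]freeg_sumE raddf_sum /=; elim/big_rec: _ => [|[m n] y _ Py].
  by rewrite -(tpure0r N (0 : M)).
apply: PD => //.
have -> : << coeff (m, n) x *g (m, n) >> =
    coeff (m, n) x *: (<< (m, n) >> : {freeg (M * N) / k}).
  by apply/eqP/freeg_eqP => z; rewrite coeffZ !coeffU mul1r.
have -> : quotmod_pi (Defs.span (@tensor_rel k M N)) (coeff (m, n) x *: << (m, n) >>) =
    tpure (coeff (m, n) x *: m) n by rewrite tpureZl linearZ.
exact: Ppure.
Qed.

Lemma tensor3_ext M N Q P (g h : {linear M ⊗ N ⊗ Q -> P}) :
  (forall m n q, g (tpure (tpure m n) q) = h (tpure (tpure m n) q)) -> g =1 h.
Proof.
move=> gh; apply: tensor_ext => t q; elim/tensor_ind: t => // x y gx gy.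
by rewrite tpureDl (linearD g) (linearD h) gx gy.
Qed.

Lemma tensor3r_ext M N Q P (g h : {linear M ⊗ (N ⊗ Q) -> P}) :
  (forall m n q, g (tpure m (tpure n q)) = h (tpure m (tpure n q))) -> g =1 h.
Proof.
move=> gh; apply: tensor_ext => m t; elim/tensor_ind: t => // x y gx gy.
by rewrite tpureDr (linearD g) (linearD h) gx gy.
Qed.

End TensorInduction.

Section CommutativeAlgebras.
Variable k : comNzRingType.

(** The product is a linear map on the tensor square, so that it composes directly with [tmap] in
    the evaluations. *)
Record calg := Calg {
  calg_sort :> lmodType k;
  cmul : {linear calg_sort ⊗ calg_sort -> calg_sort};
  cone : calg_sort;
  cmulC : forall a b, cmul (tpure a b) = cmul (tpure b a);
  cmulA : forall a b c,
    cmul (tpure a (cmul (tpure b c))) = cmul (tpure (cmul (tpure a b)) c);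
  cmul1 : forall a, cmul (tpure cone a) = a
}.

Section SquareZero.
Variable M : lmodType k.

Definition sqz_mul (x y : k^o * M) : k^o * M :=
  (x.1 * y.1, (x.1 : k) *: y.2 + (y.1 : k) *: x.2).
Fact sqz_bilinear : bilinear_for *:%R *:%R sqz_mul.
Proof.
split=> [[b n]|[b n]] s [a m] [a' m']; congr pair => /=.
- by rewrite mulrDl scalerAl.
- by rewrite scalerDl !scalerDr !scalerA addrACA (mulrC b).
- by rewrite mulrDr scalerAr.
- by rewrite scalerDl !scalerDr !scalerA addrACA (mulrC b).
Qed.
HB.instance Definition _ :=
  @bilinear_isBilinear.Build k (k^o * M)%type (k^o * M)%type (k^o * M)%type
    _ _ sqz_mul sqz_bilinear.

Definition sqz_lin : {linear (k^o * M)%type ⊗ (k^o * M)%type -> (k^o * M)%type} :=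
  tlift sqz_mul.
Lemma sqz_mulE x y : sqz_lin (tpure x y) = sqz_mul x y.
Proof. exact: tlift_pure. Qed.

Definition square_zero : calg.
Proof.
apply: (@Calg (k^o * M)%type sqz_lin (1, 0)) => [a b|a b c|a].
- by rewrite !sqz_mulE /sqz_mul mulrC addrC.
- rewrite !sqz_mulE /sqz_mul /=; congr pair; first exact: mulrA.
  by rewrite !scalerDr !scalerA addrA (mulrC c.1) (mulrC c.1).
by rewrite sqz_mulE /sqz_mul /= mul1r scale1r scaler0 addr0; case: a.
Defined.
End SquareZero.

Section TensorAlgebra.
Variables A B : calg.

Definition interchange : {linear (A ⊗ B) ⊗ (A ⊗ B) -> (A ⊗ A) ⊗ (B ⊗ B)} :=
  tassocV \o tmap idfun (tassoc \o tmap tswap idfun \o tassocV) \o tassoc.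
Definition tens_mul : {linear (A ⊗ B) ⊗ (A ⊗ B) -> A ⊗ B} :=
  tmap (cmul A) (cmul B) \o interchange.

Lemma tens_mulE a b a' b' :
  tens_mul (tpure (tpure a b) (tpure a' b')) =
  tpure (cmul A (tpure a a')) (cmul B (tpure b b')).
Proof.
by rewrite /tens_mul /interchange /= tassocE tmapE /= tassocVE tmapE tswapE
  tassocE tassocVE tmapE.
Qed.

Let tens_mulD := linearD tens_mul.

Definition tensor_calg : calg.
Proof.
apply: (@Calg (A ⊗ B) tens_mul (tpure (cone A) (cone B))) => [s t|s t u|s].
- elim/tensor_ind: s => [a b|x y hx hy]; last first.
    by rewrite tpureDl tpureDr !tens_mulD hx hy.
  elim/tensor_ind: t => [a' b'|x y hx hy]; last first.
    by rewrite tpureDl tpureDr !tens_mulD hx hy.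
  by rewrite !tens_mulE !(cmulC a) !(cmulC b).
- elim/tensor_ind: s => [a b|x y hx hy]; last first.
    by rewrite !(tpureDl, tens_mulD) hx hy.
  elim/tensor_ind: t => [a' b'|x y hx hy]; last first.
    by rewrite !(tpureDl, tpureDr, tens_mulD) hx hy.
  elim/tensor_ind: u => [a'' b''|x y hx hy]; last first.
    by rewrite !(tpureDr, tens_mulD) hx hy.
  by rewrite !tens_mulE !cmulA.
elim/tensor_ind: s => [a b|x y hx hy]; last by rewrite tpureDr tens_mulD hx hy.
by rewrite tens_mulE !cmul1.
Defined.
End TensorAlgebra.

End CommutativeAlgebras.

Section TensorMapLemmas.
Variable k : comNzRingType.
Implicit Types A B C D E F G : lmodType k.

Lemma tmap_comp A B C D E F (f : {linear C -> E}) (g : {linear D -> F})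
    (f' : {linear A -> C}) (g' : {linear B -> D}) t :
  tmap f g (tmap f' g' t) = tmap (f \o f') (g \o g') t.
Proof.
move: t; apply: (tensor_ext (g := tmap f g \o tmap f' g')) => a b.
by rewrite /= !tmapE.
Qed.

Lemma tmap_eq A B C D (f f' : {linear A -> C}) (g g' : {linear B -> D}) t :
  f =1 f' -> g =1 g' -> tmap f g t = tmap f' g' t.
Proof.
by move=> ff gg; move: t; apply: tensor_ext => a b; rewrite !tmapE ff gg.
Qed.

Lemma tmap_linl A B C D c (f f' f'' : {linear A -> C}) (g : {linear B -> D}) t :
  (forall x, f x = c *: f' x + f'' x) ->
  tmap f g t = c *: tmap f' g t + tmap f'' g t.
Proof.
move=> E; move: t; apply: (tensor_ext (h := c \*: tmap f' g \+ tmap f'' g)) => a b.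
by rewrite /= !tmapE E tpurePl.
Qed.

Lemma tmap_linr A B C D c (f : {linear A -> C}) (g g' g'' : {linear B -> D}) t :
  (forall x, g x = c *: g' x + g'' x) ->
  tmap f g t = c *: tmap f g' t + tmap f g'' t.
Proof.
move=> E; move: t; apply: (tensor_ext (h := c \*: tmap f g' \+ tmap f g'')) => a b.
by rewrite /= !tmapE E tpurePr.
Qed.

Lemma tmap_id A B (t : A ⊗ B) : tmap idfun idfun t = t.
Proof.
by elim/tensor_ind: t => [a b|x y]; rewrite ?tmapE // (linearD (tmap _ _)) => -> ->.
Qed.
End TensorMapLemmas.

(** * Families of linear maps in all arities *)

Section Families.
Variables (k : comNzRingType) (V : nat -> lmodType k) (A : lmodType k).

Definition fam_linear : {pred ({n & V n} -> A)} := fun f =>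
  `[< forall n a (x y : V n),
      f (existT _ n (a *: x + y)) = a *: f (existT _ n x) + f (existT _ n y) >].
Fact fam_submod_closed : submod_closed fam_linear.
Proof.
split=> [|c f g /asboolP hf /asboolP hg]; apply/asboolP=> n a x y.
  by rewrite /= scaler0 addr0.
have E u : (c *: f + g) u = c *: f u + g u by [].
by rewrite !E hf hg !scalerDr !scalerA (mulrC c) addrACA.
Qed.
HB.instance Definition _ :=
  GRing.isSubmodClosed.Build k ({n & V n} -> A) fam_linear fam_submod_closed.

(* All arities at once: the operations on families take the arities as arguments,
   so that composites of different arities live in the same module. *)
Record fam := Fam { fam_val : {n & V n} -> A; _ : fam_val \in fam_linear }.
HB.instance Definition _ := [isSub for fam_val].
HB.instance Definition _ := [Choice of fam by <:].
HB.instance Definition _ := [SubChoice_isSubLmodule of fam by <:].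

Definition fapp (f : fam) n (x : V n) : A := fam_val f (existT _ n x).

Lemma fapp_is_linear f n : linear (@fapp f n).
Proof. by case: f => f f_lin a x y; have /asboolP := f_lin; exact. Qed.
HB.instance Definition _ f n :=
  GRing.isLinear.Build k (V n) A _ (@fapp f n) (@fapp_is_linear f n).

Lemma fapp_lin a (f g : fam) n x : fapp (a *: f + g) x = a *: fapp f x + @fapp g n x.
Proof. by []. Qed.
Lemma fappD (f g : fam) n x : fapp (f + g) x = fapp f x + @fapp g n x.
Proof. by []. Qed.
Lemma fappN (f : fam) n x : fapp (- f) x = - @fapp f n x.
Proof. by []. Qed.
Lemma fappZ a (f : fam) n x : fapp (a *: f) x = a *: @fapp f n x.
Proof. by []. Qed.
Lemma fapp0 n (x : V n) : fapp 0 x = 0.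
Proof. by []. Qed.
Lemma fapp_sum I (r : seq I) (F : I -> fam) n (x : V n) :
  fapp (\sum_(i <- r) F i) x = \sum_(i <- r) fapp (F i) x.
Proof. exact: (big_morph (fun f => fapp f x)). Qed.
Lemma fam_eq (f g : fam) : (forall n (x : V n), fapp f x = fapp g x) -> f = g.
Proof. by move=> fg; apply/val_inj/funext => -[n x]; exact: fg. Qed.

Fact mkfam_subproof (f : forall n, {linear V n -> A}) :
  (fun u : {n & V n} => f (tag u) (tagged u)) \in fam_linear.
Proof. by apply/asboolP=> n a x y /=; rewrite linearP. Qed.
Definition mkfam f := Fam (mkfam_subproof f).
Lemma mkfamE f n (x : V n) : fapp (mkfam f) x = f n x.
Proof. by []. Qed.

End Families.

(** * The convolution operad of a cooperad *)

Lemma tswapK (k : comNzRingType) (A B : lmodType k) (t : A ⊗ B) : tswap (tswap t) = t.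
Proof.
by elim/tensor_ind: t => [a b|x y]; rewrite ?tswapE // !(linearD tswap) => -> ->.
Qed.

Section Convolution.
Variables (k : comNzRingType) (C : comult_cooperad k) (A : calg k).
Local Notation fam := (fam C A).
Local Notation Δ := (decomp C).
Implicit Types f g h : fam.

Definition flin f n : {linear C n -> A} := @fapp _ _ _ f n.

Definition ev2 f g p q : {linear C p ⊗ C q -> A} :=
  cmul A \o tmap (flin f p) (flin g q).
Definition ev3 f g h p q r : {linear C p ⊗ C q ⊗ C r -> A} :=
  cmul A \o tmap (ev2 f g p q) (flin h r).

Lemma ev2E f g p q x y :
  ev2 f g p q (tpure x y) = cmul A (tpure (fapp f x) (fapp g y)).
Proof. by rewrite /ev2 /= tmapE. Qed.
Lemma ev3E f g h p q r x y z :
  ev3 f g h p q r (tpure (tpure x y) z) =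
  cmul A (tpure (cmul A (tpure (fapp f x) (fapp g y))) (fapp h z)).
Proof. by rewrite /ev3 /= tmapE ev2E. Qed.

Definition conv p q i f g : fam := mkfam (fun n => ev2 f g p q \o Δ n p q i).

Lemma convE p q i f g n x : fapp (conv p q i f g) x = ev2 f g p q (Δ n p q i x).
Proof. by []. Qed.

Lemma ev2_lin1 a f f' g p q t :
  ev2 (a *: f + f') g p q t = a *: ev2 f g p q t + ev2 f' g p q t.
Proof.
rewrite /ev2 /= (@tmap_linl k _ _ _ _ a _ (flin f p) (flin f' p)) //.
exact: linearP.
Qed.
Lemma ev2_lin2 a f g g' p q t :
  ev2 f (a *: g + g') p q t = a *: ev2 f g p q t + ev2 f g' p q t.
Proof.
rewrite /ev2 /= (@tmap_linr k _ _ _ _ a _ _ (flin g q) (flin g' q)) //.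
exact: linearP.
Qed.

Lemma ev2_swap f g p q t : ev2 f g p q (tswap t) = ev2 g f q p t.
Proof.
move: t; apply: (tensor_ext (g := ev2 f g p q \o tswap)) => x y.
change (ev2 f g p q (tswap (tpure x y)) = ev2 g f q p (tpure x y)).
by rewrite tswapE !ev2E cmulC.
Qed.

Lemma ev3_swap23 f g h p q r t :
  ev3 f g h p q r (tassocV (tmap idfun tswap (tassoc t))) = ev3 f h g p r q t.
Proof.
move: t; apply: (tensor3_ext
  (g := ev3 f g h p q r \o tassocV \o tmap idfun tswap \o tassoc)) => x y z.
change (ev3 f g h p q r (tassocV (tmap idfun tswap (tassoc (tpure (tpure x y) z))))
  = ev3 f h g p r q (tpure (tpure x y) z)).
by rewrite tassocE tmapE tswapE tassocVE !ev3E -!cmulA [in LHS](cmulC (fapp g _)).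
Qed.

Lemma ev3_swap12 f g h p q r t :
  ev3 f g h p q r (tmap tswap idfun t) = ev3 g f h q p r t.
Proof.
move: t; apply: (tensor3_ext
  (g := ev3 f g h p q r \o tmap tswap idfun)) => x y z.
change (ev3 f g h p q r (tmap tswap idfun (tpure (tpure x y) z))
  = ev3 g f h q p r (tpure (tpure x y) z)).
by rewrite tmapE tswapE !ev3E (cmulC (fapp f _)).
Qed.

Lemma ev3_assoc f g h p q r t :
  ev3 f g h p q r (tassocV t) = cmul A (tmap (flin f p) (ev2 g h q r) t).
Proof.
move: t; apply: (tensor3r_ext (g := ev3 f g h p q r \o tassocV)
  (h := cmul A \o tmap (flin f p) (ev2 g h q r))) => x y z.
change (ev3 f g h p q r (tassocV (tpure x (tpure y z))) =
  cmul A (tmap (flin f p) (ev2 g h q r) (tpure x (tpure y z)))).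
by rewrite tassocVE ev3E tmapE ev2E cmulA.
Qed.

(** Transposition: a decomposition applied to a tensor factor becomes an operation on the two
    families that evaluate the result. This turns cooperad identities into operad identities. *)
Lemma ev3_mapl f g h p q r m (F : {linear C m -> C p ⊗ C q}) (fg : fam) t :
  (forall x, fapp fg x = ev2 f g p q (F x)) ->
  ev3 f g h p q r (tmap F idfun t) = ev2 fg h m r t.
Proof.
move=> E; rewrite /ev3 /ev2 /= tmap_comp; congr (cmul A _).
by apply: tmap_eq => // x; rewrite [RHS]E.
Qed.

Lemma ev3_mapr f g h p q r m (F : {linear C m -> C q ⊗ C r}) (gh : fam) t :
  (forall x, fapp gh x = ev2 g h q r (F x)) ->
  ev3 f g h p q r (tassocV (tmap idfun F t)) = ev2 f gh p m t.
Proof.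
move=> E; rewrite ev3_assoc {2}/ev2 /= tmap_comp; congr (cmul A _).
by apply: tmap_eq => // x; rewrite [RHS]E.
Qed.

Lemma decomp_deg n p q i x : (p + q)%N != n.+1 -> Δ n p q i x = 0.
Proof. by move=> h; rewrite decomp_out // eq_sym (negPf h). Qed.

Lemma conv_coassoc p q r i j f g h : (1 <= p)%N -> (1 <= i <= p)%N ->
  (1 <= j <= (p + q).-1)%N ->
  conv (p + q).-1 r j (conv p q i f g) h =
  if (i + q <= j)%N then conv (p + r).-1 q i (conv p r (j - q + 1) f h) g
  else if (i <= j)%N then conv p (q + r).-1 i f (conv q r (j - i + 1) g h)
  else conv (p + r).-1 q (i + r - 1) (conv p r j f h) g.
Proof.
move=> p_gt0 i_p j_pq; apply: fam_eq => n x.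
(* The cooperad axiom speaks of a single arity; in all others both sides vanish for degree
   reasons. *)
have [En|ne_n] := eqVneq n ((p + q).-1 + r).-1; last first.
  rewrite convE decomp_deg ?linear0; last by apply: contra_neqN ne_n; lia.
  by case: ifP => ?; [|case: ifP => ?];
    rewrite convE decomp_deg ?linear0 //; apply: contra_neqN ne_n; lia.
subst n; rewrite convE -(@ev3_mapl f g h p q r _ (Δ (p + q).-1 p q i)) //.
rewrite decomp_coassoc //; case: ifP => _.
  by rewrite ev3_swap23 (@ev3_mapl _ _ _ _ _ _ _ _ (conv p r (j - q + 1) f h)).
case: ifP => _.
  by rewrite (@ev3_mapr _ _ _ _ _ _ _ _ (conv q r (j - i + 1) g h)).
by rewrite ev3_swap23 (@ev3_mapl _ _ _ _ _ _ _ _ (conv p r j f h)).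
Qed.

(** Inputs are counted from 0, hence [i.+1], and [q.+1] has the parity of q - 1. The sign is the one
    in [prebracket_fun]. *)
Definition sconv p q i f g : fam := (-1) ^+ (q.+1 * (p - i.+1)) *: conv p q i.+1 f g.

Lemma conv_linl p q i a f f' g :
  conv p q i (a *: f + f') g = a *: conv p q i f g + conv p q i f' g.
Proof. by apply: fam_eq => n x; rewrite fapp_lin !convE ev2_lin1. Qed.
Lemma conv_linr p q i a f g g' :
  conv p q i f (a *: g + g') = a *: conv p q i f g + conv p q i f g'.
Proof. by apply: fam_eq => n x; rewrite fapp_lin !convE ev2_lin2. Qed.
Lemma ev2Z1 a f g p q t : ev2 (a *: f) g p q t = a *: ev2 f g p q t.
Proof.
rewrite -[a *: f]addr0 ev2_lin1; have := ev2_lin1 (-1) 0 0 g t.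
by rewrite !scaleN1r oppr0 addr0 addNr => ->; rewrite addr0.
Qed.
Lemma ev2Z2 a f g p q t : ev2 f (a *: g) p q t = a *: ev2 f g p q t.
Proof.
rewrite -[a *: g]addr0 ev2_lin2; have := ev2_lin2 (-1) f 0 0 t.
by rewrite !scaleN1r oppr0 addr0 addNr => ->; rewrite addr0.
Qed.
Lemma convZl p q i a f g : conv p q i (a *: f) g = a *: conv p q i f g.
Proof. by apply: fam_eq => n x; rewrite fappZ !convE ev2Z1. Qed.
Lemma convZr p q i a f g : conv p q i f (a *: g) = a *: conv p q i f g.
Proof. by apply: fam_eq => n x; rewrite fappZ !convE ev2Z2. Qed.

Fact sconv_bilinear p q i : bilinear_for *:%R *:%R (sconv p q i).
Proof.
split=> [h|h] a f g; rewrite /sconv /= ?conv_linl ?conv_linr scalerDr !scalerA;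
  by rewrite mulrC.
Qed.
HB.instance Definition _ p q i :=
  @bilinear_isBilinear.Build k fam fam fam _ _ (sconv p q i) (sconv_bilinear p q i).
Definition sconv_bil p q i : {bilinear fam -> fam -> fam} := sconv p q i.

Lemma fapp_sconv p q i f g n x : fapp (sconv_bil p q i f g) x =
  (-1) ^+ (q.+1 * (p - i.+1)) *: ev2 f g p q (Δ n p q i.+1 x).
Proof. by []. Qed.

(** The exponent counts the inputs right of the insertion point. These numbers add up under nesting,
    so the signs of both sides agree. *)
Lemma sconv_seq p q r i l x y z : (i < p)%N -> (l < q)%N ->
  sconv_bil (p + q).-1 r (i + l) (sconv_bil p q i x y) z =
  sconv_bil p (q + r).-1 i x (sconv_bil q r l y z).
Proof.
move=> lt_ip lt_lq; rewrite /= /sconv convZl convZr !scalerA.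
rewrite conv_coassoc; [|lia..].
rewrite (_ : (_ <= _)%N = false); last by lia.
rewrite (_ : (i < _)%N); last by lia.
rewrite (_ : (i + l).+1 - i.+1 + 1 = l.+1)%N; last by lia.
congr (_ *: _); rewrite -!exprD.
have -> : ((p + q).-1 - (i + l).+1 = (p - i.+1) + (q - l.+1))%N by lia.
have -> : (q + r).-1.+1 = (q + r)%N by lia.
by parity; ring.
Qed.

Lemma sconv_par p q r i j x y z : (i < j)%N -> (j < p)%N ->
  sconv_bil (p + q).-1 r (j + q).-1 (sconv_bil p q i x y) z =
  sgn2 k q r *: sconv_bil (p + r).-1 q i (sconv_bil p r j x z) y.
Proof.
move=> lt_ij lt_jp; rewrite /= /sconv !convZl !scalerA.
rewrite conv_coassoc; [|lia..].
rewrite (_ : (_ <= _)%N); last by lia.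
rewrite (_ : (j + q).-1.+1 - q + 1 = j.+1)%N; last by lia.
congr (_ *: _); rewrite /sgn2 -!exprD.
have -> : ((p + q).-1 - (j + q).-1.+1 = p - j.+1)%N by lia.
have -> : ((p + r).-1 - i.+1 = (p - i.+2) + r)%N by lia.
have -> : (p - i.+1 = (p - i.+2).+1)%N by lia.
by parity; ring.
Qed.

Definition mu_unit (x : C 2) : A := comu C x *: cone A.
Fact mu_unit_linear : linear mu_unit.
Proof. by move=> a x y; rewrite /mu_unit linearP scalerDl scalerA. Qed.
HB.instance Definition _ := GRing.isLinear.Build k (C 2) A _ mu_unit mu_unit_linear.

Definition mu_fam : fam := mkfam (fun n =>
  match n return {linear C n -> A} with 2 => mu_unit | _ => \0 end).

Lemma ev2_mul f n t : ev2 mu_fam f 2 n t = fapp f (contractl (comu C) t).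
Proof.
move: t; apply: (tensor_ext (h := flin f n \o contractl (comu C))) => x y.
change (ev2 mu_fam f 2 n (tpure x y) = flin f n (contractl (comu C) (tpure x y))).
rewrite ev2E contractlE linearZ /=.
change (cmul A (tpure (comu C x *: cone A) (fapp f y)) = comu C x *: fapp f y).
by rewrite tpureZl linearZ /= cmul1.
Qed.

Lemma ev2_mur f n t : ev2 f mu_fam n 2 t = fapp f (contractr (comu C) t).
Proof. by rewrite -[t in LHS](tswapK t) ev2_swap ev2_mul. Qed.

Lemma pre_mu_fam : pre sconv_bil 2 2 mu_fam mu_fam = 0.
Proof.
rewrite /pre big_nat_recr //= big_nat1 /sconv; apply: fam_eq => n x.
rewrite fappD !fappZ !convE !ev2_mul fapp0.
have [En|ne_n] := eqVneq n 3; last first.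
  by rewrite !decomp_deg ?linear0 ?scaler0 ?addr0 // eq_sym.
subst n.
have E i : fapp mu_fam (contractl (comu C) (Δ 3 2 2 i x)) =
  tscalar (comu C) (comu C) (Δ 3 2 2 i x) *: cone A by [].
rewrite !E comu_coassoc -!scalerDl -(signr_odd _ (3 * (2 - 1))).
by rewrite -(signr_odd _ (3 * (2 - 2))) /= expr1 addNr scale0r.
Qed.

Local Notation pre := (pre sconv_bil).
Local Notation hoch := (hoch sconv_bil mu_fam).
Local Notation cup := (cup sconv_bil mu_fam).
Local Notation bracket := (bracket sconv_bil).

Lemma fapp_hoch f n (x : C n.+1) : fapp f (coop_diff C n.+1 x) = fapp (hoch n f) x.
Proof.
rewrite /hoch fapp_lin /pre !fapp_sum big_nat_recr // big_nat1 !fapp_sconv.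
rewrite !ev2_mul subn1 subnn muln0 expr0 scale1r muln1.
rewrite -[coop_diff C n.+1 x]/(coop_diff_fun x) /coop_diff_fun big_add1 linearD.
rewrite linear_sum (linearD (contractl _)) (linearZ_LR (contractl _)) linearD.
rewrite linearZ_LR addrC; congr (_ + _); last exact: addrC.
rewrite scaler_sumr; apply: eq_big_nat => i /andP[_ lt_in].
rewrite linearZ_LR fapp_sconv ev2_mur scalerA; congr (_ *: _).
rewrite -exprD -{1}[n](subnK lt_in); parity; ring.
Qed.

Lemma ev2_prebracket f g n p q (x : C n) :
  ev2 f g p q (prebracket_fun p q x) = fapp (pre p q f g) x.
Proof.
rewrite /prebracket_fun big_add1 linear_sum /pre fapp_sum.
by apply: eq_bigr => i _; rewrite linearZ_LR fapp_sconv.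
Qed.

Lemma ev2_flip f g e p q t : ev2 f g p q (flip e t) = (-1) ^+ e *: ev2 g f q p t.
Proof.
have -> : flip e t = (-1) ^+ e *: tswap t by [].
by rewrite linearZ_LR ev2_swap.
Qed.

Lemma ev2_bracket f g n p q (x : C n) :
  ev2 f g p q (cobracket C n p q x) = fapp (bracket p q f g) x.
Proof.
rewrite -[cobracket C n p q x]/(cobracket_fun p q x) /cobracket_fun linearB /rho2.
rewrite ev2_flip !ev2_prebracket.
by rewrite /bracket fappD fappN fappZ /sgn2 mulnC.
Qed.

Lemma ev2_mapl f g p q m (F : {linear C m -> C p}) (f' : fam) t :
  (forall x, fapp f' x = fapp f (F x)) ->
  ev2 f g p q (tmap F idfun t) = ev2 f' g m q t.
Proof.
move=> E; rewrite /ev2 /= tmap_comp; congr (cmul A _).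
by apply: tmap_eq => // x; rewrite [RHS]E.
Qed.
Lemma ev2_mapr f g p q m (F : {linear C m -> C q}) (g' : fam) t :
  (forall x, fapp g' x = fapp g (F x)) ->
  ev2 f g p q (tmap idfun F t) = ev2 f g' p m t.
Proof.
move=> E; rewrite /ev2 /= tmap_comp; congr (cmul A _).
by apply: tmap_eq => // x; rewrite [RHS]E.
Qed.

Lemma ev2_cup f g n p q (x : C n) :
  ev2 f g p q (cup_coproduct C n p q x) = fapp (cup p q f g) x.
Proof.
rewrite (cupE sconv_par) fappZ fapp_sconv.
rewrite (@ev2_mapl _ _ _ _ _ _ (conv 2 p 1 mu_fam f)); last first.
  by move=> y; rewrite convE ev2_mul.
have -> : sconv_bil 2 p 0 mu_fam f = (-1) ^+ (p.+1 * (2 - 1)) *: conv 2 p 1 mu_fam f by [].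
rewrite [in RHS]ev2Z1 !scalerA -[LHS]scale1r; congr (_ *: _).
by rewrite subnn muln0 expr0 mulr1 muln1 -expr2 sqrr_sign.
Qed.

End Convolution.

(** * Separation of tensors by families of linear maps *)

Section Separation.
Variable k : comNzRingType.

Definition sqz_inj (M : lmodType k) (x : M) : square_zero M := (0, x).
Fact sqz_inj_linear M : linear (@sqz_inj M).
Proof.
by move=> a x y; rewrite /sqz_inj; congr pair; rewrite /= scaler0 addr0.
Qed.
HB.instance Definition _ M :=
  GRing.isLinear.Build k M (square_zero M) _ (@sqz_inj M) (@sqz_inj_linear M).

Definition tens_inl (A B : calg k) (a : A) : tensor_calg A B := tpure a (cone B).
Fact tens_inl_linear (A B : calg k) : linear (@tens_inl A B).
Proof. by move=> c x y; exact: tpurePl. Qed.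
HB.instance Definition _ (A B : calg k) :=
  GRing.isLinear.Build k A (tensor_calg A B) _ (@tens_inl A B) (@tens_inl_linear A B).
Definition tens_inr (A B : calg k) (b : B) : tensor_calg A B := tpure (cone A) b.
Fact tens_inr_linear (A B : calg k) : linear (@tens_inr A B).
Proof. by move=> c x y; exact: tpurePr. Qed.
HB.instance Definition _ (A B : calg k) :=
  GRing.isLinear.Build k B (tensor_calg A B) _ (@tens_inr A B) (@tens_inr_linear A B).

Lemma tens_inlr (A B : calg k) (a : A) (b : B) :
  cmul (tensor_calg A B) (tpure (tens_inl B a) (tens_inr A b)) = tpure a b.
Proof.
rewrite [LHS](@tens_mulE k A B) (cmulC a) !cmul1 //.
Qed.

Variable V : nat -> lmodType k.

(** Extension by zero to the other arities, with a transport along [p = n] that [fam_atE]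
    removes. *)
Definition cast_lin (A : lmodType k) p (f : {linear V p -> A}) n : {linear V n -> A} :=
  match @eqP _ p n with
  | ReflectT e => ecast m {linear V m -> A} e f
  | ReflectF _ => \0
  end.
Definition fam_at (A : lmodType k) p (f : {linear V p -> A}) : fam V A :=
  mkfam (cast_lin f).
Lemma fam_atE (A : lmodType k) p (f : {linear V p -> A}) x : fapp (fam_at f) x = f x.
Proof.
rewrite mkfamE /cast_lin; case: eqP => // e.
by rewrite (eq_irrelevance e (erefl p)).
Qed.
End Separation.

Section SeparationCoop.
Variables (k : comNzRingType) (C : comult_cooperad k).

Lemma fam_sep p (z z' : C p) :
  (forall (A : calg k) (f : fam C A), fapp f z = fapp f z') -> z = z'.
Proof.
move=> /(_ (square_zero (C p)) (fam_at (@sqz_inj k (C p)))).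
by rewrite !fam_atE => -[].
Qed.

(** The two families send x and y to the nilpotent parts of different tensor factors, where their
    product is a pure tensor. The projections [snd] recover x and y, so the evaluation is split
    injective over any ring. *)
Lemma ev2_sep p q (z z' : C p ⊗ C q) :
  (forall (A : calg k) (f g : fam C A), ev2 f g p q z = ev2 f g p q z') -> z = z'.
Proof.
pose A := square_zero (C p); pose B := square_zero (C q).
pose f := fam_at (@tens_inl k A B \o @sqz_inj k (C p)).
pose g := fam_at (@tens_inr k A B \o @sqz_inj k (C q)).
move=> /(_ (tensor_calg A B) f g) E.
pose P : {linear A ⊗ B -> C p ⊗ C q} := tmap snd snd.
have Ef x : fapp f x = tens_inl B (sqz_inj x) by exact: fam_atE.
have Eg x : fapp g x = tens_inr A (sqz_inj x) by exact: fam_atE.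
have PK t : P (ev2 f g p q t) = t.
  elim/tensor_ind: t => [x y|s t Es Et]; last first.
    by rewrite (linearD (ev2 f g p q)) (linearD P) Es Et.
  have Eev : ev2 f g p q (tpure x y) = tpure (sqz_inj x) (sqz_inj y).
    apply: (etrans (ev2E f g x y)); rewrite Ef Eg; exact: tens_inlr.
  by apply: (etrans (congr1 P Eev)); exact: tmapE.
by rewrite -[z]PK E PK.
Qed.

Lemma ev3_sep p q r (z z' : C p ⊗ C q ⊗ C r) :
  (forall (A : calg k) (f g h : fam C A), ev3 f g h p q r z = ev3 f g h p q r z') ->
  z = z'.
Proof.
pose A := square_zero (C p); pose B := square_zero (C q).
pose D := square_zero (C r); pose AB := tensor_calg A B.
pose f := fam_at (@tens_inl k AB D \o (@tens_inl k A B \o @sqz_inj k (C p))).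
pose g := fam_at (@tens_inl k AB D \o (@tens_inr k A B \o @sqz_inj k (C q))).
pose h := fam_at (@tens_inr k AB D \o @sqz_inj k (C r)).
move=> /(_ (tensor_calg AB D) f g h) E.
pose P : {linear A ⊗ B ⊗ D -> C p ⊗ C q ⊗ C r} := tmap (tmap snd snd) snd.
have Ef x : fapp f x = tens_inl D (tens_inl B (sqz_inj x)) by exact: fam_atE.
have Eg x : fapp g x = tens_inl D (tens_inr A (sqz_inj x)) by exact: fam_atE.
have Eh x : fapp h x = tens_inr AB (sqz_inj x) by exact: fam_atE.
have Efg x y : cmul (tensor_calg AB D)
    (tpure (tens_inl D (tens_inl B (sqz_inj x))) (tens_inl D (tens_inr A (sqz_inj y))))
    = tens_inl D (tpure (sqz_inj x) (sqz_inj y) : AB).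
  rewrite [LHS](@tens_mulE k AB D) cmul1.
  by rewrite [X in tpure X _](tens_inlr (sqz_inj x) (sqz_inj y)).
have PK t : P (ev3 f g h p q r t) = t.
  elim/tensor_ind: t => [s u|s t Es Et]; last first.
    by rewrite (linearD (ev3 f g h p q r)) (linearD P) Es Et.
  elim/tensor_ind: s => [x y|s t Es Et]; last first.
    by rewrite tpureDl (linearD (ev3 f g h p q r)) (linearD P) Es Et.
  have Eev : ev3 f g h p q r (tpure (tpure x y) u) =
      tpure (tpure (sqz_inj x) (sqz_inj y) : AB) (sqz_inj u).
    apply: (etrans (ev3E f g h x y u)); rewrite Ef Eg Eh Efg; exact: tens_inlr.
  apply: (etrans (congr1 P Eev)); apply: (etrans (tmapE _ _ _ _)).
  by congr tpure; exact: tmapE.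
by rewrite -[z]PK E PK.
Qed.
End SeparationCoop.

(** * Evaluation of cooperad operations *)

Section TensorScale.
Variable k : comNzRingType.
Implicit Types A B C D : lmodType k.

Lemma tmapZl A B C D c (f f' : {linear A -> C}) (g : {linear B -> D}) t :
  (forall x, f x = c *: f' x) -> tmap f g t = c *: tmap f' g t.
Proof.
move=> E; elim/tensor_ind: t => [a b|x y]; first by rewrite !tmapE E tpureZl.
by rewrite (linearD (tmap f g)) (linearD (tmap f' g)) scalerDr => -> ->.
Qed.
Lemma tmapZr A B C D c (f : {linear A -> C}) (g g' : {linear B -> D}) t :
  (forall x, g x = c *: g' x) -> tmap f g t = c *: tmap f g' t.
Proof.
move=> E; elim/tensor_ind: t => [a b|x y].
  by rewrite !tmapE E (linearZ_LR (@tpure k C D (f a))).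
by rewrite (linearD (tmap f g)) (linearD (tmap f g')) scalerDr => -> ->.
Qed.
End TensorScale.

Section Evaluation.
Variables (k : comNzRingType) (C : comult_cooperad k) (A : calg k).
Local Notation fam := (fam C A).
Implicit Types f g h : fam.
Local Notation c := (@sconv_bil k C A).
Local Notation mu := (@mu_fam k C A).
Local Notation pre := (pre c).
Local Notation hoch := (hoch c mu).
Local Notation cup := (cup c mu).
Local Notation bracket := (bracket c).

(** The arities passed to the operations are mere labels; this predicate ties the label m to the
    family, as is needed to evaluate at elements of every degree. *)
Definition supported m f := forall n (x : C n), n != m -> fapp f x = 0.

Lemma supported_lin m a f g : supported m f -> supported m g -> supported m (a *: f + g).
Proof.
by move=> sf sg n x ne; rewrite fapp_lin sf ?sg // scaler0 addr0.
Qed.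

Lemma supported_c p q i f g : supported (p + q).-1 (c p q i f g).
Proof.
move=> n x ne; rewrite fapp_sconv decomp_deg ?linear0 ?scaler0 //.
by apply: contra_neqN ne => /eqP->.
Qed.

Lemma supported_pre p q f g : supported (p + q).-1 (pre p q f g).
Proof.
by move=> n x ne; rewrite /pre fapp_sum big1 // => i _; rewrite supported_c.
Qed.

Lemma supported_hoch n f : supported n.+1 (hoch n f).
Proof.
have := @supported_pre n 2 f mu; rewrite addn2 => s1.
exact: supported_lin s1 (@supported_pre 2 n mu f).
Qed.

Lemma supported_bracket p q f g : supported (p + q).-1 (bracket p q f g).
Proof.
rewrite /bracket addrC -scaleNr; apply: supported_lin; last exact: supported_pre.
by rewrite addnC; exact: supported_pre.
Qed.

Lemma supported_cup p q f g : supported (p + q) (cup p q f g).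
Proof.
move=> n x ne; rewrite (cupE (@sconv_par k C A)) fappZ.
by rewrite (supported_c (p := p.+1)) ?scaler0.
Qed.

Lemma coop_diff0 (x : C 0) : coop_diff C 0 x = 0.
Proof.
rewrite -[LHS]/(coop_diff_fun x) /coop_diff_fun !decomp_deg // big_geq //.
by rewrite scaler0 !addr0 linear0.
Qed.

Lemma fapp_diff m f n (x : C n) : supported m f ->
  fapp f (coop_diff C n x) = fapp (hoch m f) x.
Proof.
move=> sf; have [En|ne_n] := eqVneq n m.+1; first by subst n; exact: fapp_hoch.
rewrite supported_hoch //; case: n x ne_n => [|n] x ne_n.
  by rewrite coop_diff0 linear0.
by rewrite sf.
Qed.

(** Differentials of homotopies vanish on cycles; thus operad identities up to homotopy become
    identities up to the boundary of a cooperad tensor. *)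
Lemma hoch_cycle m f n (x : C n) : coop_diff C n x = 0 -> fapp (hoch m f) x = 0.
Proof.
move=> dx; have [En|ne_n] := eqVneq n m.+1; last exact: supported_hoch.
by subst n; rewrite -fapp_hoch dx linear0.
Qed.

Lemma ev2_diff2 f g s (w : tensor2 C) p q :
  ev2 f g p q (diff2 (coop_diff C) s w p q) =
  ev2 (hoch p f) g p.+1 q (w p.+1 q)
  + (-1) ^+ (p + s) *: ev2 f (hoch q g) p q.+1 (w p q.+1).
Proof.
rewrite /diff2 (linearD (ev2 f g p q)) linearZ_LR.
congr (_ + _ *: _); [apply: ev2_mapl|apply: ev2_mapr] => x;
  by rewrite -fapp_hoch.
Qed.

Lemma ev3_map1 f g h p q r m (F : {linear C m -> C p}) (f' : fam) t :
  (forall x, fapp f' x = fapp f (F x)) ->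
  ev3 f g h p q r (tmap (tmap F idfun) idfun t) = ev3 f' g h m q r t.
Proof.
move=> E; rewrite /ev3 /= tmap_comp; congr (cmul A _).
apply: tmap_eq => // x; exact: ev2_mapl.
Qed.
Lemma ev3_map2 f g h p q r m (F : {linear C m -> C q}) (g' : fam) t :
  (forall x, fapp g' x = fapp g (F x)) ->
  ev3 f g h p q r (tmap (tmap idfun F) idfun t) = ev3 f g' h p m r t.
Proof.
move=> E; rewrite /ev3 /= tmap_comp; congr (cmul A _).
apply: tmap_eq => // x; exact: ev2_mapr.
Qed.
Lemma ev3_map3 f g h p q r m (F : {linear C m -> C r}) (h' : fam) t :
  (forall x, fapp h' x = fapp h (F x)) ->
  ev3 f g h p q r (tmap idfun F t) = ev3 f g h' p q m t.
Proof.
move=> E; rewrite /ev3 /= tmap_comp; congr (cmul A _).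
by apply: tmap_eq => // x; rewrite [RHS]E.
Qed.

Lemma ev3_diff3 f g h s t (w : tensor3 C) p q r :
  ev3 f g h p q r (diff3 (coop_diff C) s t w p q r) =
  ev3 (hoch p f) g h p.+1 q r (w p.+1 q r)
  + (-1) ^+ (p + s) *: ev3 f (hoch q g) h p q.+1 r (w p q.+1 r)
  + (-1) ^+ (p + q + t) *: ev3 f g (hoch r h) p q r.+1 (w p q r.+1).
Proof.
rewrite /diff3 2!(linearD (ev3 f g h p q r)) !linearZ_LR.
by congr (_ + _ *: _ + _ *: _); [apply: ev3_map1|apply: ev3_map2|apply: ev3_map3] => x;
  rewrite -fapp_hoch.
Qed.

Lemma ev3_rho12 f g h (z : tensor3 C) p q r :
  ev3 f g h p q r (rho12 z p q r) =
  (-1) ^+ (q.+1 * p.+1) *: ev3 g f h q p r (z q p r).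
Proof.
rewrite /rho12 (@tmapZl _ _ _ _ _ ((-1) ^+ (q.+1 * p.+1)) _ tswap) //.
by rewrite linearZ_LR ev3_swap12.
Qed.

Lemma ev3_varrho12 f g h (z : tensor3 C) p q r :
  ev3 f g h p q r (varrho12 z p q r) =
  (-1) ^+ (q * p.+1) *: ev3 g f h q p r (z q p r).
Proof.
rewrite /varrho12 (@tmapZl _ _ _ _ _ ((-1) ^+ (q * p.+1)) _ tswap) //.
by rewrite linearZ_LR ev3_swap12.
Qed.

Lemma ev3_rho23 f g h (z : tensor3 C) p q r :
  ev3 f g h p q r (rho23 z p q r) =
  (-1) ^+ (r.+1 * q.+1) *: ev3 f h g p r q (z p r q).
Proof.
rewrite /rho23 (@tmapZr _ _ _ _ _ ((-1) ^+ (r.+1 * q.+1)) _ _ tswap) //.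
rewrite (linearZ_LR (@tassocV k (C p) (C q) (C r))).
by rewrite (linearZ_LR (ev3 f g h p q r)) ev3_swap23.
Qed.

Lemma ev3_compl f g h s (F G : coop C) (opF opG : nat -> nat -> fam -> fam -> fam)
    n (x : C n) p q r :
  (forall f g n p q (x : C n), ev2 f g p q (F n p q x) = fapp (opF p q f g) x) ->
  (forall f g n p q (x : C n), ev2 f g p q (G n p q x) = fapp (opG p q f g) x) ->
  ev3 f g h p q r (compl s F G x p q r) =
  fapp (opG (p + q - s)%N r (opF p q f g) h) x.
Proof. by move=> evF evG; rewrite /compl (ev3_mapl _ (fg := opF p q f g)). Qed.

Lemma ev3_compr f g h s (F G : coop C) (opF opG : nat -> nat -> fam -> fam -> fam)
    n (x : C n) p q r :
  (forall f g n p q (x : C n), ev2 f g p q (F n p q x) = fapp (opF p q f g) x) ->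
  (forall f g n p q (x : C n), ev2 f g p q (G n p q x) = fapp (opG p q f g) x) ->
  ev3 f g h p q r (compr s F G x p q r) =
  fapp (opG p (q + r - s)%N f (opF q r g h)) x.
Proof. by move=> evF evG; rewrite /compr (ev3_mapr _ (gh := opF q r g h)). Qed.

End Evaluation.

(** * Identities up to boundaries *)

Section GerstenhaberModBoundaries.
Variables (k : comNzRingType) (C : comult_cooperad k).
Local Notation Δ := (decomp C).
Local Notation d := (@coop_diff k C).

(** The dual of [brace2], used to write down the tensor that bounds the coLeibniz defect. The swap
    restores the order of factors, since the last argument is inserted first. *)
Definition brace2_coop n p q r (x : C n) : C p ⊗ C q ⊗ C r :=
  \sum_(0 <= j < p) \sum_(0 <= i < j)
    (-1) ^+ (q.+1 * ((p + r).-1 - i.+1) + r.+1 * (p - j.+1)) *: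
    tassocV (tmap idfun tswap (tassoc
      (tmap (Δ (p + r).-1 p r j.+1) idfun (Δ n (p + r).-1 q i.+1 x)))).

Lemma ev3_brace2 (A : calg k) (f g h : fam C A) n p q r (x : C n) :
  ev3 f g h p q r (brace2_coop p q r x) =
  fapp (brace2 (@sconv_bil k C A) p q r f g h) x.
Proof.
rewrite /brace2_coop /brace2 (linear_sum (ev3 f g h p q r)) fapp_sum.
apply: eq_bigr => j _; rewrite (linear_sum (ev3 f g h p q r)) fapp_sum.
apply: eq_bigr => i _; rewrite (linearZ_LR (ev3 f g h p q r)) ev3_swap23.
rewrite (ev3_mapl _ (fg := conv p r j.+1 f h)) // fapp_sconv.
by rewrite [in RHS]ev2Z1 scalerA -exprD.
Qed.

Lemma cup_coproduct_deg n p q : (p + q)%N != n ->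
  forall x : C n, cup_coproduct C n p q x = 0.
Proof.
move=> ne x; apply: ev2_sep => A f g.
by rewrite linear0 ev2_cup supported_cup // eq_sym.
Qed.
Lemma cobracket_deg n p q : (p + q)%N != n.+1 ->
  forall x : C n, cobracket C n p q x = 0.
Proof.
move=> ne x; apply: ev2_sep => A f g; rewrite linear0 ev2_bracket.
case: (posnP (p + q)) => [/eqP|pq_gt0].
  rewrite addn_eq0 => /andP[/eqP-> /eqP->].
  by rewrite /bracket !pre0 scaler0 subr0.
by apply: supported_bracket; apply: contra_neq ne => ->; rewrite prednK.
Qed.

Lemma diff2_0 s p q : diff2 d s (fun _ _ => 0) p q = 0.
Proof. by rewrite /diff2 !linear0 ?scaler0 addr0. Qed.
Lemma diff3_0 s t p q r : diff3 d s t (fun _ _ _ => 0) p q r = 0.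
Proof. by rewrite /diff3 !linear0 ?scaler0 !addr0. Qed.

Theorem coop_gerstenhaber_mod_boundaries :
  gerstenhaber_mod_boundaries d (@cup_coproduct k C) (@cobracket k C).
Proof.
have par A := @sconv_par k C A; have seq A := @sconv_seq k C A.
have mu0 A := @pre_mu_fam k C A.
have cupE A := @ev2_cup k C A; have brE A := @ev2_bracket k C A.
split.
- case=> [|[|n]] x; try exact: coop_diff0.
  apply: fam_sep => A f; rewrite linear0 -[n.+2.-1]/(n.+1) fapp_hoch.
  by rewrite [LHS]fapp_hoch (hoch_hoch (seq A) (par A)).
- move=> n x p q; apply: ev2_sep => A f g; rewrite ev2_diff2 !cupE addn0.
  by rewrite (fapp_diff _ (@supported_cup k C A p q f g)) (hoch_cup (seq A) (par A)).
- move=> n x p q; apply: ev2_sep => A f g; rewrite ev2_diff2 !brE addn1.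
  by rewrite (fapp_diff _ (@supported_bracket k C A p q f g)) (hoch_bracket (seq A) (par A)).
- move=> n x dx; exists (fun _ _ _ => 0) => p q r; apply: ev3_sep => A f g h.
  rewrite /coassoc_defect diff3_0 linear0 linearB.
  rewrite (ev3_compl _ _ _ _ _ _ _ _ (cupE A) (cupE A)).
  rewrite (ev3_compr _ _ _ _ _ _ _ _ (cupE A) (cupE A)) !subn0.
  by rewrite (cup_assoc (seq A) (par A)) // subrr.
- move=> n x dx.
  (* The differential reads this tensor at [p.+1], where its sign is the factor [(-1) ^+ p] of
     [cup_comm]. *)
  exists (fun p q => (-1) ^+ p.+1 *: prebracket_fun p q x) => p q.
  apply: ev2_sep => A f g; rewrite ev2_diff2 addn0.
  rewrite /cocomm_defect /tau2 linearB ev2_flip !cupE.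
  rewrite !(linearZ_LR (ev2 _ _ _ _)) !ev2_prebracket.
  (* Evaluation of [cup_comm] at x, with h the differential of the homotopy, which vanishes on the
     cycle x. *)
  have E (u v w y h : fam C A) a b e : a *: u - v = b *: (w + e *: y - h) ->
      fapp h x = 0 -> a *: fapp u x - fapp v x = b *: (fapp w x + e *: fapp y x).
    move=> /(congr1 (fun t : fam C A => fapp t x)); cbv beta => + hx.
    by rewrite !(fappD, fappN, fappZ) hx subr0.
  rewrite (E _ _ _ _ _ _ _ _ (cup_comm (seq A) (par A) (mu_fam C A) p q f g)).
    2: exact: hoch_cycle.
  by parity; module k A.
- move=> n x dx; exists (fun p q => prebracket_fun p q x).
  by exists (fun _ _ => 0) => p q; rewrite diff2_0; exact: subrr.
- move=> n x dx; exists (fun _ _ _ => 0) => p q r; apply: ev3_sep => A f g h.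
  rewrite /cojacobi_defect diff3_0 linear0 2!(linearD (ev3 f g h p q r)).
  rewrite ev3_rho23 !ev3_rho12 ev3_rho23.
  rewrite !(ev3_compl _ _ _ _ _ _ _ _ (brE A) (brE A)) !subn1 -!fappZ -!fappD.
  by rewrite (bracket_jacobi (seq A) (par A)).
- move=> n x dx.
  (* At first index [p.+1] this sign has the parity of the factor [(-1) ^+ (p + q.+1 * r)] in
     [bracket_cup]. *)
  exists (fun p q r => (-1) ^+ (p.+1 + q.+1 * r) *: brace2_coop p q r x) => p q r.
  apply: ev3_sep => A f g h; rewrite ev3_diff3 /coleibniz_defect.
  rewrite (linearB (ev3 f g h p q r)) (linearD (ev3 f g h p q r)) ev3_varrho12.
  rewrite (ev3_compr _ _ _ _ _ _ _ _ (cupE A) (brE A)) subn0.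
  rewrite (ev3_compl _ _ _ _ _ _ _ _ (brE A) (cupE A)).
  rewrite (ev3_compr _ _ _ _ _ _ _ _ (brE A) (cupE A)) !subn1.
  rewrite !(linearZ_LR (ev3 _ _ _ _ _ _)) !ev3_brace2.
  have E (u v w y y' y'' b : fam C A) a a' e e' :
      u - (v + a *: w) = a' *: (y + e *: y' + e' *: y'' - b) -> fapp b x = 0 ->
      fapp u x - (fapp v x + a *: fapp w x) =
      a' *: (fapp y x + e *: fapp y' x + e' *: fapp y'' x).
    move=> /(congr1 (fun t : fam C A => fapp t x)); cbv beta => + bx.
    by rewrite !(fappD, fappN, fappZ) bx subr0.
  rewrite (E _ _ _ _ _ _ _ _ _ _ _
    (bracket_cup (seq A) (par A) (mu_fam C A) p q r f g h)).
    2: exact: hoch_cycle.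
  by parity; module k A.
Qed.
End GerstenhaberModBoundaries.

(** * The Künneth relation *)

Section TensorNaturality.
Variable k : comNzRingType.
Implicit Types A B C D E F : lmodType k.

Lemma tswap_nat A B C D (f : {linear A -> C}) (g : {linear B -> D}) t :
  tswap (tmap f g t) = tmap g f (tswap t).
Proof.
elim/tensor_ind: t => [a b|x y]; first by rewrite tswapE !tmapE tswapE.
by rewrite (linearD (tmap f g)) !(linearD (@tswap k _ _)) (linearD (tmap g f)) => -> ->.
Qed.

Lemma tassocV_nat A B C D E F (f : {linear A -> D}) (g : {linear B -> E})
    (h : {linear C -> F}) t :
  tassocV (tmap f (tmap g h) t) = tmap (tmap f g) h (tassocV t).
Proof.
move: t; apply: (tensor3r_ext (g := tassocV \o tmap f (tmap g h))
  (h := tmap (tmap f g) h \o tassocV)) => a b c.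
change (tassocV (tmap f (tmap g h) (tpure a (tpure b c))) =
  tmap (tmap f g) h (tassocV (tpure a (tpure b c)))).
by rewrite !(tmapE, tassocVE).
Qed.

Lemma tassocV_pure A B C D E F (f : {linear A -> D}) (g : {linear B -> E})
    (h : {linear C -> F}) a t :
  tmap (tmap f g) h (tassocV (tpure a t)) = tassocV (tpure (f a) (tmap g h t)).
Proof. by rewrite -tassocV_nat tmapE. Qed.

Lemma tassocVD A B C (t t' : A ⊗ (B ⊗ C)) :
  tassocV (t + t') = tassocV t + tassocV t'.
Proof. exact: linearD. Qed.
Lemma tassocVB A B C (t t' : A ⊗ (B ⊗ C)) :
  tassocV (t - t') = tassocV t - tassocV t'.
Proof. exact: linearB. Qed.
Lemma tassocVZ A B C a (t : A ⊗ (B ⊗ C)) : tassocV (a *: t) = a *: tassocV t.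
Proof. exact: linearZ_LR. Qed.

Lemma swap12_nat A B C D E F (f : {linear A -> D}) (g : {linear B -> E})
    (h : {linear C -> F}) t :
  tmap tswap idfun (tmap (tmap f g) h t) =
  tmap (tmap g f) h (tmap tswap idfun t).
Proof.
rewrite !tmap_comp; apply: tmap_eq => // x; exact: tswap_nat.
Qed.

Lemma swap12_idfun A B C F (h : {linear C -> F}) t :
  tmap tswap idfun (tmap idfun h t) = tmap idfun h (tmap (@tswap k A B) idfun t).
Proof. by rewrite !tmap_comp; apply: tmap_eq. Qed.

Definition swap23 A B C : {linear A ⊗ B ⊗ C -> A ⊗ C ⊗ B} :=
  tassocV \o tmap idfun tswap \o tassoc.

Lemma swap23E A B C (a : A) (b : B) (c : C) :
  swap23 A B C (tpure (tpure a b) c) = tpure (tpure a c) b.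
Proof.
change (tassocV (tmap idfun tswap (tassoc (tpure (tpure a b) c))) = tpure (tpure a c) b).
by rewrite tassocE tmapE tswapE tassocVE.
Qed.

Lemma swap23_nat A B C D E F (f : {linear A -> D}) (g : {linear B -> E})
    (h : {linear C -> F}) t :
  swap23 _ _ _ (tmap (tmap f g) h t) = tmap (tmap f h) g (swap23 _ _ _ t).
Proof.
move: t; apply: (tensor3_ext (g := swap23 _ _ _ \o tmap (tmap f g) h)
  (h := tmap (tmap f h) g \o swap23 _ _ _)) => a b c.
change (swap23 _ _ _ (tmap (tmap f g) h (tpure (tpure a b) c)) =
  tmap (tmap f h) g (swap23 _ _ _ (tpure (tpure a b) c))).
by rewrite !(tmapE, swap23E).
Qed.

Lemma tmapZ A B C D (f : {linear A -> C}) (g : {linear B -> D}) a t :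
  tmap f g (a *: t) = a *: tmap f g t.
Proof. exact: linearZ_LR. Qed.
Lemma tmapD A B C D (f : {linear A -> C}) (g : {linear B -> D}) t t' :
  tmap f g (t + t') = tmap f g t + tmap f g t'.
Proof. exact: linearD. Qed.
Lemma tmapB A B C D (f : {linear A -> C}) (g : {linear B -> D}) t t' :
  tmap f g (t - t') = tmap f g t - tmap f g t'.
Proof. exact: linearB. Qed.
Lemma tmap0 A B C D (f : {linear A -> C}) (g : {linear B -> D}) : tmap f g 0 = 0.
Proof. exact: linear0. Qed.

Lemma tmap0r A B C D (f : {linear A -> C}) (g : {linear B -> D}) t :
  (forall x, g x = 0) -> tmap f g t = 0.
Proof.
move=> g0; rewrite (@tmapZr _ _ _ _ _ 0 f g g) ?scale0r // => x.
by rewrite scale0r g0.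
Qed.
Lemma tmap0l A B C D (f : {linear A -> C}) (g : {linear B -> D}) t :
  (forall x, f x = 0) -> tmap f g t = 0.
Proof.
move=> f0; rewrite (@tmapZl _ _ _ _ _ 0 f f) ?scale0r // => x.
by rewrite scale0r f0.
Qed.
End TensorNaturality.

Section KunnethRelation.
Variables (k : comNzRingType) (V : nat -> lmodType k).
Variable d : forall n, {linear V n -> V n.-1}.
Local Notation H := (homology d).
Local Notation Z := (cycles d).
Local Notation incl p := (@ker_val _ _ _ (d p) : {linear Z p -> V p}).
Local Notation cls p := (hclass d p : {linear Z p -> H p}).

Lemma hclassP n (h : H n) : exists z, cls n z = h.
Proof. by exists (repr h); exact: quotmod_piK. Qed.

Lemma diff2_lin s a w w' p q :
  diff2 d s (fun p q => a *: w p q + w' p q) p q =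
  a *: diff2 d s w p q + diff2 d s w' p q.
Proof.
rewrite /diff2 !tmapD !tmapZ.
module k (V p ⊗ V q)%type.
Qed.

Lemma rel2_lin s a t t' z z' :
  kunneth_rel2 (d := d) s t z -> kunneth_rel2 (d := d) s t' z' ->
  kunneth_rel2 (d := d) s (fun p q => a *: t p q + t' p q)
    (fun p q => a *: z p q + z' p q).
Proof.
move=> [u [tu [w zw]]] [u' [tu' [w' zw']]].
exists (fun p q => a *: u p q + u' p q); split=> [p q|].
  by rewrite tu tu' tmapD tmapZ.
exists (fun p q => a *: w p q + w' p q) => p q.
by rewrite diff2_lin -zw -zw' tmapD tmapZ; module k (V p ⊗ V q)%type.
Qed.

Lemma rel2_ext s t t' z z' :
  (forall p q, t p q = t' p q) -> (forall p q, z p q = z' p q) ->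
  kunneth_rel2 (d := d) s t z -> kunneth_rel2 (d := d) s t' z'.
Proof.
move=> tt' zz' [u [tu [w zw]]]; exists u; split=> [p q|]; first by rewrite -tt'.
by exists w => p q; rewrite -zz'.
Qed.

Lemma rel2_boundary s w : kunneth_rel2 (d := d) s (fun _ _ => 0) (diff2 d s w).
Proof.
exists (fun _ _ => 0); split=> [p q|]; first by rewrite tmap0.
by exists w => p q; rewrite tmap0 subr0.
Qed.

(** Multiplication by [(-1) ^+ (e * q)] is an isomorphism between the complexes with shifts s and s
    + e; it carries the Künneth property from shift 0 to all shifts. *)
Lemma diff2_shift s e w p q :
  diff2 d (s + e) (fun p q => (-1) ^+ (e * q) *: w p q) p q =
  (-1) ^+ (e * q) *: diff2 d s w p q.
Proof.
rewrite /diff2 !tmapZ scalerDr !scalerA; congr (_ + _ *: _).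
by parity; ring.
Qed.

Lemma rel2_shift s e t z : kunneth_rel2 (d := d) s t z ->
  kunneth_rel2 (d := d) (s + e) (fun p q => (-1) ^+ (e * q) *: t p q)
    (fun p q => (-1) ^+ (e * q) *: z p q).
Proof.
move=> [u [tu [w zw]]].
exists (fun p q => (-1) ^+ (e * q) *: u p q); split=> [p q|].
  by rewrite tu tmapZ.
exists (fun p q => (-1) ^+ (e * q) *: w p q) => p q.
by rewrite diff2_shift -zw tmapZ scalerBr.
Qed.

Lemma diff2_parity s s' w p q : odd s = odd s' -> diff2 d s w p q = diff2 d s' w p q.
Proof.
by move=> Es; rewrite /diff2 -signr_odd oddD Es -oddD signr_odd.
Qed.

Lemma rel2_parity s s' t z : odd s = odd s' ->
  kunneth_rel2 (d := d) s t z -> kunneth_rel2 (d := d) s' t z.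
Proof.
move=> Es [u [tu [w zw]]]; exists u; split=> //.
by exists w => p q; rewrite zw; exact: diff2_parity.
Qed.

Hypothesis kun : kunneth d.

Lemma rel2_inj s t : kunneth_rel2 (d := d) s t (fun _ _ => 0) ->
  forall p q, t p q = 0.
Proof.
move=> /(rel2_shift s) rel.
have rel0 : kunneth_rel2 (d := d) 0 (fun p q => (-1) ^+ (s * q) *: t p q) (fun _ _ => 0).
  apply: rel2_parity (rel2_ext _ _ rel); first by rewrite addnn odd_double.
  - by [].
  - by move=> p q; rewrite scaler0.
move=> p q; have := kunneth2_inj kun rel0 p q.
by move/(congr1 (fun t => (-1) ^+ (s * q) *: t)); rewrite signrZK scaler0.
Qed.

Lemma rel2_uniq s t t' z : kunneth_rel2 (d := d) s t z ->
  kunneth_rel2 (d := d) s t' z -> forall p q, t p q = t' p q.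
Proof.
move=> rel rel' p q; apply/eqP; rewrite -subr_eq0 addrC -scaleN1r; apply/eqP.
apply: (rel2_inj (t := fun p q => -1 *: t' p q + t p q) (s := s)).
apply: rel2_ext (rel2_lin (-1) rel' rel) => // p1 q1.
by rewrite scaleN1r addNr.
Qed.

Lemma rel2_surj s z : (forall p q, diff2 d s z p q = 0) ->
  exists t, kunneth_rel2 (d := d) s t z.
Proof.
move=> dz; have [p q|t rel] := kunneth2_surj kun (z := fun p q => (-1) ^+ (s * q) *: z p q).
  rewrite -(diff2_parity _ _ _ (s := s + s)) ?addnn ?odd_double //.
  by rewrite -addnn diff2_shift dz scaler0.
exists (fun p q => (-1) ^+ (s * q) *: t p q).
apply: (rel2_ext _ _ (rel2_shift s rel)) => // p q.
by rewrite signrZK.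
Qed.

(** Cutting all witnesses down to one total degree relates the part of t in degree m to the same z,
    and uniqueness concludes. The bounding tensor is cut at [m.+1], as the differential lowers
    degrees. *)
Lemma rel2_degree s m t z : kunneth_rel2 (d := d) s t z ->
  (forall p q, (p + q)%N != m -> z p q = 0) ->
  forall p q, (p + q)%N != m -> t p q = 0.
Proof.
move=> [u [tu [w zw]]] z0.
pose tr n (X : nat -> nat -> lmodType k) (x : forall p q, X p q) p q : X p q :=
  if (p + q)%N == n then x p q else 0.
have rel' : kunneth_rel2 (d := d) s (tr m _ t) z.
  exists (tr m _ u); split=> [p q|].
    by rewrite /tr; case: ifP => _; rewrite ?tu ?tmap0.
  exists (tr m.+1 _ w) => p q; rewrite /diff2 /tr addSn addnS eqSS.
  case: ifP => [_|/negbT ne]; first exact: zw.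
  by rewrite z0 // !tmap0 ?scaler0 subr0 addr0.
have rel : kunneth_rel2 (d := d) s t z by exists u; split=> //; exists w.
by move=> p q /negPf ne; rewrite (rel2_uniq rel rel') /tr ne.
Qed.

Definition coderivation s (f : coop V) := forall n x p q,
  f n.-1 p q (d n x) = diff2 d s (fun p q => f n p q x) p q.

(** The Künneth relation is functional, so values can be chosen class by class; uniqueness then
    forces linearity. *)
Lemma induced_exists s f : coderivation s f ->
  exists fH, induced_coop (d := d) s f fH.
Proof.
move=> df.
have ex n (h : H n) : exists t, forall x, cls n x = h ->
    kunneth_rel2 (d := d) s t (fun p q => f n p q (ker_val x)).
  have [x0 x0h] := hclassP h.
  have [p q|t rel] := rel2_surj (s := s) (z := fun p q => f n p q (ker_val x0)).
    have /eqP x0_cycle : d n (ker_val x0) == 0 by case: x0 {x0h}.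
    by rewrite -df x0_cycle linear0.
  exists t => x xh; have /quotmod_pi_eq/asboolP[y xy] : cls n x = cls n x0.
    by rewrite x0h.
  (* The representatives differ by [d y], and f maps [d y] to the boundary of its value at y. *)
  apply: rel2_ext (rel2_lin 1 rel (rel2_boundary s (fun p q => f n.+1 p q y))).
    by move=> p q; rewrite scale1r addr0.
  move=> p q; rewrite scale1r -df -xy (linearB (incl n)) linearB addrC subrK //.
have [F FE] := choice (fun nh : {n & H n} => ex (tag nh) (tagged nh)).
have F_rel n (x : Z n) : kunneth_rel2 (d := d) s (F (existT _ n (cls n x)))
    (fun p q => f n p q (ker_val x)) by exact: (FE (existT _ n (cls n x)) x erefl).
have F_lin n p q : linear (fun h : H n => F (existT _ n h) p q).
  move=> a h h'; have [x <-] := hclassP h; have [x' <-] := hclassP h'.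
  have R : kunneth_rel2 (d := d) s
      (fun p q => a *: F (existT _ n (cls n x)) p q + F (existT _ n (cls n x')) p q)
      (fun p q => f n p q (ker_val (a *: x + x'))).
    apply: rel2_ext (rel2_lin a (F_rel n x) (F_rel n x')) => // p1 q1.
    by rewrite (linearP (incl n)) (linearP (f n p1 q1)).
  by rewrite -(linearP (cls n)) (rel2_uniq (F_rel n (a *: x + x')) R).
pose L n p q : {linear H n -> H p ⊗ H q} :=
  HB.pack (fun h : H n => F (existT _ n h) p q)
    (GRing.isLinear.Build k (H n) (H p ⊗ H q)%type _ _ (F_lin n p q)).
by exists L => n x; exact: F_rel.
Qed.

End KunnethRelation.

(** * The Künneth relation for triple tensors *)

Section KunnethRelation3.
Variables (k : comNzRingType) (V : nat -> lmodType k).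
Variable d : forall n, {linear V n -> V n.-1}.
Local Notation H := (homology d).
Local Notation Z := (cycles d).
Local Notation incl p := (@ker_val _ _ _ (d p) : {linear Z p -> V p}).
Local Notation cls p := (hclass d p : {linear Z p -> H p}).
Local Notation I3 p q r := (tmap (tmap (incl p) (incl q)) (incl r)).
Local Notation H3 p q r := (tmap (tmap (cls p) (cls q)) (cls r)).
Local Notation D3 p q r := (tmap (@idfun (V p ⊗ V q)) (d r)).

(* [kunneth_rel3] for arbitrary shifts. *)
Definition rel3 s t (h : tensor3 H) (z : tensor3 V) := exists u : tensor3 Z,
  (forall p q r, h p q r = H3 p q r (u p q r)) /\
  boundary3 d s t (fun p q r => z p q r - I3 p q r (u p q r)).

Lemma incl_cycle p (x : Z p) : d p (incl p x) = 0.
Proof. by apply/eqP; case: x. Qed.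

Lemma diff3_lin s t a w w' p q r :
  diff3 d s t (fun p q r => a *: w p q r + w' p q r) p q r =
  a *: diff3 d s t w p q r + diff3 d s t w' p q r.
Proof.
by rewrite /diff3 !tmapD !tmapZ; module k (V p ⊗ V q ⊗ V r)%type.
Qed.

Lemma rel3_lin s t a h h' z z' : rel3 s t h z -> rel3 s t h' z' ->
  rel3 s t (fun p q r => a *: h p q r + h' p q r)
    (fun p q r => a *: z p q r + z' p q r).
Proof.
move=> [u [hu [w zw]]] [u' [hu' [w' zw']]].
exists (fun p q r => a *: u p q r + u' p q r); split=> [p q r|].
  by rewrite hu hu' tmapD tmapZ.
exists (fun p q r => a *: w p q r + w' p q r) => p q r.
by rewrite diff3_lin -zw -zw' tmapD tmapZ; module k (V p ⊗ V q ⊗ V r)%type.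
Qed.

Lemma rel3_ext s t h h' z z' : (forall p q r, h p q r = h' p q r) ->
  (forall p q r, z p q r = z' p q r) -> rel3 s t h z -> rel3 s t h' z'.
Proof.
move=> hh' zz' [u [hu [w zw]]]; exists u; split=> [p q r|]; first by rewrite -hh'.
by exists w => p q r; rewrite -zz'.
Qed.

Lemma diff3_shift s t e e' w p q r :
  diff3 d (s + e) (t + e') (fun p q r => (-1) ^+ (e * q + e' * r) *: w p q r) p q r =
  (-1) ^+ (e * q + e' * r) *: diff3 d s t w p q r.
Proof.
rewrite /diff3 !tmapZ !scalerDr !scalerA; congr (_ + _ *: _ + _ *: _);
  by parity; ring.
Qed.

Lemma diff3_parity s s' t t' w p q r : odd s = odd s' -> odd t = odd t' ->
  diff3 d s t w p q r = diff3 d s' t' w p q r.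
Proof.
move=> Es Et; rewrite /diff3 -(signr_odd _ (p + s)) -(signr_odd _ (p + q + t)).
by rewrite 2!oddD Es Et -!oddD !signr_odd.
Qed.

Lemma rel3_parity s s' t t' h z : odd s = odd s' -> odd t = odd t' ->
  rel3 s t h z -> rel3 s' t' h z.
Proof.
move=> Es Et [u [hu [w zw]]]; exists u; split=> //.
by exists w => p q r; rewrite zw; exact: diff3_parity.
Qed.

(** The step from identities up to boundaries to identities in homology: injectivity of the triple
    Künneth map, after a twist of signs to shifts 0. *)
Lemma rel3_boundary s t h z : kunneth d -> rel3 s t h z -> boundary3 d s t z ->
  forall p q r, h p q r = 0.
Proof.
move=> kun [u [hu [w zw]]] [w' zw'].
have rel : kunneth_rel3 (d := d) (fun p q r => (-1) ^+ (s * q + t * r) *: h p q r)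
    (fun _ _ _ => 0).
  exists (fun p q r => (-1) ^+ (s * q + t * r) *: u p q r); split=> [p q r|].
    by rewrite hu tmapZ.
  exists (fun p q r => (-1) ^+ (s * q + t * r) *: (-1 *: w' p q r + w p q r)) => p q r.
  rewrite -(@diff3_parity (s + s) 0 (t + t) 0) ?addnn ?odd_double // -!addnn.
  by rewrite diff3_shift diff3_lin -zw -zw' tmapZ; module k (V p ⊗ V q ⊗ V r)%type.
move=> p q r; have := kunneth3_inj kun rel p q r.
by move/(congr1 (fun x => (-1) ^+ (s * q + t * r) *: x)); rewrite signrZK scaler0.
Qed.

Lemma rel3_rho12 h z : rel3 1 0 h z -> rel3 1 0 (rho12 h) (rho12 z).
Proof.
have rhoE (U : nat -> lmodType k) (x : tensor3 U) p q r :
    rho12 x p q r = (-1) ^+ (q.+1 * p.+1) *: tmap tswap idfun (x q p r).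
  exact: tmapZl.
move=> [u [hu [w zw]]]; exists (rho12 u); split=> [p q r|].
  by rewrite !rhoE hu tmapZ swap12_nat.
exists (rho12 w) => p q r; have := congr1 (tmap tswap idfun) (zw q p r).
rewrite /diff3 !rhoE tmapB !tmapD !tmapZ !swap12_nat swap12_idfun => /eqP.
rewrite subr_eq => /eqP ->.
by parity; module k (V p ⊗ V q ⊗ V r)%type.
Qed.

(** Before the flip the second factor carries the shift, after it the first one does; the sum of the
    two shifts stays 1. *)
Lemma rel3_varrho12 h z : rel3 0 1 h z -> rel3 1 1 (varrho12 h) (varrho12 z).
Proof.
have rhoE (U : nat -> lmodType k) (x : tensor3 U) p q r :
    varrho12 x p q r = (-1) ^+ (q * p.+1) *: tmap tswap idfun (x q p r).
  exact: tmapZl.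
move=> [u [hu [w zw]]]; exists (varrho12 u); split=> [p q r|].
  by rewrite !rhoE hu tmapZ swap12_nat.
exists (varrho12 w) => p q r; have := congr1 (tmap tswap idfun) (zw q p r).
rewrite /diff3 !rhoE tmapB !tmapD !tmapZ !swap12_nat swap12_idfun => /eqP.
rewrite subr_eq => /eqP ->.
by parity; module k (V p ⊗ V q ⊗ V r)%type.
Qed.

Lemma rel3_rho23 h z : rel3 1 0 h z -> rel3 1 0 (rho23 h) (rho23 z).
Proof.
have rhoE (U : nat -> lmodType k) (x : tensor3 U) p q r :
    rho23 x p q r = (-1) ^+ (r.+1 * q.+1) *: swap23 _ _ _ (x p r q).
  rewrite /rho23 (@tmapZr _ _ _ _ _ ((-1) ^+ (r.+1 * q.+1)) _ _ tswap) //.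
  exact: (linearZ_LR (@tassocV k (U p) (U q) (U r))).
move=> [u [hu [w zw]]]; exists (rho23 u); split=> [p q r|].
  by rewrite !rhoE hu tmapZ swap23_nat.
exists (rho23 w) => p q r; have := congr1 (swap23 _ _ _) (zw p r q).
have sD := linearD (swap23 (V p) (V r) (V q)).
have sB := linearB (swap23 (V p) (V r) (V q)).
have sZ a x : swap23 (V p) (V r) (V q) (a *: x) = a *: swap23 _ _ _ x.
  exact: linearZ_LR.
have idE : D3 p q r.+1 =1 tmap (tmap idfun idfun) (d r.+1).
  by move=> x; apply: tmap_eq => // y; rewrite tmap_id.
have idE' : D3 p r q.+1 =1 tmap (tmap idfun idfun) (d q.+1).
  by move=> x; apply: tmap_eq => // y; rewrite tmap_id.
rewrite /diff3 !rhoE sB !sD !sZ idE idE' !swap23_nat !tmapZ => /eqP.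
rewrite subr_eq => /eqP ->.
by parity; module k (V p ⊗ V q ⊗ V r)%type.
Qed.
End KunnethRelation3.

(** * Operations induced in homology *)

Section InducedComposition.
Variables (k : comNzRingType) (V : nat -> lmodType k).
Variable d : forall n, {linear V n -> V n.-1}.
Local Notation H := (homology d).
Local Notation Z := (cycles d).
Local Notation incl p := (@ker_val _ _ _ (d p) : {linear Z p -> V p}).
Local Notation cls p := (hclass d p : {linear Z p -> H p}).
Local Notation I2 p q := (tmap (incl p) (incl q)).
Local Notation H2 p q := (tmap (cls p) (cls q)).
Local Notation I3 p q r := (tmap (tmap (incl p) (incl q)) (incl r)).
Local Notation H3 p q r := (tmap (tmap (cls p) (cls q)) (cls r)).

Lemma tpureBl (M N : lmodType k) (m m' : M) (n : N) :
  tpure (m - m') n = tpure m n - tpure m' n.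
Proof. by rewrite tpureDl -scaleN1r tpureZl scaleN1r. Qed.
Lemma tpureBr (M N : lmodType k) (m : M) (n n' : N) :
  tpure m (n - n') = tpure m n - tpure m n'.
Proof. exact: linearB. Qed.
Lemma tpureZr (M N : lmodType k) a (m : M) (n : N) :
  tpure m (a *: n) = a *: tpure m n.
Proof. exact: linearZ_LR. Qed.

Variables (s : nat) (f : coop V) (fH : coop H).
Hypothesis df : coderivation d s f.
Hypothesis f_deg : forall n p q, (p + q)%N != (n + s)%N -> forall x, f n p q x = 0.
Hypothesis fHP : induced_coop (d := d) s f fH.

(** On a pure tensor, [fHP] treats the first factor and the second stays a cycle; witnesses of sums
    are sums of witnesses. With the last factor of W a cycle, only two terms of the differential
    survive. *)
Lemma compl_lift m r (v : Z m ⊗ Z r) :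
  exists (U : forall p q, Z p ⊗ Z q ⊗ Z r) (W : forall p q, V p ⊗ V q ⊗ Z r),
  forall p q, tmap (fH m p q) idfun (H2 m r v) = H3 p q r (U p q) /\
    tmap (f m p q) idfun (I2 m r v) - I3 p q r (U p q) =
    tmap (tmap (d p.+1) idfun) (incl r) (W p.+1 q)
    + (-1) ^+ (p + s) *: tmap (tmap idfun (d q.+1)) (incl r) (W p q.+1).
Proof.
elim/tensor_ind: v => [a b|v v' [U [W hv]] [U' [W' hv']]].
  have [u [fu [w fw]]] := fHP a.
  exists (fun p q => tpure (u p q) b), (fun p q => tpure (w p q) b) => p q.
  rewrite !tmapE; split; first by rewrite fu.
  by rewrite -tpureBl fw /diff2 tpureDl tpureZl.
exists (fun p q => U p q + U' p q), (fun p q => W p q + W' p q) => p q.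
have [h1 h2] := hv p q; have [h1' h2'] := hv' p q.
split; first by rewrite !tmapD h1 h1'.
rewrite !tmapD opprD addrACA h2 h2'.
by module k (V p ⊗ V q ⊗ V r)%type.
Qed.

Lemma compr_lift p m (v : Z p ⊗ Z m) :
  exists (U : forall q r, Z p ⊗ Z q ⊗ Z r) (W : forall q r, Z p ⊗ V q ⊗ V r),
  forall q r, tassocV (tmap idfun (fH m q r) (H2 p m v)) = H3 p q r (U q r) /\
    tassocV (tmap idfun (f m q r) (I2 p m v)) - I3 p q r (U q r) =
    tmap (tmap (incl p) (d q.+1)) idfun (W q.+1 r)
    + (-1) ^+ (q + s) *: tmap (tmap (incl p) idfun) (d r.+1) (W q r.+1).
Proof.
elim/tensor_ind: v => [a b|v v' [U [W hv]] [U' [W' hv']]].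
  have [u [fu [w fw]]] := fHP b.
  exists (fun q r => tassocV (tpure a (u q r))), (fun q r => tassocV (tpure a (w q r))).
  move=> q r; rewrite !tassocV_pure !tmapE fu; split=> //.
  by rewrite -tassocVB -tpureBr fw /diff2 tpureDr tpureZr tassocVD tassocVZ.
exists (fun q r => U q r + U' q r), (fun q r => W q r + W' q r) => q r.
have [h1 h2] := hv q r; have [h1' h2'] := hv' q r.
split; first by rewrite !tmapD tassocVD h1 h1'.
rewrite !tmapD tassocVD opprD addrACA h2 h2'.
by module k (V p ⊗ V q ⊗ V r)%type.
Qed.
(** f ⊗ id is a chain map: with m = p + q - s, the sign exponent m + sg of the last differential has
    the parity of p + q + (sg + s). *)
Lemma compl_diff (sg : nat) (w : tensor2 V) p q r :
  tmap (f (p + q - s)%N p q) idfun (diff2 d sg w (p + q - s)%N r) =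
  diff3 d s (sg + s)
    (fun p q r => tmap (f (p + q - s)%N p q) idfun (w (p + q - s)%N r)) p q r.
Proof.
pose G N p q r := tmap (f N p q) idfun (w N r).
rewrite /diff3 -[tmap (f (p.+1 + q - s)%N _ _) _ _]/(G (p.+1 + q - s)%N p.+1 q r).
rewrite -[tmap (f (p + q.+1 - s)%N _ _) _ _]/(G (p + q.+1 - s)%N p q.+1 r).
rewrite addnS addSn /G tmap_comp.
have [le_s|lt_s] := leqP s (p + q).
  rewrite (subSn le_s); set m := (p + q - s)%N.
  rewrite /diff2 tmapD tmapZ !tmap_comp (@tmap_linl _ _ _ _ _ ((-1) ^+ (p + s))
    (f m p q \o d m.+1) (tmap idfun (d q.+1) \o f m.+1 p q.+1)
    (tmap (d p.+1) idfun \o f m.+1 p.+1 q)); last first.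
    by move=> x; have := df x p q; rewrite /diff2 addrC.
  rewrite [_ *: _ + _ in LHS]addrC; congr (_ + _ + _ *: _).
    by rewrite -(subnK le_s) -/m; parity.
(* For p + q < s the subtractions truncate to 0. There f has no component (p, q), so the left side
   vanishes, and the coderivation identity in degree 0, where [0.-1] is 0, cancels what remains on
   the right. *)
have f0 x : f (p + q - s)%N p q x = 0 by apply: f_deg; lia.
have -> : ((p + q).+1 - s = 0)%N by lia.
rewrite [LHS]tmap0l // (tmap0l (f := f _ p q)) // tmap0 scaler0 addr0 !tmap_comp.
rewrite addrC -(@tmap_linl _ _ _ _ _ ((-1) ^+ (p + s)) (f 0.-1 p q \o d 0)) ?tmap0l //.
  by move=> x; apply: f_deg; lia.
by move=> x; have := df x p q; rewrite /diff2 addrC.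
Qed.

Lemma sign_compr (p q sg : nat) :
  (-1) ^+ (p + q + (sg + s)) = (-1) ^+ (p + sg) * (-1) ^+ (q + s) :> k.
Proof. by rewrite -exprD addnACA. Qed.

Lemma compr_diff (sg : nat) (w : tensor2 V) p q r :
  tassocV (tmap idfun (f (q + r - s)%N q r) (diff2 d sg w p (q + r - s)%N)) =
  diff3 d sg (sg + s)
    (fun p q r => tassocV (tmap idfun (f (q + r - s)%N q r) (w p (q + r - s)%N))) p q r.
Proof.
pose G N p q r := tmap idfun (f N q r) (w p N).
rewrite /diff3 -[tmap _ (f (q.+1 + r - s)%N _ _) _]/(G (q.+1 + r - s)%N p q.+1 r).
rewrite -[tmap _ (f (q + r.+1 - s)%N _ _) _]/(G (q + r.+1 - s)%N p q r.+1).
have idE : tmap idfun (d r.+1) =1 tmap (tmap (@idfun (V p)) (@idfun (V q))) (d r.+1).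
  by move=> x; apply: tmap_eq => // y; rewrite tmap_id.
rewrite addnS addSn idE -!tassocV_nat /G.
have [le_s|lt_s] := leqP s (q + r).
  rewrite (subSn le_s); set m := (q + r - s)%N.
  rewrite /diff2 tmapD tmapZ !tmap_comp (@tmap_linr _ _ _ _ _ ((-1) ^+ (q + s)) _
    (f m q r \o d m.+1) (tmap idfun (d r.+1) \o f m.+1 q r.+1)
    (tmap (d q.+1) idfun \o f m.+1 q.+1 r)); last first.
    by move=> x; have := df x q r; rewrite /diff2 addrC.
  rewrite tassocVD tassocVZ tassocVD tassocVZ.
  have -> : tassocV (tmap (idfun \o d p.+1) (f m q r \o idfun) (w p.+1 m)) =
    tassocV (tmap (d p.+1 \o idfun) (tmap idfun idfun \o f m q r) (w p.+1 m)).
    by congr (tassocV _); apply: tmap_eq => // x; rewrite /= tmap_id.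
  rewrite sign_compr.
  by module k (V p ⊗ V q ⊗ V r)%type.
have f0 x : f (q + r - s)%N q r x = 0 by apply: f_deg; lia.
have -> : ((q + r).+1 - s = 0)%N by lia.
rewrite !(@tmap0r k _ _ _ _ _ (f (q + r - s)%N q r)) // tmap0.
rewrite !(linear0 (@tassocV k _ _ _)) add0r !tmap_comp.
rewrite sign_compr.
rewrite -scalerA -scalerDr -tassocVZ -tassocVD [X in tassocV X]addrC.
rewrite -(@tmap_linr _ _ _ _ _ ((-1) ^+ (q + s)) _ (f 0.-1 q r \o d 0)).
  rewrite tmap0r ?(linear0 (@tassocV k _ _ _)) ?scaler0 // => x.
  by apply: f_deg; lia.
by move=> x; have := df x q r; rewrite /diff2 addrC.
Qed.

Lemma compl_rel (sg : nat) (g : coop V) (gH : coop H) n (x : Z n) :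
  induced_coop (d := d) sg g gH ->
  rel3 s (sg + s) (compl s fH gH (cls n x)) (compl s f g (incl n x)).
Proof.
move=> gHP; have [v [gv [w gw]]] := gHP n x.
pose lift m r := cid (compl_lift (v m r)).
pose U m r := sval (lift m r).
pose lift2 m r := cid (svalP (lift m r)).
pose W m r := sval (lift2 m r).
have UW m r : _ := svalP (lift2 m r).
exists (fun p q r => U (p + q - s)%N r p q); split=> [p q r|].
  by rewrite /compl gv; have [] := UW (p + q - s)%N r p q.
(* The differential raises p or q by one, which turns [(p + q).-1 - s] into the degree [p + q - s]
   that f splits. *)
pose B p q r := tmap (@idfun (V p ⊗ V q)) (incl r) (W ((p + q).-1 - s)%N r p q).
exists (fun p q r => 1 *: tmap (f (p + q - s)%N p q) idfun (w (p + q - s)%N r)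
  + B p q r) => p q r.
rewrite diff3_lin -compl_diff scale1r -gw tmapB /compl -addrA; congr (_ + _).
have [_ E] := UW (p + q - s)%N r p q.
rewrite -[LHS](addKr (tmap (f (p + q - s)%N p q) idfun (I2 _ _ (v (p + q - s)%N r)))).
congr (_ + _); rewrite [LHS]E.
rewrite /diff3 /B addnS addSn !tmap_comp.
rewrite (@tmap0r k _ _ _ _ _ (d r.+1 \o incl r.+1)) ?scaler0 ?addr0; last exact: incl_cycle.
by congr (_ + _ *: _); apply: tmap_eq.
Qed.

Lemma compr_rel (sg : nat) (g : coop V) (gH : coop H) n (x : Z n) :
  induced_coop (d := d) sg g gH ->
  rel3 sg (sg + s) (compr s fH gH (cls n x)) (compr s f g (incl n x)).
Proof.
move=> gHP; have [v [gv [w gw]]] := gHP n x.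
pose lift p m := cid (compr_lift (v p m)).
pose U p m := sval (lift p m).
pose lift2 p m := cid (svalP (lift p m)).
pose W p m := sval (lift2 p m).
have UW p m : _ := svalP (lift2 p m).
exists (fun p q r => U p (q + r - s)%N q r); split=> [p q r|].
  by rewrite /compr gv; have [] := UW p (q + r - s)%N q r.
(* The sign compensates the passage of the differential past the first factor. *)
pose B p q r := (-1) ^+ (p + sg) *: tmap (tmap (incl p) (@idfun (V q)))
  (@idfun (V r)) (W p ((q + r).-1 - s)%N q r).
exists (fun p q r =>
  1 *: tassocV (tmap idfun (f (q + r - s)%N q r) (w p (q + r - s)%N)) + B p q r).
move=> p q r.
rewrite diff3_lin -compr_diff scale1r -gw tmapB tassocVB /compr -addrA; congr (_ + _).
have [_ E] := UW p (q + r - s)%N q r.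
rewrite -[LHS](addKr (tassocV (tmap idfun (f (q + r - s)%N q r)
  (I2 _ _ (v p (q + r - s)%N))))).
congr (_ + _); rewrite [LHS]E.
rewrite /diff3 /B addnS addSn !tmapZ !tmap_comp.
have T0 y : tmap (tmap (d p.+1) idfun \o tmap (incl p.+1) (@idfun (V q)))
    (idfun \o @idfun (V r)) y = 0.
  by apply: tmap0l => y'; rewrite /= tmap_comp; apply: tmap0l; exact: incl_cycle.
rewrite T0.
rewrite scaler0 add0r !scalerA sign_compr mulrAC -expr2 sqrr_sign mul1r.
rewrite scale1r; congr (_ + _ *: _); apply: tmap_eq => // y;
  by rewrite /= tmap_comp; apply: tmap_eq.
Qed.
End InducedComposition.

(** * The coalgebra identities in homology *)

Section HomologyCoalgebra.
Variables (k : comNzRingType) (V : nat -> lmodType k).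
Variable d : forall n, {linear V n -> V n.-1}.
Local Notation H := (homology d).
Local Notation Z := (cycles d).
Local Notation incl p := (@ker_val _ _ _ (d p) : {linear Z p -> V p}).
Local Notation cls p := (hclass d p : {linear Z p -> H p}).

Lemma flip_nat (A B D E : lmodType k) e (f : {linear A -> D}) (g : {linear B -> E}) t :
  flip e (tmap f g t) = tmap g f (flip e t).
Proof.
have flipE (X Y : lmodType k) (z : X ⊗ Y) : flip e z = (-1) ^+ e *: tswap z by [].
by rewrite !flipE tmapZ tswap_nat.
Qed.

Lemma flip_sign (A B : lmodType k) e (t : A ⊗ B) : flip e t = (-1) ^+ e *: tswap t.
Proof. by []. Qed.

Lemma rel2_tau2 t z : kunneth_rel2 (d := d) 0 t z ->
  kunneth_rel2 (d := d) 0 (tau2 t) (tau2 z).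
Proof.
move=> [u [tu [w zw]]]; exists (tau2 u); split=> [p q|].
  by rewrite /tau2 tu flip_nat.
exists (tau2 w) => p q; have := congr1 tswap (zw q p).
have sD := linearD (@tswap k (V q) (V p)); have sB := linearB (@tswap k (V q) (V p)).
have sZ a x : tswap (a *: x) = a *: @tswap k (V q) (V p) x by exact: linearZ_LR.
rewrite /tau2 /diff2 !flip_sign sB sD sZ !tmapZ !tswap_nat => /eqP.
rewrite subr_eq => /eqP ->.
by parity; module k (V p ⊗ V q)%type.
Qed.

Variables cup cobr : coop V.
Hypothesis gmb : gerstenhaber_mod_boundaries d cup cobr.
Hypothesis cup_deg : forall n p q, (p + q)%N != n -> forall x, cup n p q x = 0.
Hypothesis cobr_deg : forall n p q, (p + q)%N != n.+1 -> forall x, cobr n p q x = 0.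
Hypothesis kun : kunneth d.

Theorem homology_gerstenhaber_coalgebra : exists cupH cobrH : coop H,
  [/\ induced_coop (d := d) 0 cup cupH, induced_coop (d := d) 1 cobr cobrH,
      (forall cupH' cobrH' : coop H,
         induced_coop (d := d) 0 cup cupH' -> induced_coop (d := d) 1 cobr cobrH' ->
         forall n p q (x : H n),
           cupH' n p q x = cupH n p q x /\ cobrH' n p q x = cobrH n p q x)
    & gerstenhaber_coalgebra cupH cobrH].
Proof.
have cup_d0 : coderivation d 0 cup by move=> n x p q; exact: (cup_coderivation gmb).
have cobr_d1 : coderivation d 1 cobr by move=> n x p q; exact: (cobr_coderivation gmb).
have [cupH cupHP] := induced_exists kun cup_d0.
have [cobrH cobrHP] := induced_exists kun cobr_d1.
have cup_deg0 n p q : (p + q)%N != (n + 0)%N -> forall x, cup n p q x = 0.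
  by rewrite addn0; exact: cup_deg.
have cobr_deg1 n p q : (p + q)%N != (n + 1)%N -> forall x, cobr n p q x = 0.
  by rewrite addn1; exact: cobr_deg.
exists cupH, cobrH; split=> //.
  move=> cupH' cobrH' cupHP' cobrHP' n p q h; have [x <-] := hclassP h.
  by split; [exact: (rel2_uniq kun (cupHP' n x) (cupHP n x))
            |exact: (rel2_uniq kun (cobrHP' n x) (cobrHP n x))].
split.
- move=> n p q ne h; have [x <-] := hclassP h.
  by apply: (rel2_degree kun (cupHP n x)) ne => p1 q1 ne; exact: cup_deg.
- move=> n p q ne h; have [x <-] := hclassP h.
  by apply: (rel2_degree kun (cobrHP n x)) ne => p1 q1 ne; exact: cobr_deg.
- move=> n h p q r; have [x <-] := hclassP h.
  have L := compl_rel cup_d0 cup_deg0 cupHP x cupHP.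
  have R := compr_rel cup_d0 cup_deg0 cupHP x cupHP.
  apply: (rel3_boundary kun _ (mod_coassoc gmb (incl_cycle x))).
  by apply: rel3_ext (rel3_lin (-1) R L) => p1 q1 r1; rewrite scaleN1r addrC.
- move=> n h p q; have [x <-] := hclassP h; rewrite /cocomm_defect.
  have [w zw] := mod_cocomm gmb (incl_cycle x).
  apply: (rel2_inj kun (s := 0) (t := cocomm_defect cupH (cls n x))).
  have R := rel2_lin (-1) (cupHP n x) (rel2_tau2 (cupHP n x)).
  have R' := rel2_lin (-1) (rel2_boundary d 0 w) R.
  apply: (rel2_ext _ _ R') => p1 q1.
    by rewrite scaler0 add0r scaleN1r addrC.
  by rewrite -zw !scaleN1r /cocomm_defect addrC [- _ + tau2 _ _ _]addrC subrr.
- move=> n h; have [x <-] := hclassP h.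
  have [y [w zw]] := mod_antisym gmb (incl_cycle x).
  (* Up to a boundary the cobracket is [y - rho2 y], but y need not be a cycle; injectivity on
     coinvariants supplies an antisymmetrized tensor of classes. *)
  apply: (kunneth_coinv_inj kun (t := fun p q => cobrH n p q (cls n x)) (y := y)).
  apply: rel2_ext (rel2_lin (-1) (rel2_boundary d 1 w) (cobrHP n x)) => p1 q1.
    by rewrite scaler0 add0r.
  by rewrite -zw scaleN1r opprB addrNK.
- move=> n h p q r; have [x <-] := hclassP h.
  have R : rel3 1 0 (compl 1 cobrH cobrH (cls n x)) (compl 1 cobr cobr (incl n x)).
    apply: (rel3_parity _ _ (compl_rel cobr_d1 cobr_deg1 cobrHP x cobrHP)) => //.
  apply: (rel3_boundary kun _ (mod_cojacobi gmb (incl_cycle x))).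
  apply: rel3_ext (rel3_lin 1 (rel3_lin 1 R (rel3_rho23 (rel3_rho12 R)))
    (rel3_rho12 (rel3_rho23 R))) => p1 q1 r1; by rewrite !scale1r.
- move=> n h p q r; have [x <-] := hclassP h.
  (* The three terms come out with the same parities of shifts, 1 for the first factor and 1 for the
     first two together, so they can be added. *)
  have R1 := compr_rel cup_d0 cup_deg0 cupHP x cobrHP.
  have R2 := compl_rel cobr_d1 cobr_deg1 cobrHP x cupHP.
  have R3 := rel3_varrho12 (compr_rel cobr_d1 cobr_deg1 cobrHP x cupHP).
  apply: (rel3_boundary kun _ (mod_coleibniz gmb (incl_cycle x))).
  apply: rel3_ext (rel3_lin (-1) R3 (rel3_lin (-1) R2 R1)) => p1 q1 r1;
    by rewrite !scaleN1r /coleibniz_defect opprD addrC -addrA [RHS]addrCA.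
Qed.
End HomologyCoalgebra.

(** * The Künneth property over a field *)

Section Splitting.
Variable k : comNzRingType.
Hypothesis k_field : is_field k.

Definition subspace (M : lmodType k) (S : M -> Prop) :=
  forall a x y, S x -> S y -> S (a *: x + y).

Lemma complement (M : lmodType k) (S : M -> Prop) : S 0 -> subspace S ->
  exists K : M -> Prop, [/\ K 0, subspace K, forall x, K x -> S x -> x = 0
    & forall b, exists s x, [/\ S s, K x & b = s + x]].
Proof.
move=> S0 S_lin.
have [|K [[K_lin KS] K_max]] :=
    @Zorn_bigcup M (fun K => subspace K /\ forall x, K x -> S x -> x = 0).
  move=> F FP tot; split=> [a x y [X FX Xx] [Y FY Yy]|x [X FX Xx]]; last first.
    by have [_] := FP _ FX; exact.
  have [XY|YX] := tot _ _ FX FY.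
    by exists Y => //; have [Y_lin _] := FP _ FY; apply: Y_lin => //; exact: XY.
  by exists X => //; have [X_lin _] := FP _ FX; apply: X_lin => //; exact: YX.
have K0 : K 0.
  apply: contrapT => nK0; apply: (K_max (fun x => x = 0)).
    split=> [x Kx|sub]; last by apply: nK0; exact: sub.
    by case: nK0; rewrite -[0](addNr x) -scaleN1r; exact: K_lin.
  by split=> [a x y -> ->|x ->]; rewrite ?scaler0 ?addr0.
exists K; split=> // b; apply: contrapT => nb.
have bK c : c *: b + 0 = c *: b by rewrite addr0.
(* If b is not in S + K, then K + k b is larger and still meets S only in 0: a nonzero coefficient
   of b could be inverted. *)
apply: (K_max (fun x => exists2 y, K y & exists c, x = y + c *: b)).
  split=> [x Kx|sub]; first by exists x => //; exists 0; rewrite scale0r addr0.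
  have Kb : K b by apply: sub; exists 0 => //; exists 1; rewrite scale1r add0r.
  by apply: nb; exists 0, b; rewrite add0r.
split=> [a _ _ [x Kx [c ->]] [y Ky [c' ->]]|_ [x Kx [c ->]]].
  exists (a *: x + y); first exact: K_lin.
  by exists (a * c + c'); rewrite scalerDr scalerDl scalerA addrACA.
move=> Sxc; have [c0|nc0] := eqVneq c 0.
  by move: Sxc; rewrite c0 scale0r addr0; exact: KS.
have [c' c'c] := k_field nc0; case: nb.
exists (c' *: (x + c *: b) + 0), (- c' *: x + 0); split.
- exact: S_lin.
- exact: K_lin.
- by rewrite !addr0 scalerDr scalerA c'c scale1r scaleNr addrAC subrr add0r.
Qed.

(** With K a complement of the kernel and L one of the image, g sends y to the only x in K with y -
    f x in L; G is its graph. *)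
Lemma generalized_inverse (M N : lmodType k) (f : {linear M -> N}) :
  exists g : {linear N -> M}, forall x, f (g (f x)) = f x.
Proof.
have [||K [K0 K_lin Kker K_sum]] := @complement M (fun x => f x = 0).
- exact: linear0.
- by move=> a x y fx fy; rewrite linearP fx fy scaler0 addr0.
have [||L [L0 L_lin Lim L_sum]] := @complement N (fun y => exists x, y = f x).
- by exists 0; rewrite linear0.
- by move=> a _ _ [x ->] [y ->]; exists (a *: x + y); rewrite linearP.
pose G y x := K x /\ exists2 l, L l & y = f x + l.
have G_ex y : exists x, G y x.
  have [_ [l [[x ->] Ll ->]]] := L_sum y; have [s [x' [fs Kx' ->]]] := K_sum x.
  by exists x'; split=> //; exists l => //; rewrite linearD fs add0r.
have G_lin a y y' x x' : G y x -> G y' x' -> G (a *: y + y') (a *: x + x').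
  move=> [Kx [l Ll ->]] [Kx' [l' Ll' ->]]; split; first exact: K_lin.
  by exists (a *: l + l'); [exact: L_lin|rewrite linearP scalerDr addrACA].
have G0 x : G 0 x -> x = 0.
  move=> [Kx [l Ll /eqP]]; rewrite eq_sym addr_eq0 => /eqP fx.
  apply: Kker => //; rewrite fx; have -> : l = 0; last by rewrite oppr0.
  by apply: Lim => //; exists (- x); rewrite linearN fx opprK.
have G_uniq y x x' : G y x -> G y x' -> x = x'.
  move=> Gx Gx'; apply/eqP; rewrite -subr_eq0 addrC -scaleN1r; apply/eqP/G0.
  by rewrite -[0](addNr y) -scaleN1r; exact: G_lin.
have [g gG] := choice G_ex.
have g_lin : linear g by move=> a y y'; apply: G_uniq (gG _) (G_lin _ _ _ _ _ (gG y) (gG y')).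
pose L' : {linear N -> M} := HB.pack g (GRing.isLinear.Build k N M _ g g_lin).
exists L' => x; rewrite -[L' _]/(g _).
have [_ [l Ll E]] := gG (f x); have l0 : l = 0; last by rewrite [RHS]E l0 addr0.
by apply: Lim => //; exists (x - g (f x)); rewrite linearB [X in X - _]E addrC addKr.
Qed.
End Splitting.

Section FieldKunneth.
Variables (k : comNzRingType) (V : nat -> lmodType k).
Variable d : forall n, {linear V n -> V n.-1}.
Local Notation H := (homology d).
Local Notation Z := (cycles d).
Local Notation incl p := (@ker_val _ _ _ (d p) : {linear Z p -> V p}).
Local Notation cls p := (hclass d p : {linear Z p -> H p}).
Local Notation I2 p q := (tmap (incl p) (incl q)).
Local Notation H2 p q := (tmap (cls p) (cls q)).
Hypothesis dd : forall n x, d n.-1 (d n x) = 0.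
Hypothesis d0 : forall x, d 0 x = 0.

(* With e = incl sect retr, homot0 and homotS say that 1 - e = d homot + homot d. *)
Record retraction := Retraction {
  retr : forall n, {linear V n -> H n};
  sect : forall n, {linear H n -> Z n};
  homot : forall n, {linear V n -> V n.+1};
  retr_incl : forall n z, retr n (incl n z) = cls n z;
  retr_d : forall n y, retr n (d n.+1 y) = 0;
  sect_cls : forall n h, cls n (sect n h) = h;
  homot0 : forall x, x - incl 0 (sect 0 (retr 0 x)) = d 1 (homot 0 x);
  homotS : forall n x, x - incl n.+1 (sect n.+1 (retr n.+1 x)) =
    d n.+2 (homot n.+1 x) + homot n (d n.+1 x)
}.

Section Retraction.
Variable g : forall n, {linear V n -> V n.+1}.
Hypothesis dgd : forall n x, d n.+1 (g n (d n.+1 x)) = d n.+1 x.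

(** The projection g d, whose kernel consists of the cycles. *)
Definition gd n : {linear V n -> V n} :=
  match n with 0 => \0 | n'.+1 => g n' \o d n'.+1 end.

Lemma d_gd n x : d n (gd n x) = d n x.
Proof. by case: n x => [|n] x; [rewrite !d0|exact: dgd]. Qed.
Lemma gd_d n y : gd n (d n.+1 y) = 0.
Proof. by case: n y => [|n] y //=; rewrite (dd (n := n.+2)) linear0. Qed.
Lemma gd_cycle n z : gd n (incl n z) = 0.
Proof. by case: n z => [|n] z //=; rewrite incl_cycle linear0. Qed.

Fact zproj_subproof n x : x - gd n x \in ker_pred (d n).
Proof. by rewrite unfold_in /ker_pred linearB d_gd subrr. Qed.
Definition zproj n x : Z n := Ker (zproj_subproof x).
Fact zproj_linear n : linear (@zproj n).
Proof.
move=> a x y; apply: val_inj; rewrite [RHS](linearP (incl n)).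
change (a *: x + y - gd n (a *: x + y) = a *: (x - gd n x) + (y - gd n y)).
by rewrite (linearP (gd n)) scalerBr opprD addrACA.
Qed.
HB.instance Definition _ n :=
  GRing.isLinear.Build k (V n) (Z n) _ (@zproj n) (@zproj_linear n).

Fact zsec_subproof n z : incl n z - d n.+1 (g n (incl n z)) \in ker_pred (d n).
Proof. by rewrite unfold_in /ker_pred linearB incl_cycle (dd (n := n.+1)) subrr. Qed.
(** 1 - d g alters a cycle by a boundary and kills boundaries because d g d = d, so it descends to a
    section of the class map. *)
Definition zsec n z : Z n := Ker (zsec_subproof z).
Fact zsec_linear n : linear (@zsec n).
Proof.
move=> a x y; apply: val_inj; rewrite [RHS](linearP (incl n)).
change (incl n (a *: x + y) - d n.+1 (g n (incl n (a *: x + y))) =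
  a *: (incl n x - d n.+1 (g n (incl n x))) + (incl n y - d n.+1 (g n (incl n y)))).
by rewrite (linearP (incl n)) (linearP (g n)) (linearP (d n.+1)) scalerBr opprD addrACA.
Qed.
HB.instance Definition _ n :=
  GRing.isLinear.Build k (Z n) (Z n) _ (@zsec n) (@zsec_linear n).

Definition hsec n (h : H n) : Z n := zsec (repr h).
Lemma hsec_cls n z : hsec (cls n z) = zsec z.
Proof.
have /quotmod_pi_eq/asboolP[y zy] : cls n (repr (cls n z)) = cls n z.
  exact: quotmod_piK.
apply/eqP; rewrite -subr_eq0 -(linearB (@zsec n)); apply/eqP/val_inj.
change (incl n (repr (cls n z) - z) - d n.+1 (g n (incl n (repr (cls n z) - z))) = 0).
by rewrite [incl n _]zy dgd subrr.
Qed.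
Fact hsec_linear n : linear (@hsec n).
Proof.
move=> a h h'; have [z <-] := hclassP h; have [z' <-] := hclassP h'.
by rewrite -linearP !hsec_cls linearP.
Qed.
HB.instance Definition _ n :=
  GRing.isLinear.Build k (H n) (Z n) _ (@hsec n) (@hsec_linear n).

(** The homotopy is g (1 - g d). As g d kills boundaries, the homotopy applied to [d x] is just g d
    x, the second term in [zsec_zproj]. *)
Lemma exists_retraction : retraction.
Proof.
have zsec_zproj n x : x - incl n (hsec (cls n (zproj x))) =
    d n.+1 (g n (x - gd n x)) + gd n x.
  by rewrite hsec_cls /= opprD opprK addrA opprD opprK addrA subrr add0r addrC.
apply: (@Retraction (fun n => cls n \o @zproj n) (@hsec)
  (fun n => g n \o (idfun \- gd n))) => [n z|n y|n h|x|n x] /=.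
- congr (cls n _); apply: val_inj => /=; by rewrite gd_cycle subr0.
- apply/eqP; rewrite -[0](linear0 (cls n)); apply/eqP/quotmod_pi_eq/asboolP.
  by exists y; rewrite subr0 /= gd_d subr0.
- have [z <-] := hclassP h; rewrite hsec_cls; apply/quotmod_pi_eq/asboolP.
  exists (- g n (incl n z)); rewrite linearN (linearB (incl n)) /=.
  by rewrite addrAC subrr add0r.
- by rewrite zsec_zproj /= subr0 addr0.
by rewrite zsec_zproj /= gd_d subr0.
Qed.
End Retraction.

Section Kunneth.
Variable R : retraction.
Local Notation ret p := (retr R p).
Local Notation sec p := (incl p \o sect R p \o ret p).

Lemma sec_d n y : sec n (d n.+1 y) = 0.
Proof. by rewrite /= retr_d !linear0. Qed.

Lemma retr2 p q (u : Z p ⊗ Z q) : tmap (ret p) (ret q) (I2 p q u) = H2 p q u.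
Proof. by rewrite tmap_comp; apply: tmap_eq; exact: retr_incl. Qed.

Lemma retr2_diff s w p q : tmap (ret p) (ret q) (diff2 d s w p q) = 0.
Proof.
rewrite /diff2 tmapD tmapZ !tmap_comp tmap0l ?tmap0r ?scaler0 ?addr0 //;
  exact: retr_d.
Qed.

Lemma retr3_diff s t w p q r :
  tmap (tmap (ret p) (ret q)) (ret r) (diff3 d s t w p q r) = 0.
Proof.
rewrite /diff3 !tmapD !tmapZ !tmap_comp.
rewrite [X in X + _ + _]tmap0l => [|x]; last first.
  by rewrite /= tmap_comp; apply: tmap0l; exact: retr_d.
rewrite [X in _ + _ *: X + _]tmap0l => [|x]; last first.
  by rewrite /= tmap_comp; apply: tmap0r; exact: retr_d.
by rewrite tmap0r ?scaler0 ?addr0 //; exact: retr_d.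
Qed.

(* The homotopy homot ⊗ 1 + e ⊗ homot from 1 to e ⊗ e, with Koszul signs. *)
Definition homot2 (z : tensor2 V) : tensor2 V := fun p q =>
  match p return V p ⊗ V q with
    0 => 0 | p'.+1 => tmap (homot R p') idfun (z p' q) end
  + (-1) ^+ p *: match q return V p ⊗ V q with
    0 => 0 | q'.+1 => tmap (sec p) (homot R q') (z p q') end.

Lemma homot2P z : (forall p q, diff2 d 0 z p q = 0) ->
  forall p q, z p q - tmap (sec p) (sec q) (z p q) = diff2 d 0 (homot2 z) p q.
Proof.
move=> dz p q.
pose A p q := match p return V p ⊗ V q with
  0 => 0 | p'.+1 => tmap (homot R p') idfun (z p' q) end.
pose B p q := match q return V p ⊗ V q with
  0 => 0 | q'.+1 => tmap (sec p) (homot R q') (z p q') end.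
have secl (X : lmodType k) n (t : V n ⊗ X) :
    tmap (idfun \- sec n) idfun t = -1 *: tmap (sec n) idfun t + t.
  rewrite -{3}[t]tmap_id; apply: tmap_linl => x.
  by rewrite scaleN1r addrC.
have secr n (t : V p ⊗ V n) :
    tmap (sec p) (idfun \- sec n) t =
    -1 *: tmap (sec p) (sec n) t + tmap (sec p) idfun t.
  by apply: tmap_linr => x; rewrite scaleN1r addrC.
(* The difference is split as 1 - e ⊗ e = (1 - e) ⊗ 1 + e ⊗ (1 - e), with e = [sec]; E1 and E2 bound
   the two summands. *)
have E1 : tmap (d p.+1 \o homot R p) idfun (z p q)
    + (-1) ^+ p *: tmap idfun (d q.+1) (A p q.+1) =
    -1 *: tmap (sec p) idfun (z p q) + z p q.
  rewrite -secl; case: p {secr} => [|p].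
    rewrite -[A 0 q.+1]/(0 : V 0 ⊗ V q.+1) tmap0 scaler0 addr0.
    by apply: tmap_eq => // x; rewrite -[LHS]homot0.
  rewrite -[A p.+1 q.+1]/(tmap (homot R p) idfun (z p q.+1)) tmap_comp.
  rewrite (@tmap_linl _ _ _ _ _ (-1) (d p.+2 \o homot R p.+1)
    (homot R p \o d p.+1) (idfun \- sec p.+1)).
    (* As z is a cycle, homot d ⊗ 1 is exchanged for homot ⊗ d up to sign. *)
    have := congr1 (tmap (homot R p) idfun) (dz p q).
    rewrite /diff2 tmap0 tmapD tmapZ !tmap_comp addn0 => /eqP.
    rewrite addr_eq0 => /eqP E; rewrite [tmap (homot R p \o _) idfun _]E.
    by parity; module k (V p.+1 ⊗ V q)%type.
  move=> x; change (d p.+2 (homot R p.+1 x) = -1 *: homot R p (d p.+1 x)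
    + (x - incl p.+1 (sect R p.+1 (ret p.+1 x)))).
  by rewrite homotS scaleN1r addrC addrK.
have E2 : tmap (sec p) (d q.+1 \o homot R q) (z p q) =
    -1 *: tmap (sec p) (sec q) (z p q) + tmap (sec p) idfun (z p q).
  rewrite -secr; case: q {E1} => [|q].
    by apply: tmap_eq => // x; rewrite -[LHS]homot0.
  rewrite (@tmap_linr _ _ _ _ _ (-1) _ (d q.+2 \o homot R q.+1)
    (homot R q \o d q.+1) (idfun \- sec q.+1)).
    have := congr1 (tmap (sec p) (homot R q)) (dz p q).
    rewrite /diff2 tmap0 tmapD tmapZ !tmap_comp tmap0l ?add0r; last exact: sec_d.
    move/(congr1 (fun t => (-1) ^+ (p + 0) *: t)); rewrite signrZK scaler0 => E.
    by rewrite [X in -1 *: X]E scaler0 add0r.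
  move=> x; change (d q.+2 (homot R q.+1 x) = -1 *: homot R q (d q.+1 x)
    + (x - incl q.+1 (sect R q.+1 (ret q.+1 x)))).
  by rewrite homotS scaleN1r addrC addrK.
have dB : tmap (d p.+1) idfun (B p.+1 q) = 0.
  rewrite /B; case: q {E1 E2} => [|q]; first exact: tmap0.
  by rewrite tmap_comp; apply: tmap0l => x; exact: incl_cycle.
rewrite /diff2 addn0 -[homot2 z p.+1 q]/(tmap (homot R p) idfun (z p q) + _ *: B p.+1 q).
rewrite -[homot2 z p q.+1]/(A p q.+1 + _ *: tmap (sec p) (homot R q) (z p q)).
rewrite !tmapD !tmapZ dB scaler0 addr0 !tmap_comp scalerDr addrA E1 scalerA.
rewrite -expr2 sqrr_sign scale1r [X in _ = _ + X]E2.
by module k (V p ⊗ V q)%type.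
Qed.

(** Tensor powers of [retr] kill boundaries and invert the Künneth maps on the left, and they
    commute with flips, which settles the coinvariants. Surjectivity is [homot2P]: each cycle is
    homologous to its image under e ⊗ e. *)
Lemma retraction_kunneth : kunneth d.
Proof.
split.
- move=> t [u [tu [w uw]]] p q; have := congr1 (tmap (ret p) (ret q)) (uw p q).
  rewrite retr2_diff tmapB tmap0 sub0r retr2 -tu => /eqP.
  by rewrite oppr_eq0 => /eqP.
- move=> z dz; pose u p q := tmap (sect R p \o ret p) (sect R q \o ret q) (z p q).
  exists (fun p q => H2 p q (u p q)), u; split=> //.
  exists (homot2 z) => p q; rewrite -homot2P // /u tmap_comp; congr (_ - _).
- move=> t [u [tu [w uw]]] p q r.
  have := congr1 (tmap (tmap (ret p) (ret q)) (ret r)) (uw p q r).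
  rewrite retr3_diff tmapB tmap0 sub0r tmap_comp => /eqP.
  rewrite oppr_eq0 => /eqP; rewrite tu => <-; apply: tmap_eq => x.
    by rewrite /= retr2.
  by rewrite /= retr_incl.
- move=> t y [u [tu [w uw]]]; exists (fun p q => tmap (ret p) (ret q) (y p q)) => p q.
  have := congr1 (tmap (ret p) (ret q)) (uw p q).
  rewrite retr2_diff !tmapB retr2 -tu /rho2 -flip_nat => /eqP.
  by rewrite subr_eq0 => /eqP <-.
Qed.
End Kunneth.
End FieldKunneth.

Theorem field_kunneth (k : comNzRingType) (V : nat -> lmodType k)
    (d : forall n, {linear V n -> V n.-1}) :
  is_field k -> (forall n x, d n.-1 (d n x) = 0) -> (forall x, d 0 x = 0) ->
  kunneth d.
Proof.
move=> k_field dd d0.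
have inv n := cid (generalized_inverse k_field (d n.+1)).
exact: retraction_kunneth (exists_retraction dd d0 (fun n => svalP (inv n))).
Qed.

Theorem theorem4p8 (k : comNzRingType) (C : comult_cooperad k) :
  gerstenhaber_mod_boundaries (@coop_diff k C) (@cup_coproduct k C)
    (@cobracket k C)
  /\
  (is_field k \/ kunneth (@coop_diff k C) ->
   exists cupH cobrH : coop (homology (@coop_diff k C)),
     [/\ induced_coop 0 (@cup_coproduct k C) cupH,
         induced_coop 1 (@cobracket k C) cobrH,
         (forall cupH' cobrH' : coop (homology (@coop_diff k C)),
            induced_coop 0 (@cup_coproduct k C) cupH' ->
            induced_coop 1 (@cobracket k C) cobrH' ->
            forall n p q (x : homology (@coop_diff k C) n),
              cupH' n p q x = cupH n p q x /\ cobrH' n p q x = cobrH n p q x)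
       & gerstenhaber_coalgebra cupH cobrH]).
Proof.
have gmb := coop_gerstenhaber_mod_boundaries C; split=> // field_or_kunneth.
have kun : kunneth (@coop_diff k C).
  case: field_or_kunneth => // k_field; apply: field_kunneth => //.
    exact: diff_diff gmb.
  exact: coop_diff0.
by apply: homology_gerstenhaber_coalgebra kun => // n p q ne x;
  [exact: cup_coproduct_deg|exact: cobracket_deg].
Qed.
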